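(* Suppose that $I_+$ is empty and that no group $\mathbf{H}_i$ ($i\in I_0$) is $(E_i)_0$-isomorphic to $\mathbf{O}^{is}_2$. Then there exists only one (i.e. exactly one) CLF-map from $\mathfrak{B}^1(H)$ to $\mathfrak{B}^1(G)$.
   Context: **Basic setting.** $k$ is a non-Archimedean local field of odd residue characteristic; $D$ is a division algebra with centre $k$ and finite index $d$; $\nu$ is the valuation on $k$ with $\nu(k^\times)=\mathbb{Z}$, extended uniquely to $D$ and to every finite-dimensional division algebra over $k$; $\rho$ is an involution on $D$ (a ring isomorphism $D\to D^{op}$ of order one or two); $k_0$ is the fixed field of $\rho$ in $k$; $\bar k$ is an algebraic closure of $k$. For a division algebra $D'$ with discrete valuation, $o_{D'}$ and $\mathfrak{p}_{D'}$ are its valuation ring and maximal ideal. $V$ is an $m$-dimensional right $D$-vector space, $\epsilon\in\{1,-1\}$, $h:V\times V\to D$ is a non-degenerate $\epsilon$-hermitian form (biadditive, $h(v_1\lambda_1,v_2\lambda_2)=\epsilon\rho(\lambda_1)\rho(h(v_2,v_1))\lambda_2$), and $\sigma$ is its adjoint involution on $\mathrm{End}_D(V)$. $\mathbf{G}=\mathbf{U}(h)=\mathbf{U}(\sigma)$ is the unitary group over $k_0$, $G=\mathbf{G}(k_0)=\{g\in \mathrm{End}_D(V): \sigma(g)g=1\}$, $\mathfrak{g}=\mathrm{Lie}(\mathbf{G})(k_0)=\{a\in\mathrm{End}_D(V):\sigma(a)=-a\}$. **The group $\mathbf{O}_2^{is}$** is the algebraic group $\left\{\begin{pmatrix}\lambda&0\\0&\lambda^{-1}\end{pmatrix},\begin{pmatrix}0&\lambda\\\lambda^{-1}&0\end{pmatrix}:\lambda\in\bar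 k^\times\right\}$, defined over the prime field (the isotropic orthogonal group of rank one). **Lattice functions.** An $o_D$-lattice function in $V$ is a family $(\Lambda(r))_{r\in\mathbb{R}}$ of (full) $o_D$-lattices in $V$ with $\Lambda(r)\supseteq\Lambda(s)$ for $r<s$, $\Lambda(r)=\bigcap_{t<r}\Lambda(t)$, $\Lambda(r)\mathfrak{p}_D=\Lambda(r+\frac1d)$. $\mathrm{Latt}^1_{o_D}(V)$ is the set of these. The dual of $\Lambda$ is $\Lambda^{\#}(t)=\{v\in V: h(v,\Lambda(s))\subseteq\mathfrak{p}_D\text{ for all }s>-t\}$; $\mathrm{Latt}^1_h(V)$ is the set of self-dual ones. $G$ acts by $(g.\Lambda)(t)=g(\Lambda(t))$. The extended Bruhat–Tits building $\mathfrak{B}^1(G)=\mathfrak{B}^1(\mathbf{G},k_0)$ is identified, by the unique affine $G$-equivariant bijection, with $\mathrm{Latt}^1_h(V)$. The square lattice function of $\Lambda$ is $\tilde{\mathfrak{g}}_\Lambda(t)=\{a\in\mathrm{End}_D(V): a\Lambda(s)\subseteq\Lambda(s+t)\ \forall s\in\mathbb{R}\}$; the Lie algebra filtration of $\Lambda\in\mathfrak{B}^1(G)$ is $\mathfrak{g}_\Lambda(t)=\tilde{\mathfrak{g}}_\Lambda(t)\cap\mathfrak{g}$. **Centralizer.** $\beta\in\mathfrak{g}$ is such that $E:=k[\beta]\subseteq\mathrm{End}_D(V)$ is a product of fields $E_i$ ($i\in I$) with identity elements $1_i$; $V_i=1_iV$. $\sigma$ acts on $I$ by $\sigma(1_i)=1_{\sigma(i)}$;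 write $-i=\sigma(i)$; $I_0$ is the fixed point set, and $I\setminus I_0=I_+\sqcup I_-$ with $\sigma(I_+)=I_-$. For $i\in I_0$, $(E_i)_0$ is the set of $\sigma$-fixed points in $E_i$; for $i\in I_+$, $(E_i)_0=E_i$. $H$ is the centralizer of $\beta$ in $G$. For each $i$, fix an $E_i$-algebra isomorphism of $\mathrm{End}_{E_i\otimes_kD}(V_i)$ (the centralizer of $E_i$ in $\mathrm{End}_D(V_i)$) with $\mathrm{End}_{D'_i}(V'_i)$, where $D'_i$ is a division algebra of finite index central over $E_i$ and $V_i'$ a finite-dimensional right $D_i'$-vector space. Put $\mathbf{H}_i=\mathbf{U}(\sigma|_{\mathrm{End}_{D'_i}(V'_i)})$ for $i\in I_0$, $\mathbf{H}_i=\mathbf{GL}_{D'_i}(V'_i)$ for $i\in I_+$, $H_i=\mathbf{H}_i((E_i)_0)$. Canonically $H\cong\prod_{i\in I_0\cup I_+}H_i$, and $\mathfrak{B}^1(H):=\prod_{i\in I_0\cup I_+}\mathfrak{B}^1(\mathbf{H}_i,(E_i)_0)$. Here $\mathfrak{B}^1(\mathbf{H}_i,(E_i)_0)$ is identified (affinely and $H_i$-equivariantly) with $\mathrm{Latt}^1_{o_{D'_i}}(V'_i)$ for $i\in I_+$ and with the self-dual elements $\mathrm{Latt}^1_{h_i}(V'_i)$ for $i\in I_0$, where $h_i$ is a fixed signed hermitian form on $V'_i$ with adjoint involution $\sigma|_{\mathrm{End}_{D'_i}(V'_i)}$; lattice functions over $D'_i$ are normalized via the extension of $\nu$, i.e.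 $\Lambda(r)\pi=\Lambda(r+\nu(\pi))$ for a uniformizer $\pi$ of $D'_i$. The Lie algebra of $H$ is $\mathfrak{h}=\bigoplus_{i\in I_0\cup I_+}\mathfrak{h}_i$, with $\mathfrak{h}_i=\{a\in\mathrm{End}_{E_i\otimes_kD}(V_i):\sigma(a)=-a\}$ for $i\in I_0$ and $\mathfrak{h}_i=\mathrm{End}_{E_i\otimes_kD}(V_i)$ for $i\in I_+$; it embeds in $\mathfrak{g}$ by $(a_i)\mapsto\sum_{i\in I_0}a_i+\sum_{i\in I_+}(a_i-\sigma(a_i))$. For $x=(x_i)\in\mathfrak{B}^1(H)$, $\mathfrak{h}_x(t)=\bigoplus_i\mathfrak{h}_{x_i}(t)$, where $\mathfrak{h}_{x_i}$ is the square lattice function of $x_i$ for $i\in I_+$ and its intersection with $\mathfrak{h}_i$ for $i\in I_0$. **CLF.** A map $f:\mathfrak{B}^1(H)\to\mathfrak{B}^1(G)$ (no further property assumed) is a CLF-map (compatible with the Lie algebra filtrations) if $\mathfrak{h}_x(t)=\mathfrak{h}\cap\mathfrak{g}_{f(x)}(t)$ (inside $\mathfrak{g}$) for all $x\in\mathfrak{B}^1(H)$, $t\in\mathbb{R}$. *)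

(* Defs.v *)
From HB Require Import structures.
From mathcomp Require Import all_boot all_order all_algebra all_field.
From mathcomp Require Import boolp classical_sets reals constructive_ereal.
From mathcomp Require mpoly.

Set Implicit Arguments.
Unset Strict Implicit.
Unset Printing Implicit Defensive.

Import Order.TTheory GRing.Theory Num.Theory.

Local Open Scope classical_set_scope.
Local Open Scope ring_scope.

(* Conventions.  A right D-vector space is a left vector space over the       *)
(* converse ring D^c: the vector v.x is written (x : D^c) *: v.  For such a V,*)
(* 'End(V) is End_D(V), and composition (f \o g)%VF sends v to f (g v).       *)
(* Valuations take values in \bar R, with the value +oo exactly at 0.         *)

Section Valuations.
Variable R : realType.
Implicit Types A D : nzRingType.

Record is_valuation A (v : A -> \bar R) : Prop := {
  val_eqy : forall x, v x = +oo%E <-> x = 0;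
  val_mul : forall x y, v (x * y) = (v x + v y)%E;
  val_add : forall x y, (Order.min (v x) (v y) <= v (x + y)%R)%E }.

Definition valuation_ring A (v : A -> \bar R) : set A :=
  [set x | (0 <= v x)%E].

Definition maximal_ideal A (v : A -> \bar R) : set A :=
  [set x | (0 < v x)%E].

Record is_uniformizer A (v : A -> \bar R) (p : A) : Prop := {
  unif_neq0 : p != 0;
  unif_gt0 : maximal_ideal v p;
  unif_min : forall x, maximal_ideal v x -> (v p <= v x)%E }.

Record is_odd_local_field (k : fieldType) (nu : k -> \bar R) : Prop := {
  lf_val : is_valuation nu;
  lf_int : forall x, x != 0 -> exists n : int, nu x = (n%:~R)%:E;
  lf_onto : forall n : int, exists2 x, x != 0 & nu x = (n%:~R)%:E;
  lf_complete : forall u : nat -> k,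
    (forall n : nat, exists N : nat, forall p q : nat,
        (N <= p)%N -> (N <= q)%N -> ((n%:R)%:E <= nu (u p - u q)%R)%E) ->
    exists l, forall n : nat, exists N : nat, forall p : nat,
        (N <= p)%N -> ((n%:R)%:E <= nu (u p - l)%R)%E;
  lf_finite : exists s : seq k, forall x, valuation_ring nu x ->
    exists2 y, y \in s & maximal_ideal nu (x - y);
  lf_odd : exists p : nat, [/\ prime p, odd p & maximal_ideal nu p%:R] }.

Record is_central_division (k : fieldType) (D : falgType k) : Prop := {
  cd_division : forall x : D, x != 0 -> x \is a GRing.unit;
  cd_central : forall z : D, (forall x, z * x = x * z) ->
    exists c : k, z = c%:A }.

Record is_ring_involution D (rho : D -> D) : Prop := {
  inv_add : forall x y, rho (x + y) = rho x + rho y;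
  inv_one : rho 1 = 1;
  inv_mul : forall x y, rho (x * y) = rho y * rho x;
  inv_invol : forall x, rho (rho x) = x }.

Section RightSpace.
Variables (D : nzRingType) (V : vectType D^c).

(* Meant for z central in D; otherwise v |-> v.z is not D-linear. *)
Definition homothety (z : D) : 'End(V) := linfun (fun v => (z : D^c) *: v).

Record is_signed_hermitian (rho : D -> D) (eps : D) (h : V -> V -> D) :
    Prop := {
  sh_inv : is_ring_involution rho;
  sh_sign : eps = 1 \/ eps = -1;
  sh_addl : forall v1 v2 w, h (v1 + v2) w = h v1 w + h v2 w;
  sh_addr : forall v w1 w2, h v (w1 + w2) = h v w1 + h v w2;
  sh_herm : forall v1 v2 (l1 l2 : D),
    h ((l1 : D^c) *: v1) ((l2 : D^c) *: v2) =
      eps * rho l1 * rho (h v2 v1) * l2;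
  sh_nondeg : forall v, (forall w, h v w = 0) -> v = 0 }.

Definition is_adjoint (h : V -> V -> D) (s : 'End(V) -> 'End(V)) : Prop :=
  forall (a : 'End(V)) v w, h (a v) w = h v (s a w).

Variable v : D -> \bar R.

Definition is_lattice (L : set V) : Prop :=
  exists (n : nat) (g : 'I_n -> V),
    (L = [set w | exists2 c : 'I_n -> D, (forall i, valuation_ring v (c i))
                    & w = \sum_(i < n) (c i : D^c) *: g i]) /\
    (forall w, exists c : 'I_n -> D, w = \sum_(i < n) (c i : D^c) *: g i).

Definition mul_maximal_ideal (L : set V) : set V :=
  [set w | exists (n : nat) (g : 'I_n -> V) (c : 'I_n -> D),
     [/\ forall i, L (g i), forall i, maximal_ideal v (c i)
       & w = \sum_(i < n) (c i : D^c) *: g i]].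

(* q is the valuation of a uniformizer: 1/d for a central division algebra of *)
(* index d over k.                                                            *)
Record is_lattice_function (q : R) (L : R -> set V) : Prop := {
  latf_lattice : forall r, is_lattice (L r);
  latf_decr : forall r s, r < s -> L s `<=` L r;
  latf_left : forall r, L r = [set w | forall t, t < r -> L t w];
  latf_period : forall r, mul_maximal_ideal (L r) = L (r + q) }.

Definition dual_lattice_function (h : V -> V -> D) (L : R -> set V) :
    R -> set V :=
  fun t => [set w | forall s, - t < s ->
                    forall u, L s u -> maximal_ideal v (h w u)].

Definition square_lattice_function (L : R -> set V) : R -> set 'End(V) :=
  fun t => [set a : 'End(V) | forall s u, L s u -> L (s + t) (a u)].

End RightSpace.
End Valuations.

(* Linear algebraic groups as closed subsets of K^n, with K algebraically     *)
(* closed; an F-isomorphism is given by polynomial maps over F in both        *)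
(* directions.  This is the usual notion for closed subsets defined over F,   *)
(* which unitary groups are, being smooth when the characteristic is not 2.   *)
Section AlgebraicGroups.

Record affine_group (K : fieldType) := AffineGroup {
  ag_dim : nat;
  ag_points : set 'rV[K]_ag_dim;
  ag_mul : 'rV[K]_ag_dim -> 'rV[K]_ag_dim -> 'rV[K]_ag_dim }.
Arguments ag_points {K} a _.
Arguments ag_mul {K} a x y.

Definition poly_map (F K : fieldType) (f : F -> K) (n m : nat)
    (P : 'I_m -> mpoly.mpoly n F) (x : 'rV[K]_n) : 'rV[K]_m :=
  \row_j mpoly.mmap f (fun i => x 0 i) (P j).

Definition isomorphic_over (F K : fieldType) (f : {rmorphism F -> K})
    (G1 G2 : affine_group K) : Prop :=
  exists (P : 'I_(ag_dim G2) -> mpoly.mpoly (ag_dim G1) F)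
         (Q : 'I_(ag_dim G1) -> mpoly.mpoly (ag_dim G2) F),
    [/\ forall x, ag_points G1 x -> ag_points G2 (poly_map f P x),
        forall y, ag_points G2 y -> ag_points G1 (poly_map f Q y),
        forall x, ag_points G1 x -> poly_map f Q (poly_map f P x) = x,
        forall y, ag_points G2 y -> poly_map f P (poly_map f Q y) = y
      & forall x y, ag_points G1 x -> ag_points G1 y ->
          poly_map f P (ag_mul G1 x y) =
            ag_mul G2 (poly_map f P x) (poly_map f P y)].

(* The four coordinates are the entries of a 2 x 2 matrix. *)
Definition O2is (K : fieldType) : affine_group K :=
  @AffineGroup K ((1 + 1) * (1 + 1))
    [set x | exists2 l : K, l != 0 &
       x = mxvec (block_mx l%:M 0 0 (l^-1)%:M : 'M[K]_(1 + 1)) \/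
       x = mxvec (block_mx 0 l%:M (l^-1)%:M 0 : 'M[K]_(1 + 1))]
    (fun x y => mxvec (vec_mx x *m vec_mx y)).

(* For a finite-dimensional F-algebra A with an F-linear involution s, and F- *)
(* linear coordinates co : A -> F^n with inverse oc, the group of points g of *)
(* K (x)_F A = K^n with s(g) g = 1.                                           *)
Section Unitary.
Variables (F K : fieldType) (f : {rmorphism F -> K}).
Variables (A : zmodType) (scale : F -> A -> A) (mul : A -> A -> A) (one : A).
Variables (s : A -> A) (n : nat) (co : A -> 'rV[F]_n) (oc : 'rV[F]_n -> A).

Record is_coordinates : Prop := {
  co_add : forall a b, co (a + b) = co a + co b;
  co_scale : forall c a, co (scale c a) = c *: co a;
  coK : cancel co oc;
  ocK : cancel oc co }.

Definition ext_basis (i : 'I_n) : A := oc (delta_mx 0 i).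

Definition ext_mul (x y : 'rV[K]_n) : 'rV[K]_n :=
  \sum_(i < n) \sum_(j < n)
     (x 0 i * y 0 j) *: map_mx f (co (mul (ext_basis i) (ext_basis j))).

Definition ext_inv (x : 'rV[K]_n) : 'rV[K]_n :=
  \sum_(i < n) x 0 i *: map_mx f (co (s (ext_basis i))).

Definition unitary_group : affine_group K :=
  @AffineGroup K n [set x | ext_mul (ext_inv x) x = map_mx f (co one)] ext_mul.

End Unitary.
End AlgebraicGroups.

Record hermitian_space (R : realType) := HermitianSpace {
  hs_k : fieldType;
  hs_nu : hs_k -> \bar R;
  hs_local : is_odd_local_field hs_nu;
  hs_D : falgType hs_k;
  hs_division : is_central_division hs_D;
  hs_index : nat;
  hs_indexP : \dim {:hs_D} = (hs_index ^ 2)%N;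
  hs_val : hs_D -> \bar R;
  hs_valP : is_valuation hs_val;
  hs_val_ext : forall c : hs_k, hs_val c%:A = hs_nu c;
  hs_V : vectType hs_D^c;
  hs_rho : hs_D -> hs_D;
  hs_eps : hs_D;
  hs_h : hs_V -> hs_V -> hs_D;
  hs_herm : is_signed_hermitian hs_rho hs_eps hs_h;
  hs_sigma : 'End(hs_V) -> 'End(hs_V);
  hs_adjoint : is_adjoint hs_h hs_sigma }.

Section Buildings.
Variables (R : realType) (X : hermitian_space R).

Definition lieG : set 'End(hs_V X) := [set a | hs_sigma a = - a].

(* The extended building B^1(G), as Latt^1_h(V). *)
Definition buildingG : Type :=
  {L : R -> set (hs_V X) |
    is_lattice_function (@hs_val R X) (hs_index X)%:R^-1 L /\
    dual_lattice_function (@hs_val R X) (@hs_h R X) L = L}.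

Definition lieG_filtration (L : buildingG) (t : R) :
    set 'End(hs_V X) :=
  square_lattice_function (sval L) t `&` lieG.

Definition in_adjoin (beta a : 'End(hs_V X)) : Prop :=
  exists p : {poly hs_k X}, forall v : hs_V X,
    a v = \sum_(i < size p) ((p`_i)%:A : (hs_D X)^c) *: iter i beta v.

(* An element beta of Lie(G) with k[beta] a product of fields E_i, embedded by*)
(* iota_i into End_D(V) with iota_i(1) = 1_i, together with all the choices   *)
(* made to describe its centralizer: cz_sI is the action of sigma on I, cz_E0 *)
(* is (E_i)_0 with cz_Ebar an algebraic closure, and cz_D, cz_V, cz_h are     *)
(* D'_i, V'_i, h_i.  The centralizer of E_i in End_D(V_i) is seen inside      *)
(* End_D(V) as the set of a = 1_i a commuting with E_i, and cz_psi identifies *)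
(* End_{D'_i}(V'_i) with it.  cz_E0 is unconstrained outside I_0 and I_+, and *)
(* cz_sigma, cz_rho, cz_eps, cz_h are unconstrained outside I_0.              *)
Record centralizer_datum (beta : 'End(hs_V X)) := CentralizerDatum {
  cz_beta : lieG beta;
  cz_I : finType;
  cz_E : cz_I -> fieldExtType (hs_k X);
  cz_iota : forall i, cz_E i -> 'End(hs_V X);
  cz_iotaD : forall i (x y : cz_E i),
    cz_iota (x + y) = cz_iota x + cz_iota y;
  cz_iotaM : forall i (x y : cz_E i),
    cz_iota (x * y) = (cz_iota x \o cz_iota y)%VF;
  cz_iotaZ : forall i (c : hs_k X) (x : cz_E i) v,
    cz_iota (c *: x) v = (c%:A : (hs_D X)^c) *: cz_iota x v;
  cz_iota_inj : forall i, injective (@cz_iota i);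
  cz_ortho : forall i j, i != j ->
    (cz_iota (1 : cz_E i) \o cz_iota (1 : cz_E j))%VF = 0;
  cz_sum1 : \sum_i cz_iota (1 : cz_E i) = \1%VF;
  cz_adjoin : forall a, in_adjoin beta a <->
    exists x : (forall i, cz_E i), a = \sum_i cz_iota (x i);
  cz_sI : cz_I -> cz_I;
  cz_sIP : forall i, hs_sigma (cz_iota (1 : cz_E i)) =
                     cz_iota (1 : cz_E (cz_sI i));
  cz_I0 := [set i | cz_sI i == i]%SET;
  cz_Ip : {set cz_I};
  cz_Ip_cover : (cz_Ip :|: cz_sI @: cz_Ip = ~: cz_I0)%SET;
  cz_Ip_disj : (cz_Ip :&: cz_sI @: cz_Ip)%SET = finset.set0;
  cz_E0 : cz_I -> fieldType;
  cz_incl : forall i, {rmorphism cz_E0 i -> cz_E i};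
  cz_inclP : forall i, i \in cz_I0 -> forall x : cz_E i,
    (exists y, cz_incl i y = x) <-> hs_sigma (cz_iota x) = cz_iota x;
  cz_incl_plus : forall i, i \in cz_Ip -> forall x : cz_E i,
    exists y, cz_incl i y = x;
  cz_Ebar : cz_I -> closedFieldType;
  cz_tau : forall i, {rmorphism cz_E0 i -> cz_Ebar i};
  cz_tau_alg : forall i (z : cz_Ebar i), algebraicOver (cz_tau i) z;
  cz_D : forall i, falgType (cz_E i);
  cz_division : forall i, is_central_division (cz_D i);
  cz_val : forall i, cz_D i -> \bar R;
  cz_valP : forall i, is_valuation (@cz_val i);
  cz_val_ext : forall i (c : hs_k X),
    @cz_val i ((c%:A : cz_E i)%:A) = @hs_nu R X c;
  cz_pi : forall i, cz_D i;
  cz_piP : forall i, is_uniformizer (@cz_val i) (cz_pi i);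
  cz_V : forall i, vectType (cz_D i)^c;
  cz_psi : forall i, 'End(cz_V i) -> 'End(hs_V X);
  cz_psiD : forall i (a b : 'End(cz_V i)),
    cz_psi (a + b) = cz_psi a + cz_psi b;
  cz_psiM : forall i (a b : 'End(cz_V i)),
    cz_psi (a \o b)%VF = (cz_psi a \o cz_psi b)%VF;
  cz_psiE : forall i (x : cz_E i),
    cz_psi (homothety (cz_V i) x%:A) = cz_iota x;
  cz_psi_inj : forall i, injective (@cz_psi i);
  cz_psi_image : forall i (a : 'End(hs_V X)),
    (exists b : 'End(cz_V i), cz_psi b = a) <->
    (cz_iota (1 : cz_E i) \o a)%VF = a /\
    forall x : cz_E i, (cz_iota x \o a)%VF = (a \o cz_iota x)%VF;
  cz_sigma : forall i, 'End(cz_V i) -> 'End(cz_V i);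
  cz_sigmaP : forall i, i \in cz_I0 -> forall a : 'End(cz_V i),
    cz_psi (cz_sigma a) = hs_sigma (cz_psi a);
  cz_rho : forall i, cz_D i -> cz_D i;
  cz_eps : forall i, cz_D i;
  cz_h : forall i, cz_V i -> cz_V i -> cz_D i;
  cz_herm : forall i, i \in cz_I0 ->
    is_signed_hermitian (@cz_rho i) (cz_eps i) (@cz_h i);
  cz_adjoint : forall i, i \in cz_I0 -> is_adjoint (@cz_h i) (@cz_sigma i) }.

Section Centralizer.
Variables (beta : 'End(hs_V X)) (Y : centralizer_datum beta).

(* For i in I_0.  Changing the coordinates changes the group presented below  *)
(* by an (E_i)_0-linear isomorphism, so their choice is immaterial.           *)
Definition H_is_O2is (i : cz_I Y) : Prop :=
  exists (n : nat) (co : 'End(cz_V i) -> 'rV[cz_E0 i]_n)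
         (oc : 'rV[cz_E0 i]_n -> 'End(cz_V i)),
    is_coordinates
      (fun c a => (homothety (cz_V i) (cz_incl i c)%:A \o a)%VF) co oc /\
    isomorphic_over (cz_tau i)
      (unitary_group (cz_tau i) (fun a b => (a \o b)%VF) \1%VF
         (@cz_sigma beta Y i) co oc)
      (O2is (cz_Ebar i)).

Definition factorH : finType := {i : cz_I Y | i \in cz_I0 Y :|: cz_Ip Y}%SET.

Definition buildingH : Type :=
  {x : forall j : factorH, R -> set (cz_V (val j)) |
    forall j : factorH,
      is_lattice_function (@cz_val beta Y (val j))
        (fine (cz_val (cz_pi (val j)))) (x j) /\
      (val j \in cz_I0 Y ->
        dual_lattice_function (@cz_val beta Y (val j))
          (@cz_h beta Y (val j)) (x j) = x j)}.

Definition lieH_mem (b : forall j : factorH, 'End(cz_V (val j))) : Prop :=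
  forall j : factorH, val j \in cz_I0 Y -> cz_sigma (b j) = - b j.

Definition lieH_embed (b : forall j : factorH, 'End(cz_V (val j))) :
    'End(hs_V X) :=
  \sum_(j : factorH) if val j \in cz_I0 Y then cz_psi (b j)
                     else cz_psi (b j) - hs_sigma (cz_psi (b j)).

Definition lieH : set 'End(hs_V X) :=
  [set a | exists2 b, lieH_mem b & a = lieH_embed b].

Definition lieH_filtration (x : buildingH) (t : R) :
    set 'End(hs_V X) :=
  [set a | exists b, [/\ lieH_mem b,
     forall j, square_lattice_function (sval x j) t (b j)
     & a = lieH_embed b]].

Definition is_CLF (f : buildingH -> buildingG) : Prop :=
  forall x t, lieH_filtration x t = lieH `&` lieG_filtration (f x) t.

End Centralizer.
End Buildings.

(* Main.v *)
(* Points of the building are seen as norms on V.  As I_+ is empty, sigma preserves every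
   summand V_i, and x_i prescribes a filtration F_i of the centralizer of E_i in End_D(V_i).

   Existence: among the norms on V for which the operators of all F_i are bounded as
   prescribed there is, below any given norm, a largest one, and duality preserves this
   property.  Two such norms differ on each V_i by an additive constant.  Indeed D is k
   or, since it has an involution and the residue characteristic is odd, a quaternion algebra
   with a basis 1, i, j, ij of anticommuting elements: averaging over this basis, the norms
   define the same bounds for all E_i-linear operators of V_i, not only for the D-linear ones,
   and operators of rank one over E_i compare the norms of any two vectors.
   Translating a norm by half of its distance to the dual gives a self-dual norm, and rank one
   operators show that it induces no more than F_i on the centralizer.

   Uniqueness: if E_i contains a skew element e <> 0, then a symmetric operator b is the
   product of the skew operator b e with e^-1, so the skew operators determine the filtration
   of the whole centralizer, and self-duality fixes the additive constant.  This fails for at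
   most one i, with E_i = k fixed by sigma.  There, two self-dual norms defining the same
   bounds for the skew operators e h(u, .) - eps u h(e, .) must agree, unless D = k, eps = 1
   and V_i is a hyperbolic plane; but then H_i is O_2^is. *)

From HB Require Import structures.
Require Import Defs.
From mathcomp Require Import all_boot all_order all_algebra all_field all_fingroup all_solvable.
From mathcomp Require Import zify ring lra.
From mathcomp Require Import boolp classical_sets reals constructive_ereal.
From mathcomp Require mpoly.

Set Implicit Arguments.
Unset Strict Implicit.
Unset Printing Implicit Defensive.

Import Order.TTheory GRing.Theory Num.Theory.

Local Open Scope classical_set_scope.
Local Open Scope ring_scope.

(** * Valuations and filtrations *)

(** The index of [D] is at most two because conjugation by a uniformizer acts on the residue field
    as a power map, which the anti-automorphism [rho] turns into its inverse: its square is trivial.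
    This presupposes that involutions preserve the valuation. On [k] they do, since elements
    congruent to 1 have roots of every order [2 ^ n], an algebraic property that forces the integral
    value of their images to be 0. The averaging answers an obstacle: an operator of rank one over
    [E_i] need not be [D]-linear, so the prescribed bounds say nothing about it directly. A
    compatible norm induces no more than [F_i] because a nonzero idempotent cannot raise a norm by a
    positive amount. The component of [beta] in [E_i] is itself skew; where there is no nonzero skew
    element it vanishes, polynomials in [beta] act by their constant term, and therefore [E_i = k]
    for a single [i]. There a vector that nearly maximizes the difference of the two norms, with a
    partner that nearly attains duality, spans the hyperbolic plane. *)

Section ValuationTheory.
Variables (R : realType) (A : nzRingType) (v : A -> \bar R).
Hypothesis hv : is_valuation v.
Implicit Types (x y : A) (r s : R).

(** At 0 this is the default value 0 of [fine], not infinity; statements that must cover 0 correctly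
    are phrased with [vge]. *)
Definition vr x : R := fine (v x).

Definition vge r x : Prop := (r%:E <= v x)%E.

Lemma val0 : v 0 = +oo%E.
Proof. by apply/(val_eqy hv). Qed.

Lemma val_fin x : x != 0 -> v x = (vr x)%:E.
Proof.
move=> x0; rewrite /vr fineK // fin_numE; apply/andP; split; last first.
  by apply/eqP => /(val_eqy hv) /eqP; rewrite (negbTE x0).
apply/eqP => vx.
(* The value [-oo] is excluded by [v (0 * x) = v 0 + v x], because [+oo] plus [-oo] is [-oo]. *)
by have := val_mul hv 0 x; rewrite mul0r val0 vx.
Qed.

Lemma vgeE r x : x != 0 -> vge r x <-> r <= vr x.
Proof. by move=> x0; rewrite /vge val_fin // lee_fin. Qed.

Lemma vge0 r : vge r 0.
Proof. by rewrite /vge val0 leey. Qed.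

Lemma vge_vr x : vge (vr x) x.
Proof.
have [->|x0] := eqVneq x 0; first exact: vge0.
exact/vgeE.
Qed.

Lemma vge_le r s x : s <= r -> vge r x -> vge s x.
Proof. by move=> sr; apply: le_trans; rewrite lee_fin. Qed.

Lemma vge_eq0 x : (forall r, vge r x) -> x = 0.
Proof.
move=> h; apply/eqP; apply/negPn/negP => x0.
have /(vgeE _ x0) := h (vr x + 1); lra.
Qed.

Lemma mul_neq0 x y : x != 0 -> y != 0 -> x * y != 0.
Proof.
move=> x0 y0; apply/eqP => /(val_eqy hv).
by rewrite (val_mul hv) (val_fin x0) (val_fin y0).
Qed.

Lemma vrM x y : x != 0 -> y != 0 -> vr (x * y) = vr x + vr y.
Proof.
move=> x0 y0; have := val_mul hv x y.
by rewrite (val_fin x0) (val_fin y0) (val_fin (mul_neq0 x0 y0)) => -[].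
Qed.

Lemma vr1 : vr 1 = 0.
Proof.
have := vrM (oner_neq0 A) (oner_neq0 A); rewrite mulr1; lra.
Qed.

Lemma vrN1 : vr (-1) = 0.
Proof.
have n0 : (-1 : A) != 0 by rewrite oppr_eq0 oner_neq0.
have := vrM n0 n0; rewrite mulrNN mulr1 vr1; lra.
Qed.

Lemma vrN x : vr (- x) = vr x.
Proof.
have [->|x0] := eqVneq x 0; first by rewrite oppr0.
by rewrite -mulN1r vrM ?oppr_eq0 ?oner_neq0 // vrN1 add0r.
Qed.

Lemma vgeD r x y : vge r x -> vge r y -> vge r (x + y).
Proof.
move=> hx hy; apply: le_trans (val_add hv x y).
by rewrite le_min; apply/andP; split.
Qed.

Lemma vgeN r x : vge r x -> vge r (- x).
Proof.
have [->|x0] := eqVneq x 0; first by rewrite oppr0.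
by move/(vgeE _ x0) => h; apply/vgeE; rewrite ?oppr_eq0 // vrN.
Qed.

Lemma vgeB r x y : vge r x -> vge r y -> vge r (x - y).
Proof. by move=> hx hy; apply: vgeD => //; apply: vgeN. Qed.

Lemma vgeM r s x y : vge r x -> vge s y -> vge (r + s) (x * y).
Proof.
have [->|x0] := eqVneq x 0; first by rewrite mul0r => *; exact: vge0.
have [->|y0] := eqVneq y 0; first by rewrite mulr0 => *; exact: vge0.
move=> /(vgeE _ x0) hx /(vgeE _ y0) hy; apply/(vgeE _ (mul_neq0 x0 y0)).
by rewrite vrM // lerD.
Qed.

Lemma vge_sum (I : Type) (s : seq I) (P : pred I) (F : I -> A) r :
  (forall i, P i -> vge r (F i)) -> vge r (\sum_(i <- s | P i) F i).
Proof. by move=> h; apply: big_ind => //; [exact: vge0|exact: vgeD]. Qed.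

Lemma vge1 : vge 0 1.
Proof. by rewrite vgeE ?oner_neq0 // vr1. Qed.

Lemma vge_nat n : vge 0 n%:R.
Proof.
elim: n => [|n IH]; first exact: vge0.
by rewrite -addn1 natrD; apply: vgeD => //; exact: vge1.
Qed.

Lemma expr_neq0 x n : x != 0 -> x ^+ n != 0.
Proof.
by move=> x0; elim: n => [|n IH]; rewrite ?expr0 ?oner_neq0 // exprS mul_neq0.
Qed.

Lemma vrX x n : x != 0 -> vr (x ^+ n) = n%:R * vr x.
Proof.
move=> x0; elim: n => [|n IH]; first by rewrite expr0 vr1 mul0r.
by rewrite exprS vrM ?expr_neq0 // IH -[n.+1]addn1 natrD; ring.
Qed.

Lemma vgeX r x n : vge r x -> vge (n%:R * r) (x ^+ n).
Proof.
move=> hx; elim: n => [|n IH]; first by rewrite expr0 mul0r; exact: vge1.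
have -> : n.+1%:R * r = r + n%:R * r by rewrite -[n.+1]addn1 natrD; ring.
by rewrite exprS; apply: vgeM.
Qed.

Lemma vr_ge r x : x != 0 -> vge r x -> r <= vr x.
Proof. by move=> x0 /(vgeE _ x0). Qed.

(** The ultrametric principle that a perturbation of strictly larger value leaves the value
    unchanged. *)
Lemma vr_dom x y r : x != 0 -> vr x < r -> vge r (y - x) -> y != 0 /\ vr y = vr x.
Proof.
move=> x0 xr hyx.
have y0 : y != 0.
  apply/eqP => ye; move: hyx; rewrite ye sub0r => /vgeN; rewrite opprK.
  by move/(vr_ge x0); rewrite leNgt xr.
split=> //; apply/eqP; rewrite eq_le; apply/andP; split; last first.
  apply: (vr_ge y0); have -> : y = x + (y - x) by rewrite addrC subrK.
  by apply: vgeD; [exact: vge_vr|apply: vge_le hyx; exact: ltW].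
have h : vge (Num.min (vr y) r) x.
  have -> : x = y - (y - x) by rewrite opprB addrC subrK.
  apply: vgeB; first by apply: vge_le (vge_vr y); rewrite ge_min lexx.
  by apply: vge_le hyx; rewrite ge_min lexx orbT.
have := vr_ge x0 h; rewrite ge_min => /orP[//|]; lra.
Qed.

Definition vpos x : Prop := maximal_ideal v x.

Lemma vposE x : x != 0 -> vpos x <-> 0 < vr x.
Proof. by move=> x0; rewrite /vpos /maximal_ideal /= val_fin // lte_fin. Qed.

Lemma vpos0 : vpos 0.
Proof. by rewrite /vpos /maximal_ideal /= val0 lt0y. Qed.

Lemma vposN x : vpos x -> vpos (- x).
Proof.
have [->|x0] := eqVneq x 0; first by rewrite oppr0.
by move/(vposE x0) => h; apply/vposE; rewrite ?oppr_eq0 // vrN.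
Qed.

Lemma vpos_ge r x : 0 < r -> vge r x -> vpos x.
Proof. by move=> r0; apply: lt_le_trans; rewrite lte_fin. Qed.

Lemma vpos_ge0 x : vpos x -> vge 0 x.
Proof. exact: ltW. Qed.

Lemma vpos_exge x : vpos x -> exists2 r, 0 < r & vge r x.
Proof.
have [-> _|x0] := eqVneq x 0; first by exists 1 => //; exact: vge0.
by move/(vposE x0) => h; exists (vr x) => //; exact: vge_vr.
Qed.

Lemma vposD x y : vpos x -> vpos y -> vpos (x + y).
Proof.
move=> /vpos_exge[r r0 hx] /vpos_exge[s s0 hy].
apply: (@vpos_ge (Num.min r s)); first by rewrite lt_min r0.
by apply: vgeD; [apply: vge_le hx|apply: vge_le hy]; rewrite ge_min lexx ?orbT.
Qed.

Lemma vposB x y : vpos x -> vpos y -> vpos (x - y).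
Proof. by move=> hx hy; apply: vposD => //; exact: vposN. Qed.

Lemma vpos_sum (I : Type) (s : seq I) (P : pred I) (F : I -> A) :
  (forall i, P i -> vpos (F i)) -> vpos (\sum_(i <- s | P i) F i).
Proof. by move=> h; apply: big_ind => //; [exact: vpos0|exact: vposD]. Qed.

Lemma vposMl x y : vpos x -> vge 0 y -> vpos (x * y).
Proof.
move=> /vpos_exge[r r0 hx] hy; apply: (vpos_ge r0).
by rewrite -[r]addr0; exact: vgeM.
Qed.

Lemma vposMr x y : vge 0 x -> vpos y -> vpos (x * y).
Proof.
move=> hx /vpos_exge[r r0 hy]; apply: (vpos_ge r0).
by rewrite -[r]add0r; exact: vgeM.
Qed.

Lemma vge0_pos x : x != 0 -> vge 0 x -> ~ vpos x -> vr x = 0.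
Proof.
move=> x0 /(vr_ge x0) h1 h2; apply/eqP; rewrite eq_le h1 andbT leNgt.
by apply/negP => /(vposE x0).
Qed.

End ValuationTheory.

Lemma vrV (R : realType) (A : unitRingType) (v : A -> \bar R) (x : A) :
  is_valuation v -> x \is a GRing.unit -> vr v x^-1 = - vr v x.
Proof.
move=> hv ux; have x0 : x != 0 by apply: contraTneq ux => ->; rewrite unitr0.
have x'0 : x^-1 != 0.
  by apply: contraTneq ux => h; rewrite -unitrV h unitr0.
by have := vrM hv x0 x'0; rewrite mulrV // (vr1 hv); lra.
Qed.

Section Filtrations.
Variables (R : realType).

(** A norm given by its balls: [L r] collects the elements of norm at least [r]. Left continuity
    lets the norm be attained, and the last two fields make it finite exactly away from 0. *)
Record filtration (M : zmodType) (L : R -> set M) : Prop := {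
  fil_0 : forall r, L r 0;
  fil_sub : forall r x y, L r x -> L r y -> L r (x - y);
  fil_le : forall r s x, s <= r -> L r x -> L s x;
  fil_left : forall r x, (forall s, s < r -> L s x) -> L r x;
  fil_exh : forall x, exists r, L r x;
  fil_sep : forall x, (forall r, L r x) -> x = 0 }.

(** In additive notation: the operator norm of [g] is at least [c]. *)
Definition shifts (M N : zmodType) (L : R -> set M) (L' : R -> set N) (c : R)
    (g : M -> N) : Prop := forall s u, L s u -> L' (s + c) (g u).

Section Basics.
Variables (M : zmodType) (L : R -> set M).
Hypothesis hL : filtration L.

Lemma fil_opp r x : L r x -> L r (- x).
Proof. by rewrite -sub0r; apply: fil_sub hL _ _ _ (fil_0 hL r). Qed.

Lemma fil_add r x y : L r x -> L r y -> L r (x + y).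
Proof. by move=> hx hy; rewrite -[y]opprK; apply: (fil_sub hL) => //; exact: fil_opp. Qed.

Lemma fil_sum (I : Type) (s : seq I) (P : pred I) (F : I -> M) r :
  (forall i, P i -> L r (F i)) -> L r (\sum_(i <- s | P i) F i).
Proof. by move=> h; apply: big_ind => //; [exact: fil_0|exact: fil_add]. Qed.

Lemma fil_value x : x != 0 -> exists r, forall s, L s x <-> s <= r.
Proof.
move=> x0; pose E := [set s | L s x].
have hE : has_sup E.
  split; first by have [r hr] := fil_exh hL x; exists r.
  have [t ht] : exists t, ~ L t x.
    apply/not_existsP => h; move/eqP: x0; apply; apply: (fil_sep hL) => r.
    exact: contrapT (h r).
  exists t => s hs; rewrite leNgt; apply/negP => ts; apply: ht.
  by apply: fil_le hL _ _ _ (ltW ts) hs.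
exists (sup E) => s; split=> [hs|sr]; first exact: sup_upper_bound.
apply: (fil_left hL) => t ts.
have d0 : 0 < sup E - t by rewrite subr_gt0 (lt_le_trans ts sr).
have [e he te] := sup_adherent d0 hE.
move: te; rewrite subKr => te.
by apply: fil_le hL _ _ _ (ltW te) he.
Qed.

End Basics.

Lemma shifts_le (M N : zmodType) (L : R -> set M) (L' : R -> set N) c d g :
  filtration L' -> d <= c -> shifts L L' c g -> shifts L L' d g.
Proof.
move=> hL dc h s u hu; apply: (fil_le hL) (h s u hu); lra.
Qed.

End Filtrations.

(** * Completeness *)

Section Completeness.
Variables (R : realType) (k : fieldType) (nu : k -> \bar R).
Hypothesis hk : is_odd_local_field nu.
Let hv := lf_val hk.

(** The explicit rate of convergence is what allows series to be summed coordinate by coordinate in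
    [span_series]. *)
Lemma series_cvg (q : R) (c : nat -> k) (B : R) : 0 < q ->
  (forall n, vge nu (n%:R * q - B) (c n)) ->
  exists l, forall m, vge nu (m%:R * q - B) (l - \sum_(i < m) c i).
Proof.
move=> q0 hc; pose S m := \sum_(i < m) c i.
have hS : forall m p, (m <= p)%N -> vge nu (m%:R * q - B) (S p - S m).
  move=> m p mp; have -> : S p - S m = \sum_(m <= i < p) c i.
    by rewrite /S -!(big_mkord xpredT c) (@big_cat_nat _ _ _ m 0%N p) //= addrAC subrr add0r.
  rewrite big_nat_cond; apply: (vge_sum hv) => // i /andP[/andP[mi _] _].
  by apply: vge_le (hc i); rewrite lerB // ler_pM2r // ler_nat.
have [|l hl] := lf_complete hk (u := S).
  move=> n; pose N := (Num.truncn ((n%:R + `|B|) / q)).+1; exists N => p r Np Nr.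
  have hN : n%:R <= N%:R * q - B.
    have : n%:R + `|B| < N%:R * q by rewrite -ltr_pdivrMr // truncnS_gt.
    have := ler_norm B; lra.
  have -> : S p - S r = (S p - S N) - (S r - S N) by rewrite opprB addrA subrK.
  by apply: (vgeB hv) => //; apply: vge_le hN _; apply: hS.
exists l => m; pose n := (Num.truncn `|m%:R * q - B|).+1.
have [N hN] := hl n; pose p := maxn N m.
have -> : l - S m = (S p - S m) - (S p - l) by rewrite opprB [RHS]addrC addrA subrK.
apply: (vgeB hv) => //; first by apply: hS; rewrite leq_maxr.
apply: vge_le (hN p _); last by rewrite leq_maxl.
have := truncnS_gt `|m%:R * q - B|; have := ler_norm (m%:R * q - B); rewrite -/n; lra.
Qed.

Section Comparison.
Variables (M : zmodType) (sc : k -> M -> M).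

(** There is no unit law, because [cz_E i] acts on the whole of [V] with 1 acting as the projector
    onto [V_i]. *)
Record is_prescaling : Prop := {
  sc_add : forall c x y, sc c (x + y) = sc c x + sc c y;
  sc_addl : forall a b x, sc (a + b) x = sc a x + sc b x;
  sc_mul : forall a b x, sc (a * b) x = sc a (sc b x) }.

Record is_scaling : Prop := {
  sc_pre :> is_prescaling;
  sc_1 : forall x, sc 1 x = x }.

(** Spans are taken with respect to an explicit action, so that one development serves [k] acting on
    itself, on [D], on right spaces and on their endomorphism rings. *)
Fixpoint in_span (es : seq M) (x : M) : Prop :=
  if es is e :: es' then exists c, in_span es' (x - sc c e) else x = 0.

Fixpoint in_span_ge (r : R) (es : seq M) (x : M) : Prop :=
  if es is e :: es' then
    exists2 c, vge nu r c & in_span_ge r es' (x - sc c e) else x = 0.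

Section Prescaling.
Hypothesis hsc : is_prescaling.

Lemma sc_0l x : sc 0 x = 0.
Proof. by apply: (addIr (sc 0 x)); rewrite -sc_addl // !add0r. Qed.

Lemma sc_0r c : sc c 0 = 0.
Proof. by apply: (addIr (sc c 0)); rewrite -sc_add // !add0r. Qed.

Lemma sc_oppr c x : sc c (- x) = - sc c x.
Proof. by apply: (addIr (sc c x)); rewrite -sc_add // !addNr sc_0r. Qed.

Lemma sc_oppl c x : sc (- c) x = - sc c x.
Proof. by apply: (addIr (sc c x)); rewrite -sc_addl // !addNr sc_0l. Qed.

Lemma sc_suml (I : Type) (s : seq I) (P : pred I) (F : I -> k) x :
  sc (\sum_(i <- s | P i) F i) x = \sum_(i <- s | P i) sc (F i) x.
Proof.
by apply: (big_morph (sc^~ x)) => [a b|]; [exact: sc_addl|exact: sc_0l].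
Qed.

Lemma in_span0 es : in_span es 0.
Proof. by elim: es => //= e es IH; exists 0; rewrite sc_0l subr0. Qed.

Lemma in_spanD es x y : in_span es x -> in_span es y -> in_span es (x + y).
Proof.
elim: es x y => [x y -> ->|e es IH x y /= [c hc] [d hd]]; first by rewrite /= addr0.
by exists (c + d); rewrite sc_addl // opprD addrACA; apply: IH.
Qed.

Lemma in_spanN es x : in_span es x -> in_span es (- x).
Proof.
elim: es x => [x ->|e es IH x /= [c hc]]; first by rewrite /= oppr0.
by exists (- c); rewrite sc_oppl -opprD; apply: IH.
Qed.

Lemma in_spanZ es a x : in_span es x -> in_span es (sc a x).
Proof.
elim: es x => [x ->|e es IH x /= [c hc]]; first by rewrite /= sc_0r.
by exists (a * c); rewrite sc_mul // -sc_oppr -sc_add //; apply: IH.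
Qed.

Lemma in_span_sum es (I : Type) (s : seq I) (P : pred I) (F : I -> M) :
  (forall i, P i -> in_span es (F i)) -> in_span es (\sum_(i <- s | P i) F i).
Proof. by move=> h; apply: big_ind => //; [exact: in_span0|exact: in_spanD]. Qed.

Lemma in_span_geW r es x : in_span_ge r es x -> in_span es x.
Proof. by elim: es x => //= e es IH x [c _ /IH h]; exists c. Qed.

Lemma in_span_ge_le r s es x : s <= r -> in_span_ge r es x -> in_span_ge s es x.
Proof.
move=> sr; elim: es x => //= e es IH x [c hc /IH h]; exists c => //.
exact: vge_le hc.
Qed.

Lemma span_series q es (d : nat -> M) (B : R) : 0 < q ->
  (forall n, in_span_ge (n%:R * q - B) es (d n)) ->
  exists l, forall m, in_span_ge (m%:R * q - B) es (l - \sum_(i < m) d i).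
Proof.
move=> q0; elim: es d => [d hd|e es IH d hd] /=.
  by exists 0 => m; rewrite big1 ?subr0 // => i _; have := hd i.
have /choice[c hc] : forall n, exists c, vge nu (n%:R * q - B) c /\
    in_span_ge (n%:R * q - B) es (d n - sc c e).
  by move=> n; have [c ? ?] := hd n; exists c.
have [l hl] := series_cvg q0 (fun n => proj1 (hc n)).
have [x hx] := IH (fun n => d n - sc (c n) e) (fun n => proj2 (hc n)).
exists (x + sc l e) => m; exists (l - \sum_(i < m) c i) => //.
have -> : x + sc l e - \sum_(i < m) d i - sc (l - \sum_(i < m) c i) e =
    x - \sum_(i < m) (d i - sc (c i) e); last exact: hx.
rewrite sc_addl // sc_oppl sc_suml sumrB !opprB [x + _]addrC -!addrA addrC.
by rewrite -!addrA addNr addr0 [- _ + _]addrC.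
Qed.

End Prescaling.

Hypothesis hsc : is_scaling.
Let hpre : is_prescaling := sc_pre hsc.

Lemma sc_K c x : c != 0 -> sc c^-1 (sc c x) = x.
Proof. by move=> c0; rewrite -(sc_mul hpre) // mulVf // (sc_1 hsc). Qed.

Lemma in_span_mem es x : x \in es -> in_span es x.
Proof.
elim: es => //= e es IH; rewrite inE => /orP[/eqP ->|/IH h].
  by exists 1; rewrite (sc_1 hsc) // subrr; exact: (in_span0 hpre).
by exists 0; rewrite (sc_0l hpre) subr0.
Qed.

Variable L : R -> set M.
Hypothesis hL : filtration L.
Hypothesis hLsc : forall c, c != 0 -> shifts L L (vr nu c) (sc c).

Lemma shifts_sc_ge r c : vge nu r c -> shifts L L r (sc c).
Proof.
have [-> _ s u _|c0 /(vr_ge hv c0) rc] := eqVneq c 0.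
  by rewrite (sc_0l hpre); exact: (fil_0 hL).
exact: shifts_le hL rc (hLsc c0).
Qed.

Lemma in_span_fil es : exists B, forall r x, in_span_ge r es x -> L (r - B) x.
Proof.
elim: es => [|e es [B hB]] /=.
  by exists 0 => r x ->; exact: (fil_0 hL).
have [b hb] := fil_exh hL e.
exists (Num.max B (- b)) => r x [c hc /hB hx].
rewrite -(subrK (sc c e) x); apply: (fil_add hL) => //.
  by apply: fil_le hL _ _ _ _ hx; rewrite lerB // le_max lexx.
apply: fil_le hL _ _ _ _ (shifts_sc_ge hc hb).
have : - b <= Num.max B (- b) by rewrite le_max lexx orbT.
lra.
Qed.

(** Equivalence of norms in finite dimension over a complete field. By induction the span of [es] is
    complete, hence closed, so that a new vector [e] outside it has finite distance [B1] to it,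
    which bounds the coefficient of [e]. *)
Theorem span_comparison es : exists B, forall r x, in_span es x -> L r x ->
  in_span_ge (r - B) es x.
Proof.
elim: es => [|e es [B hB]] /=; first by exists 0.
have [he|he] := pselect (in_span es e).
  exists B => r x [c hx] hr; exists 0; first exact: (vge0 hv).
  rewrite (sc_0l hpre) subr0; apply: hB => //.
  by rewrite -(subrK (sc c e) x); apply: (in_spanD hpre) => //; exact: (in_spanZ hpre).
have [B1 hB1] : exists n : nat, forall u, in_span es u -> ~ L n%:R (e + u).
  apply/not_existsP => h.
  have /choice[u hu] : forall n : nat, exists u, in_span es u /\ L n%:R (e + u).
    move=> n; have /existsNP[u /not_implyP[hu /contrapT hn]] := h n.
    by exists u.
  (* If [e] were a limit of elements [- u n] of the span, their successive differences would be
     small, hence small in coordinates by induction; the resulting series converges inside the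
     span. *)
  have hd n : in_span_ge (n%:R * 1 - B) es (u n.+1 - u n).
    rewrite mulr1; apply: hB; first by apply: (in_spanD hpre); [exact: (hu _).1|apply: (in_spanN hpre); exact: (hu _).1].
    have -> : u n.+1 - u n = (e + u n.+1) - (e + u n) by rewrite opprD addrACA subrr add0r.
    apply: (fil_sub hL); last exact: (hu n).2.
    by apply: fil_le hL _ _ _ _ (hu n.+1).2; rewrite ler_nat.
  have [l hl] := span_series hpre ltr01 hd.
  have [B2 hB2] := in_span_fil es.
  have hul n : L (n%:R - B - B2) (u 0%N + l - u n).
    have -> : u 0%N + l - u n = l - \sum_(i < n) (u i.+1 - u i).
      rewrite -(big_mkord xpredT (fun i => u i.+1 - u i)) telescope_sumr //.
      by rewrite opprB addrA [l + _]addrC.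
    by apply: hB2; have := hl n; rewrite mulr1.
  have e0 : e + (u 0%N + l) = 0.
    apply: (fil_sep hL) => r.
    pose n := (Num.truncn (`|r| + `|B| + `|B2|)).+1.
    have hn : `|r| + `|B| + `|B2| < n%:R by exact: truncnS_gt.
    have hr := ler_norm r; have hB' := ler_norm B; have hB2' := ler_norm B2.
    have hB0 := normr_ge0 B; have hB20 := normr_ge0 B2.
    have -> : e + (u 0%N + l) = (e + u n) + (u 0%N + l - u n).
      by rewrite [_ + l - u n]addrC [RHS]addrA addrK.
    apply: (fil_add hL) => //; first by apply: fil_le hL _ _ _ _ (hu n).2; lra.
    by apply: fil_le hL _ _ _ _ (hul n); lra.
  apply: he; rewrite (_ : e = - (u 0%N + l)); last by apply/eqP; rewrite -addr_eq0 e0.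
  apply/(in_spanN hpre)/(in_spanD hpre); first exact: (hu _).1.
  have := in_span_geW (hl 0%N); rewrite big_ord0 subr0; exact: id.
have [b hb] := fil_exh hL e.
(* The coefficient [c] loses [B1]; then [x - c e] lies in [L (r - B1 + min b B1)], where [b] bounds
   the norm of [e], and its coordinates lose another [B]. *)
exists (Num.max (Num.max B1%:R B) (B + B1%:R - b)) => r x [c hx] hr.
set B' := Num.max _ _.
have hB'1 : B1%:R <= B' by rewrite !le_max lexx.
have hB'3 : B <= B' by rewrite !le_max lexx orbT.
have hB'2 : B + B1%:R - b <= B' by rewrite le_max lexx orbT.
have hc : vge nu (r - B1%:R) c.
  have [->|c0] := eqVneq c 0; first exact: (vge0 hv).
  apply/(vgeE hv _ c0); rewrite leNgt; apply/negP => hlt.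
  apply: (hB1 (sc c^-1 (x - sc c e))); first exact: (in_spanZ hpre).
  have -> : e + sc c^-1 (x - sc c e) = sc c^-1 x.
    by rewrite (sc_add hpre) // (sc_oppr hpre) sc_K // addrC subrK.
  have c'0 : c^-1 != 0 by rewrite invr_eq0.
  have := hLsc c'0 hr; rewrite (vrV hv) ?unitfE // => h.
  by apply: fil_le hL _ _ _ _ h; lra.
exists c; first by apply: vge_le hc; lra.
apply: in_span_ge_le (hB _ _ hx (_ : L (r - B1%:R + Num.min b B1%:R) _)).
  have : Num.min b B1%:R = b \/ Num.min b B1%:R = B1%:R by rewrite /Num.min; case: ifP; [left|right].
  by case=> ->; lra.
apply: (fil_sub hL).
  apply: fil_le hL _ _ _ _ hr.
  have : Num.min b B1%:R <= B1%:R by rewrite ge_min lexx orbT.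
  lra.
apply: fil_le hL _ _ _ _ (shifts_sc_ge hc hb).
have : Num.min b B1%:R <= b by rewrite ge_min lexx.
lra.
Qed.

End Comparison.

(** The norm of the source controls coordinates by [span_comparison], and coordinates control any
    norm on the target by [in_span_fil]. *)
Lemma bounded_operator (M N : zmodType) (scM : k -> M -> M) (scN : k -> N -> N)
    (L : R -> set M) (L' : R -> set N) (es : seq M) (g : M -> N) :
  is_scaling scM -> is_scaling scN -> filtration L -> filtration L' ->
  (forall c, c != 0 -> shifts L L (vr nu c) (scM c)) ->
  (forall c, c != 0 -> shifts L' L' (vr nu c) (scN c)) ->
  (forall x, in_span scM es x) ->
  (forall x y, g (x + y) = g x + g y) -> (forall c x, g (scM c x) = scN c (g x)) ->
  exists t, shifts L L' t g.
Proof.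
move=> hM hN hL hL' sL sL' hes gD gsc.
have g0 : g 0 = 0 by apply: (addIr (g 0)); rewrite -gD !add0r.
have [B hB] := span_comparison hM hL sL es.
have [B2 hB2] := in_span_fil hN hL' sL' (map g es).
exists (- B - B2) => s u hu.
have {hu} := hB _ _ (hes u) hu.
move=> hu; rewrite addrA; apply: hB2.
elim: es u {hes hB} hu => [u ->|e es IH u /= [c hc hu]] /=; first exact: g0.
exists c => //; have {IH} := IH _ hu.
have -> : g (u - scM c e) = g u - scN c (g e).
  rewrite gD; congr (_ + _); rewrite -gsc.
  by apply: (addIr (g (scM c e))); rewrite -gD !addNr g0.
by [].
Qed.

End Completeness.

(** * Involutions preserve the valuation *)

(** Removes a bounded error [t] from a comparison of values known for all powers of an element. *)
Lemma archi_le (R : realType) (a b t : R) :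
  (forall n : nat, n%:R * a + t <= n%:R * b) -> a <= b.
Proof.
move=> h; rewrite leNgt; apply/negP => ba.
have d0 : 0 < a - b by rewrite subr_gt0.
pose n := (Num.truncn (`|t| / (a - b))).+1.
have hn : `|t| < n%:R * (a - b) by rewrite -ltr_pdivrMr // truncnS_gt.
have := h n; have := ler_norm (- t); rewrite normrN; lra.
Qed.

Section LocalField.
Variables (R : realType) (k : fieldType) (nu : k -> \bar R).
Hypothesis hk : is_odd_local_field nu.
Let hv := lf_val hk.

Lemma lf_vr_int x : x != 0 -> exists n : int, vr nu x = n%:~R.
Proof. by move=> x0; have [n hn] := lf_int hk x0; exists n; rewrite /vr hn. Qed.

Lemma lf_vpos_ge1 x : vpos nu x -> vge nu 1 x.
Proof.
have [-> _|x0] := eqVneq x 0; first exact: (vge0 hv).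
move/(vposE hv x0); have [n hn] := lf_vr_int x0; rewrite hn ltr0z => h.
by apply/(vgeE hv _ x0); rewrite hn; rewrite -[1]/(1%:~R) ler_int.
Qed.

Lemma lf_not_vpos1 : ~ vpos nu 1.
Proof. by move/(vposE hv (oner_neq0 _)); rewrite (vr1 hv) ltxx. Qed.

Lemma lf_not_vpos2 : ~ vpos nu 2.
Proof.
move=> h2; have [p [_ op hp]] := lf_odd hk.
apply: lf_not_vpos1; rewrite (_ : 1 = p%:R - 2 * p./2%:R).
  by apply: (vposB hv) => //; apply: (vposMl hv) => //; exact: (vge_nat hv).
by rewrite -[in p%:R](odd_double_half p) op /= add1n -addn1 natrD -mul2n natrM addrAC subrr add0r.
Qed.

Lemma lf_2neq0 : (2 : k) != 0.
Proof. by apply/eqP => h; apply: lf_not_vpos2; rewrite h; exact: (vpos0 hv). Qed.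

Lemma lf_vr2 : vr nu 2 = 0.
Proof.
by apply: (vge0_pos hv lf_2neq0); [exact: (vge_nat hv 2)|exact: lf_not_vpos2].
Qed.

Lemma lf_vge_half r x : vge nu r x -> vge nu r (x / 2).
Proof.
move=> h; rewrite -[r]addr0; apply: (vgeM hv) => //.
have t0 : (2 : k)^-1 != 0 by rewrite invr_eq0 lf_2neq0.
by apply/(vgeE hv _ t0); rewrite (vrV hv) ?unitfE ?lf_2neq0 // lf_vr2 oppr0.
Qed.

(** Newton's iteration with the derivative frozen at 2, a unit. As the iterates stay congruent to 1,
    the error [s ^+ 2 - a] gains at least 1 in value at each step. *)
Lemma lf_sqrt y : vpos nu y -> exists2 s, s ^+ 2 = 1 + y & vpos nu (s - 1).
Proof.
move=> hy; have hy1 := lf_vpos_ge1 hy; pose a := 1 + y.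
pose step s := s - (s ^+ 2 - a) / 2; pose s n := iter n step 1.
have hs n : vge nu (n%:R + 1) (s n ^+ 2 - a) /\ vge nu 1 (s n - 1).
  elim: n => [|n [IH1 IH2]].
    rewrite /s /= expr1n /a opprD addrA subrr add0r; split; last first.
      exact: (vge0 hv).
    by rewrite add0r; exact: (vgeN hv).
  have n1 : (1 : R) <= n%:R + 1 by rewrite lerDr ler0n.
  split; last first.
    rewrite /s iterS -/(s n) /step addrAC; apply: (vgeB hv) => //.
    exact: vge_le (lf_vge_half IH1).
  have -> : s n.+1 ^+ 2 - a =
      - ((s n ^+ 2 - a) * (s n - 1)) + ((s n ^+ 2 - a) / 2) * ((s n ^+ 2 - a) / 2).
    by rewrite /s iterS -/(s n) /step; field; exact: lf_2neq0.
  rewrite -natr1; apply: (vgeD hv); first by apply/(vgeN hv)/(vgeM hv).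
  apply: vge_le (vgeM hv (lf_vge_half IH1) (lf_vge_half IH1)); lra.
have [|l hl] := series_cvg hk (c := fun n => s n.+1 - s n) (B := -1) ltr01.
  move=> n; rewrite mulr1 opprK /s iterS -/(s n) /step addrAC subrr add0r.
  by apply/(vgeN hv)/lf_vge_half; exact: (hs n).1.
have hls m : vge nu (m%:R + 1) (1 + l - s m).
  have := hl m; rewrite mulr1 opprK -(big_mkord xpredT (fun i => s i.+1 - s i)).
  by rewrite telescope_sumr // opprB [1 + l]addrC -addrA.
have h1 : vge nu 1 l by have := hls 0%N; rewrite add0r {1}/s /= addrAC subrr add0r.
exists (1 + l); last by rewrite addrAC subrr add0r; apply: (vpos_ge _ h1).
apply/eqP; rewrite -subr_eq0 -/a; apply/eqP; apply: (vge_eq0 hv) => r.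
pose m := (Num.truncn `|r|).+1.
have hm : r <= m%:R + 1.
  by have := truncnS_gt `|r|; have := ler_norm r; rewrite -/m; lra.
have -> : (1 + l) ^+ 2 - a = (1 + l - s m) * (1 + l - s m + 2 * s m) + (s m ^+ 2 - a).
  by rewrite /a; ring.
apply: vge_le hm _; apply: (vgeD hv); last exact: (hs m).1.
rewrite -[_ + 1]addr0; apply: (vgeM hv) => //; apply: (vgeD hv).
  by apply: vge_le (hls m); rewrite addr_ge0.
rewrite -[0]addr0; apply: (vgeM hv); first exact: (vge_nat hv 2).
rewrite -(subrK 1 (s m)); apply: (vgeD hv); last exact: (vge1 hv).
by apply: vge_le (hs m).2.
Qed.

Section Involution.
Variable tau : k -> k.
Hypothesis htau : is_ring_involution tau.

Lemma inv_0 : tau 0 = 0.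
Proof. by apply: (addIr (tau 0)); rewrite -(inv_add htau) !add0r. Qed.

Lemma inv_neq0 x : x != 0 -> tau x != 0.
Proof. by apply: contra => /eqP h; rewrite -(inv_invol htau x) h inv_0. Qed.

Lemma inv_exp x n : tau (x ^+ n) = tau x ^+ n.
Proof.
elim: n => [|n IH]; first by rewrite !expr0 (inv_one htau).
by rewrite exprS (inv_mul htau) IH exprSr.
Qed.

Lemma one_add_vpos y : vpos nu y -> 1 + y != 0 /\ vr nu (1 + y) = 0.
Proof.
move=> /lf_vpos_ge1 hy.
have [||h1 h2] := @vr_dom _ _ _ hv 1 (1 + y) 1 (oner_neq0 _).
- by rewrite (vr1 hv).
- by rewrite addrAC subrr add0r.
by rewrite (vr1 hv) in h2.
Qed.

Lemma vpos_2power y m : vpos nu y -> exists2 s, s ^+ (2 ^ m) = 1 + y & vpos nu (s - 1).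
Proof.
move=> hy; elim: m => [|m [s hs1 hs2]].
  by exists (1 + y); rewrite ?expr1 // addrAC subrr add0r.
have [t ht1 ht2] := lf_sqrt hs2; exists t => //.
by rewrite expnS exprM ht1 addrC subrK hs1.
Qed.

(* Since [2] is a unit of the residue field, [1 + y] has [2^n]-th roots for all [n], so
   the integer [vr nu (tau (1 + y))] is divisible by every power of [2]. *)
Lemma vr_tau_1p y : vpos nu y -> vr nu (tau (1 + y)) = 0.
Proof.
move=> hy; have [h0 _] := one_add_vpos hy.
have [z hz] := lf_vr_int (inv_neq0 h0).
rewrite hz; have [->//|z0] := eqVneq z 0.
have [s hs1 hs2] := vpos_2power `|z| hy.
have s0 : s != 0.
  by apply: contraNneq h0 => s0; rewrite -hs1 s0 expr0n expn_eq0.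
have [w hw] := lf_vr_int (inv_neq0 s0).
have : vr nu (tau (1 + y)) = (2 ^ `|z|)%:R * vr nu (tau s).
  by rewrite -hs1 inv_exp (vrX hv) // inv_neq0.
rewrite hz hw pmulrn -intrM => /eqP; rewrite eqr_int => /eqP hzw.
have hh : (`|z| < 2 ^ `|z|)%N by rewrite ltn_expl.
have hzw2 : (`|z| = 2 ^ `|z| * `|w|)%N by rewrite {1}hzw abszM absz_nat.
have w0 : (0 < `|w|)%N.
  by rewrite absz_gt0; apply: contraNneq z0 => w0; rewrite hzw w0 mulr0.
have : (2 ^ `|z| <= 2 ^ `|z| * `|w|)%N by rewrite leq_pmulr.
by rewrite -hzw2 leqNgt hh.
Qed.

(** If [tau y] had negative value, so would [1 + tau y = tau (1 + y)], against [vr_tau_1p]. *)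
Lemma vge0_tau_vpos y : vpos nu y -> vge nu 0 (tau y).
Proof.
move=> hy; have [->|y0] := eqVneq y 0; first by rewrite inv_0; exact: (vge0 hv).
apply/(vgeE hv _ (inv_neq0 y0)); rewrite leNgt; apply/negP => h.
have [|_] := @vr_dom _ _ _ hv (tau y) (1 + tau y) 0 (inv_neq0 y0) h.
  by rewrite addrK; exact: (vge1 hv).
have := vr_tau_1p hy; rewrite (inv_add htau) (inv_one htau) => ->.
by move=> h'; move: h; rewrite -h' ltxx.
Qed.

Lemma lf_unif : exists2 w, w != 0 & vr nu w = 1.
Proof. by have [w w0 hw] := lf_onto hk 1; exists w => //; rewrite /vr hw. Qed.

(** All [x ^+ n * w] lie in the maximal ideal, so [n * vr nu (tau x)] is bounded below independently
    of [n]. *)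
Lemma vge0_tau x : vge nu 0 x -> vge nu 0 (tau x).
Proof.
have [->|x0] := eqVneq x 0; first by rewrite inv_0.
move=> hx; apply/(vgeE hv _ (inv_neq0 x0)).
have [w w0 hw] := lf_unif.
apply: (@archi_le _ _ _ (- vr nu (tau w))) => n; rewrite mulr0 add0r.
have hp : vpos nu (x ^+ n * w).
  apply: (vposMr hv); first by rewrite -[0](mulr0 n%:R); exact: (vgeX hv).
  by apply/(vposE hv w0); rewrite hw.
have := vge0_tau_vpos hp; rewrite (inv_mul htau) inv_exp.
have h1 := inv_neq0 w0; have h2 := expr_neq0 hv n (inv_neq0 x0).
move/(vgeE hv _ (mul_neq0 hv h1 h2)); rewrite (vrM hv) // (vrX hv) ?inv_neq0 //; lra.
Qed.

Lemma vr0_tau x : x != 0 -> vr nu x = 0 -> vr nu (tau x) = 0.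
Proof.
move=> x0 hx; have t0 := inv_neq0 x0.
have h1 : 0 <= vr nu (tau x).
  by apply: (vr_ge hv t0); apply: vge0_tau; apply/(vgeE hv _ x0); rewrite hx.
have x'0 : x^-1 != 0 by rewrite invr_eq0.
have : vge nu 0 (tau x^-1).
  by apply: vge0_tau; apply/(vgeE hv _ x'0); rewrite (vrV hv) ?unitfE // hx oppr0.
move/(vr_ge hv (inv_neq0 x'0)) => h2.
have : vr nu (tau (x * x^-1)) = 0 by rewrite mulfV // (inv_one htau) (vr1 hv).
by rewrite (inv_mul htau) (vrM hv) ?inv_neq0 //; lra.
Qed.

(** Units go to units, and a uniformizer [w] cannot go to a unit, since [tau (tau w) = w]; it thus
    goes to an element of value at least 1. *)
Lemma vr_tau_ge x : x != 0 -> 0 <= vr nu x -> vr nu x <= vr nu (tau x).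
Proof.
move=> x0 hx; have [w w0 hw] := lf_unif.
have hw1 : 1 <= vr nu (tau w).
  have h : vge nu 0 (tau w) by apply: vge0_tau; apply/(vgeE hv _ w0); rewrite hw.
  apply: (vr_ge hv (inv_neq0 w0)); apply: lf_vpos_ge1; apply/(vposE hv (inv_neq0 w0)).
  rewrite lt_neqAle (vr_ge hv (inv_neq0 w0) h) andbT; apply/eqP => h0.
  have := vr0_tau (inv_neq0 w0) (esym h0); rewrite (inv_invol htau) hw; lra.
have [n hn] := lf_vr_int x0.
have n0 : 0 <= n by rewrite -(ler0z R) -hn.
case: n n0 hn => // n _ hn; rewrite -pmulrn in hn.
have wn0 : w ^+ n != 0 by rewrite expf_neq0.
have u0 : x / w ^+ n != 0 by rewrite mulf_neq0 // invr_eq0.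
have hu : vr nu (x / w ^+ n) = 0.
  rewrite (vrM hv) ?invr_eq0 // (vrV hv) ?unitfE // (vrX hv) // hw hn; lra.
rewrite -[in leRHS](divfK wn0 x) (inv_mul htau) inv_exp.
rewrite (vrM hv) ?expf_neq0 ?inv_neq0 // (vr0_tau u0 hu) (vrX hv) ?inv_neq0 // hn.
by rewrite addr0 ler_peMr.
Qed.

Theorem vr_tau x : vr nu (tau x) = vr nu x.
Proof.
have [->|x0] := eqVneq x 0; first by rewrite inv_0.
wlog hx : x x0 / 0 <= vr nu x.
  move=> IH; have [|h] := leP 0 (vr nu x); first exact: IH.
  have x'0 : x^-1 != 0 by rewrite invr_eq0.
  have hV : vr nu x^-1 = - vr nu x by rewrite (vrV hv) ?unitfE.
  have := IH _ x'0; rewrite hV oppr_ge0 => /(_ (ltW h)) h1.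
  have : vr nu (tau (x * x^-1)) = 0 by rewrite mulfV // (inv_one htau) (vr1 hv).
  by rewrite (inv_mul htau) (vrM hv) ?inv_neq0 //; lra.
have h1 := vr_tau_ge x0 hx.
have := vr_tau_ge (inv_neq0 x0) (le_trans hx h1); rewrite (inv_invol htau) => h2.
by apply/eqP; rewrite eq_le h1 h2.
Qed.

End Involution.

(** * Uniqueness of the extended valuation *)

Section Extension.

Lemma vge_filtration (A : nzRingType) (v : A -> \bar R) :
  is_valuation v -> filtration (fun r => [set x | vge v r x]).
Proof.
move=> hv'; split => /=.
- exact: vge0.
- by move=> *; exact: vgeB.
- by move=> r s x; exact: vge_le.
- move=> r x h; have [->|x0] := eqVneq x 0; first exact: (vge0 hv').
  apply/(vgeE hv' _ x0); rewrite leNgt; apply/negP => xr.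
  have /h/(vr_ge hv' x0) : (vr v x + r) / 2 < r by lra.
  lra.
- by move=> x; exists (vr v x); exact: vge_vr.
- exact: vge_eq0.
Qed.

Lemma scale_is_scaling (V : lmodType k) : is_scaling (fun (c : k) (x : V) => c *: x).
Proof.
split; last exact: scale1r.
by split=> *; rewrite ?scalerDr ?scalerDl ?scalerA.
Qed.

Lemma vect_span (V : vectType k) (x : V) :
  in_span (fun (c : k) (x : V) => c *: x) (vbasis {:V}) x.
Proof.
have hsc := scale_is_scaling V.
rewrite (coord_vbasis (memvf x)); apply: (in_span_sum hsc) => i _.
by apply: (in_spanZ hsc); apply: (in_span_mem hsc); rewrite mem_nth // size_tuple.
Qed.

Variables (A : nzRingType) (emb : {rmorphism k -> A}).

Lemma emb_is_scaling : is_scaling (fun c (x : A) => emb c * x).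
Proof.
split; last by move=> x; rewrite rmorph1 mul1r.
by split=> *; rewrite ?mulrDr ?rmorphD ?mulrDl ?rmorphM ?mulrA.
Qed.

Variable es : seq A.
Hypothesis hes : forall x, in_span (fun c x => emb c * x) es x.

Lemma shifts_val_ext (v : A -> \bar R) : is_valuation v ->
  (forall c : k, v (emb c) = nu c) -> forall c, c != 0 ->
  shifts (fun r => [set x | vge v r x]) (fun r => [set x | vge v r x])
    (vr nu c) (fun x => emb c * x).
Proof.
move=> hv' he c c0 s u /= hu; rewrite addrC; apply: (vgeM hv') => //.
by rewrite /vr -he; exact: (vge_vr hv').
Qed.

(** Both valuations are norms on one finite-dimensional space, so they differ by a bounded amount,
    which multiplicativity on powers reduces to nothing. *)
Theorem val_ext_unique (v1 v2 : A -> \bar R) : is_valuation v1 -> is_valuation v2 ->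
  (forall c : k, v1 (emb c) = nu c) -> (forall c : k, v2 (emb c) = nu c) ->
  forall x, vr v1 x = vr v2 x.
Proof.
wlog suff : v1 v2 / is_valuation v1 -> is_valuation v2 ->
  (forall c : k, v1 (emb c) = nu c) -> (forall c : k, v2 (emb c) = nu c) ->
  forall x, vr v1 x <= vr v2 x.
  move=> IH h1 h2 e1 e2 x; apply/eqP.
  by rewrite eq_le (IH v1 v2) // (IH v2 v1).
move=> h1 h2 e1 e2 x; have [->|x0] := eqVneq x 0.
  by rewrite /vr (val0 h1) (val0 h2).
have hsc := emb_is_scaling.
have [t ht] := bounded_operator hk (g := id) hsc hsc (vge_filtration h1)
  (vge_filtration h2) (shifts_val_ext h1 e1) (shifts_val_ext h2 e2) hes
  (fun x y => erefl) (fun c x => erefl).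
apply: (@archi_le _ _ _ t) => n.
rewrite -(vrX h2) //; apply: (vr_ge h2); first exact: (expr_neq0 h2).
by apply: ht; exact: (vgeX h1 _ (vge_vr h1 x)).
Qed.

(** [v \o rho] is again a valuation, values being commutative, and it extends [nu] because [tau]
    preserves [nu]. *)
Theorem vr_involution (v : A -> \bar R) (rho : A -> A) (tau : k -> k) :
  is_valuation v -> (forall c : k, v (emb c) = nu c) ->
  is_ring_involution rho -> is_ring_involution tau ->
  (forall c, rho (emb c) = emb (tau c)) -> forall x, vr v (rho x) = vr v x.
Proof.
move=> hv' he hrho htau hc x.
have rho0 : rho 0 = 0 by apply: (addIr (rho 0)); rewrite -(inv_add hrho) !add0r.
have hv2 : is_valuation (v \o rho).
  split=> [y|y z|y z] /=.
  - rewrite (val_eqy hv'); split=> [h|->//].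
    by rewrite -(inv_invol hrho y) h.
  - by rewrite (inv_mul hrho) (val_mul hv') addeC.
  - by rewrite (inv_add hrho); exact: (val_add hv').
suff he2 : forall c, (v \o rho) (emb c) = nu c by exact: val_ext_unique hv2 hv' he2 he x.
move=> c /=; rewrite hc he; have [->|c0] := eqVneq c 0; first by rewrite (inv_0 htau).
by rewrite (val_fin hv c0) (val_fin hv (inv_neq0 htau c0)) (vr_tau htau).
Qed.

End Extension.
End LocalField.

(** * Structure of division algebras with involution *)

Section Discrete.
Variables (R : realType) (A : unitRingType) (v : A -> \bar R).
Hypotheses (hv : is_valuation v) (hA : forall x : A, x != 0 -> x \is a GRing.unit).

Lemma inv_neq0_div x : x != 0 -> x^-1 != 0 :> A.
Proof. by move=> x0; apply: contraTneq (hA x0) => h; rewrite -unitrV h unitr0. Qed.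

Lemma vr_inv x : x != 0 -> vr v x^-1 = - vr v x.
Proof. by move=> x0; apply: vrV => //; exact: hA. Qed.

Lemma exprz_neq0 x (n : int) : x != 0 -> x ^ n != 0 :> A.
Proof.
move=> x0; case: n => n; first by apply: (expr_neq0 hv).
by rewrite NegzE -exprnN; apply/inv_neq0_div/(expr_neq0 hv).
Qed.

Lemma vrXz x (n : int) : x != 0 -> vr v (x ^ n) = n%:~R * vr v x.
Proof.
move=> x0; case: n => n; first by rewrite -[x ^ _]/(x ^+ n) (vrX hv).
rewrite NegzE -exprnN vr_inv ?(expr_neq0 hv) // (vrX hv) //.
by rewrite mulrNz mulNr -pmulrn.
Qed.

Variable p : A.
Hypothesis hp : is_uniformizer v p.

Definition unif_val := vr v p.

Lemma unif_val_gt0 : 0 < unif_val.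
Proof. by have [p0 /(vposE hv p0) hq _] := hp. Qed.

Lemma vpos_unif x : vpos v x <-> vge v unif_val x.
Proof.
split; last by apply: vpos_ge; exact: unif_val_gt0.
by move=> hx; have := unif_min hp hx; rewrite (val_fin hv (unif_neq0 hp)).
Qed.

Lemma unif_decomp x : x != 0 -> exists2 n : int, vr v x = n%:~R * unif_val
  & vr v (p ^ (- n) * x) = 0.
Proof.
move=> x0; have p0 := unif_neq0 hp; have q0 := unif_val_gt0.
pose n := Num.floor (vr v x / unif_val).
have y0 := mul_neq0 hv (exprz_neq0 (- n) p0) x0.
have hy : vr v (p ^ (- n) * x) = vr v x - n%:~R * unif_val.
  by rewrite (vrM hv) ?exprz_neq0 // vrXz // mulrNz mulNr addrC.
have /andP[h1 h2] := Num.Theory.floor_itv (vr v x / unif_val).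
move: h1 h2; rewrite -/n ler_pdivlMr // ltr_pdivrMr // rmorphD mulrDl => h1 h2.
have h : vr v (p ^ (- n) * x) = 0.
  apply/eqP; rewrite eq_le hy; apply/andP; split; last lra.
  rewrite leNgt; apply/negP => h.
  have /vpos_unif/(vr_ge hv y0) : vpos v (p ^ (- n) * x) by apply/(vposE hv y0); rewrite hy.
  rewrite hy; lra.
by exists n => //; apply/eqP; rewrite -subr_eq0 -hy h.
Qed.

End Discrete.

(** * Finiteness modulo powers of the maximal ideal, and uniformizers *)

Section FiniteResidue.
Variables (R : realType) (k : fieldType) (nu : k -> \bar R).
Hypothesis hk : is_odd_local_field nu.
Let hv := lf_val hk.

Lemma lf_reps0 (n : nat) : exists S : seq k, forall x, vge nu 0 x ->
  exists2 y, y \in S & vge nu n%:R (x - y).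
Proof.
elim: n => [|n [S hS]].
  by exists [:: 0] => x hx; exists 0; rewrite ?inE // subr0.
have [S1 hS1] := lf_finite hk; have [w w0 hw] := lf_unif hk.
exists [seq y + w ^+ n * z | y <- S, z <- S1] => x /hS[y yS hy].
have wn0 := expr_neq0 hv n w0.
have [|z zS hz] := hS1 (w ^- n * (x - y)).
  rewrite /valuation_ring /=; apply: (vge_le (r := - n%:R + n%:R)); first by rewrite addNr.
  apply: (vgeM hv) => //; apply/(vgeE hv); rewrite ?invr_eq0 //.
  by rewrite (vrV hv) ?unitfE // (vrX hv) // hw mulr1.
exists (y + w ^+ n * z); first by apply/allpairsP; exists (y, z).
have -> : x - (y + w ^+ n * z) = w ^+ n * (w ^- n * (x - y) - z).
  by rewrite mulrBr mulrA mulfV // mul1r opprD addrA.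
rewrite -natr1; apply: (vgeM hv); last exact: lf_vpos_ge1.
by apply/(vgeE hv) => //; rewrite (vrX hv) // hw mulr1.
Qed.

Lemma lf_reps (r s : R) : exists S : seq k, forall x, vge nu r x ->
  exists2 y, y \in S & vge nu s (x - y).
Proof.
have [w w0 hw] := lf_unif hk; pose m := (Num.truncn `|r|).+1.
pose n := (Num.truncn `|s + m%:R|).+1.
have wm0 := expr_neq0 hv m w0.
have [S hS] := lf_reps0 n; exists [seq w ^- m * y | y <- S] => x hx.
have [|y yS hy] := hS (w ^+ m * x).
  apply: (vge_le (r := m%:R + r)).
    have := truncnS_gt `|r|; have := ler_norm (- r); rewrite normrN -/m; lra.
  apply: (vgeM hv) => //; apply/(vgeE hv) => //; by rewrite (vrX hv) // hw mulr1.
exists (w ^- m * y); first exact: map_f.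
have -> : x - w ^- m * y = w ^- m * (w ^+ m * x - y).
  by rewrite mulrBr mulrA mulVf // mul1r.
apply: (vge_le (r := - m%:R + n%:R)).
  have := truncnS_gt `|s + m%:R|; have := ler_norm (s + m%:R); rewrite -/n; lra.
apply: (vgeM hv) => //; apply/(vgeE hv); rewrite ?invr_eq0 //.
by rewrite (vrV hv) ?unitfE // (vrX hv) // hw mulr1.
Qed.

Section Space.
Variables (M : zmodType) (sc : k -> M -> M) (L : R -> set M) (es : seq M).
Hypotheses (hsc : is_scaling sc) (hL : filtration L).
Hypothesis hLsc : forall c, c != 0 -> shifts L L (vr nu c) (sc c).
Hypothesis hes : forall x, in_span sc es x.

Lemma span_reps fs r s : exists S : seq M, forall x, in_span_ge nu sc r fs x ->
  exists2 y, y \in S & in_span_ge nu sc s fs (x - y).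
Proof.
elim: fs => [|f fs [S hS]] /=.
  by exists [:: 0] => x ->; exists 0; rewrite ?inE // subr0.
have [S1 hS1] := lf_reps r s.
exists [seq y + sc c f | y <- S, c <- S1] => x [c /hS1[d dS hd] /hS[y yS hy]].
exists (y + sc d f); first by apply/allpairsP; exists (y, d).
exists (c - d) => //; rewrite (_ : _ - _ = x - sc c f - y) //.
by rewrite (sc_addl hsc) (sc_oppl hsc) opprB opprD [x + _]addrA [LHS]addrA subrK addrAC.
Qed.

Lemma fil_reps r s : exists S : seq M, forall x, L r x ->
  exists2 y, y \in S & L s (x - y).
Proof.
have [B hB] := span_comparison hk hsc hL hLsc es.
have [B2 hB2] := in_span_fil hk hsc hL hLsc es.
have [S hS] := span_reps es (r - B) (s + B2); exists S => x hx.
have [y yS hy] := hS x (hB _ _ (hes x) hx); exists y => //.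
by rewrite -[s](addrK B2); apply: hB2.
Qed.

Lemma fil_series q (d : nat -> M) : 0 < q -> (forall n, L (n%:R * q) (d n)) ->
  exists B l, forall m, L (m%:R * q - B) (l - \sum_(i < m) d i).
Proof.
move=> q0 hd; have [B hB] := span_comparison hk hsc hL hLsc es.
have [B2 hB2] := in_span_fil hk hsc hL hLsc es.
have [l hl] := span_series hk hsc q0 (fun n => hB _ _ (hes (d n)) (hd n)).
by exists (B + B2), l => m; rewrite opprD addrA; apply: hB2.
Qed.

End Space.

Section Uniformizer.
Variables (A : unitRingType) (emb : {rmorphism k -> A}) (es : seq A) (v : A -> \bar R).
Hypothesis hes : forall x, in_span (fun c x => emb c * x) es x.
Hypotheses (hv' : is_valuation v) (he : forall c, v (emb c) = nu c).

Lemma emb_unif : exists w : k, [/\ w != 0, emb w != 0 & vr v (emb w) = 1].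
Proof.
have [w w0 hw] := lf_unif hk; exists w; split=> //; first by rewrite fmorph_eq0.
by rewrite /vr he.
Qed.

Lemma seq_argmin (T : eqType) (f : T -> R) x (s : seq T) :
  exists2 y, y \in x :: s & forall z, z \in x :: s -> f y <= f z.
Proof.
elim: s x => [|a s IH] x.
  by exists x; rewrite ?inE // => z; rewrite inE => /eqP ->.
have [y yS hy] := IH a; have [h|h] := leP (f x) (f y).
  exists x; first by rewrite inE eqxx.
  move=> z; rewrite inE => /orP[/eqP -> //|/hy]; exact: le_trans.
exists y; first by rewrite inE yS orbT.
move=> z; rewrite inE => /orP[/eqP ->|/hy //]; exact: ltW.
Qed.

(** Discreteness of the extended valuation comes from finiteness: an element with value strictly
    between 0 and 1 has the same value as its representative in a finite list modulo value 1. The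
    candidate [emb w], of value 1, takes care of the other elements of the maximal ideal. *)
Theorem exists_uniformizer : exists p : A, is_uniformizer v p.
Proof.
have [w [_ w0 hw]] := emb_unif.
have hsc := emb_is_scaling emb.
have [S hS] := fil_reps hsc (vge_filtration hv') (shifts_val_ext hv' he) hes 0 1.
pose S' := [seq y <- S | (y != 0) && (0 < vr v y)].
have [p pS hp] := seq_argmin (vr v) (emb w) S'.
have [p0 hp0] : p != 0 /\ 0 < vr v p.
  move: pS; rewrite inE => /orP[/eqP ->|]; first by rewrite hw.
  by rewrite mem_filter => /andP[/andP[]].
exists p; split=> //; first by apply/(vposE hv').
move=> x hx; have [->|x0] := eqVneq x 0; first by rewrite (val0 hv') leey.
rewrite (val_fin hv' p0); apply/(vgeE hv' _ x0).
have /(vposE hv' x0) xp := hx.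
have [h1|h1] := leP 1 (vr v x).
  by apply: le_trans h1; rewrite -hw; apply: hp; rewrite inE eqxx.
have [|y yS hy] := hS x; first exact: (vpos_ge0 hx).
have [y0 yx] : y != 0 /\ vr v y = vr v x.
  by apply: (vr_dom hv' x0 h1); rewrite -opprB; apply: (vgeN hv').
by rewrite -yx; apply: hp; rewrite inE mem_filter y0 yx xp yS orbT.
Qed.

End Uniformizer.
End FiniteResidue.

(** * The residue ring and its multiplicative group *)

Section ResidueRing.
Variables (R : realType) (A : unitRingType) (v : A -> \bar R) (S : seq A).
Hypotheses (hv : is_valuation v) (hA : forall x : A, x != 0 -> x \is a GRing.unit).
Hypothesis hS : forall x, vge v 0 x -> exists2 y, y \in S & vpos v (x - y).

(** Taking the first congruent element of a finite list makes the representative depend only on the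
    residue class, so that the quotient is a subtype of a list and finite by construction. *)
Definition res_rep x : A := nth 0 S (find (fun y => `[< vpos v (x - y) >]) S).

Lemma res_repP x : vge v 0 x -> vpos v (x - res_rep x).
Proof.
move=> /hS[y yS hy].
have h : has (fun y => `[< vpos v (x - y) >]) S.
  by apply/hasP; exists y => //; apply/asboolP.
by have /asboolP := nth_find 0 h.
Qed.

Lemma res_rep_eq x y : vpos v (x - y) -> res_rep x = res_rep y.
Proof.
move=> h; rewrite /res_rep; congr nth; apply: eq_find => z /=.
apply/asboolP/asboolP => h2.
  have -> : y - z = (x - z) - (x - y) by rewrite opprB [RHS]addrC addrA subrK.
  exact: (vposB hv).
have -> : x - z = (x - y) + (y - z) by rewrite addrA subrK.
exact: (vposD hv).
Qed.

Definition res_seq := [seq res_rep y | y <- S & `[< vge v 0 y >]].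

Lemma mem_res_seq x : vge v 0 x -> res_rep x \in res_seq.
Proof.
move=> hx; have [y yS hy] := hS hx; rewrite (res_rep_eq hy); apply: map_f.
rewrite mem_filter yS andbT; apply/asboolP.
by rewrite (_ : y = x - (x - y)); [apply: (vgeB hv) => //; exact: vpos_ge0|rewrite subKr].
Qed.

Definition residue := seq_sub res_seq.
HB.instance Definition _ := Finite.on residue.

Definition to_residue (x : A) : residue :=
  insubd (SeqSub (mem_res_seq (vge0 hv 0))) (res_rep x).

Local Notation mk := to_residue.

Lemma mem_res_seqP x : x \in res_seq -> vge v 0 x /\ res_rep x = x.
Proof.
case/mapP => y; rewrite mem_filter => /andP[/asboolP hy yS] ->.
have h := res_repP hy; split; last by rewrite -(res_rep_eq h).
have -> : res_rep y = y - (y - res_rep y) by rewrite subKr.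
by apply: (vgeB hv) => //; exact: vpos_ge0.
Qed.

Lemma residue_val_int (t : residue) : vge v 0 (ssval t).
Proof. by have [] := mem_res_seqP (ssvalP t). Qed.

Lemma to_residue_val x : vge v 0 x -> ssval (mk x) = res_rep x.
Proof. by move=> hx; rewrite -[ssval _]/(val _) val_insubd mem_res_seq. Qed.

Lemma to_residueK (t : residue) : mk (ssval t) = t.
Proof.
apply: val_inj; rewrite /= to_residue_val; last exact: residue_val_int.
by have [] := mem_res_seqP (ssvalP t).
Qed.

Lemma to_residue_eq x y : vge v 0 x -> vge v 0 y -> mk x = mk y <-> vpos v (x - y).
Proof.
move=> hx hy; split=> [h|h]; last by apply: val_inj; rewrite /= !to_residue_val // (res_rep_eq h).
have : ssval (mk x) = ssval (mk y) by rewrite h.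
rewrite !to_residue_val // => hr; have := vposB hv (res_repP hx) (res_repP hy).
by rewrite hr opprB addrA subrK.
Qed.

Lemma residueP (t : residue) : exists2 x, vge v 0 x & t = mk x.
Proof. by exists (ssval t); rewrite ?to_residueK //; exact: residue_val_int. Qed.

Lemma ssval_mk x : vge v 0 x -> vpos v (x - ssval (mk x)).
Proof. by move=> hx; rewrite to_residue_val //; exact: res_repP. Qed.

Definition residue_add (s t : residue) := mk (ssval s + ssval t).
Definition residue_opp (s : residue) := mk (- ssval s).
Definition residue_mul (s t : residue) := mk (ssval s * ssval t).
Definition residue_inv (s : residue) := if s == mk 0 then s else mk (ssval s)^-1.

Lemma residue_addE x y : vge v 0 x -> vge v 0 y -> residue_add (mk x) (mk y) = mk (x + y).
Proof.
move=> hx hy; apply/to_residue_eq; try by apply: (vgeD hv) => //; exact: residue_val_int.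
set a := ssval _; set b := ssval _.
have -> : a + b - (x + y) = - ((x - a) + (y - b)) by rewrite addrACA -opprD opprB.
by apply/(vposN hv)/(vposD hv); exact: ssval_mk.
Qed.

Lemma residue_oppE x : vge v 0 x -> residue_opp (mk x) = mk (- x).
Proof.
move=> hx; apply/to_residue_eq; try by apply: (vgeN hv) => //; exact: residue_val_int.
by rewrite opprK addrC; exact: ssval_mk.
Qed.

Lemma residue_mulE x y : vge v 0 x -> vge v 0 y -> residue_mul (mk x) (mk y) = mk (x * y).
Proof.
have vgeM0 a b : vge v 0 a -> vge v 0 b -> vge v 0 (a * b).
  by move=> ha hb; rewrite -[0]addr0; exact: (vgeM hv).
move=> hx hy; have hx' := residue_val_int (mk x); have hy' := residue_val_int (mk y).
apply/to_residue_eq; try exact: vgeM0.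
set a := ssval _; set b := ssval _.
rewrite (_ : _ - _ = - ((x - a) * b + x * (y - b))); last first.
  by rewrite mulrBl mulrBr [_ - _ + (_ - _)]addrC addrA subrK opprB.
apply/(vposN hv)/(vposD hv); first by apply: (vposMl hv) => //; exact: ssval_mk.
by apply: (vposMr hv) => //; exact: ssval_mk.
Qed.

Fact residue_addA : associative residue_add.
Proof.
move=> s t u; have [x hx ->] := residueP s; have [y hy ->] := residueP t.
have [z hz ->] := residueP u.
by rewrite !residue_addE ?addrA //; apply: (vgeD hv).
Qed.
Fact residue_addC : commutative residue_add.
Proof. by move=> s t; rewrite /residue_add addrC. Qed.
Fact residue_add0 : left_id (mk 0) residue_add.
Proof.
move=> s; have [x hx ->] := residueP s.
by rewrite residue_addE ?add0r //; exact: (vge0 hv).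
Qed.
Fact residue_addN : left_inverse (mk 0) residue_opp residue_add.
Proof.
move=> s; have [x hx ->] := residueP s.
by rewrite residue_oppE // residue_addE ?addNr //; exact: (vgeN hv).
Qed.
HB.instance Definition _ := GRing.isZmodule.Build residue
  residue_addA residue_addC residue_add0 residue_addN.

Lemma vgeM00 a b : vge v 0 a -> vge v 0 b -> vge v 0 (a * b).
Proof. by move=> ha hb; rewrite -[0]addr0; exact: (vgeM hv). Qed.

Fact residue_mulA : associative residue_mul.
Proof.
move=> s t u; have [x hx ->] := residueP s; have [y hy ->] := residueP t.
have [z hz ->] := residueP u.
by rewrite !residue_mulE ?mulrA //; apply: vgeM00.
Qed.
Fact residue_mul1 : left_id (mk 1) residue_mul.
Proof.
move=> s; have [x hx ->] := residueP s.
by rewrite residue_mulE ?mul1r //; exact: (vge1 hv).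
Qed.
Fact residue_mulr1 : right_id (mk 1) residue_mul.
Proof.
move=> s; have [x hx ->] := residueP s.
by rewrite residue_mulE ?mulr1 //; exact: (vge1 hv).
Qed.
Fact residue_mulDl : left_distributive residue_mul residue_add.
Proof.
move=> s t u; have [x hx ->] := residueP s; have [y hy ->] := residueP t.
have [z hz ->] := residueP u.
rewrite residue_addE // !residue_mulE //; last exact: (vgeD hv).
by rewrite residue_addE ?mulrDl //; exact: vgeM00.
Qed.
Fact residue_mulDr : right_distributive residue_mul residue_add.
Proof.
move=> s t u; have [x hx ->] := residueP s; have [y hy ->] := residueP t.
have [z hz ->] := residueP u.
rewrite residue_addE // !residue_mulE //; last exact: (vgeD hv).
by rewrite residue_addE ?mulrDr //; exact: vgeM00.
Qed.
Fact residue_1neq0 : mk 1 != mk 0.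
Proof.
apply/eqP => /(to_residue_eq (vge1 hv) (vge0 hv 0)); rewrite subr0.
by move/(vposE hv (oner_neq0 A)); rewrite (vr1 hv) ltxx.
Qed.
HB.instance Definition _ := GRing.Zmodule_isNzRing.Build residue
  residue_mulA residue_mul1 residue_mulr1 residue_mulDl residue_mulDr residue_1neq0.

Lemma mk0 : mk 0 = 0. Proof. by []. Qed.
Lemma mk1 : mk 1 = 1. Proof. by []. Qed.

Lemma mkD x y : vge v 0 x -> vge v 0 y -> mk (x + y) = mk x + mk y.
Proof. by move=> hx hy; rewrite -residue_addE. Qed.

Lemma mkM x y : vge v 0 x -> vge v 0 y -> mk (x * y) = mk x * mk y.
Proof. by move=> hx hy; rewrite -residue_mulE. Qed.

Lemma mk_eq0 x : vge v 0 x -> mk x = 0 <-> vpos v x.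
Proof. by move=> hx; rewrite -mk0 to_residue_eq ?subr0 //; exact: (vge0 hv). Qed.

Lemma mkX x n : vge v 0 x -> mk (x ^+ n) = mk x ^+ n.
Proof.
move=> hx; elim: n => [|n IH]; first by rewrite !expr0.
by rewrite !exprS mkM ?IH //; rewrite -[0](mulr0 n%:R); exact: (vgeX hv).
Qed.

Lemma mk_nat n : mk n%:R = n%:R.
Proof.
elim: n => [|n IH]; first by rewrite !mulr0n.
by rewrite -!natr1 mkD ?IH //; [exact: (vge_nat hv)|exact: (vge1 hv)].
Qed.

Lemma mk_neq0 x : vge v 0 x -> mk x != 0 -> x != 0 /\ vr v x = 0.
Proof.
move=> hx /eqP h.
have x0 : x != 0 by apply/eqP => x0; apply: h; rewrite x0.
by split=> //; apply: (vge0_pos hv x0 hx) => /(mk_eq0 hx).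
Qed.

Lemma residue_inv_spec (t : residue) : t != 0 ->
  residue_inv t * t = 1 /\ t * residue_inv t = 1.
Proof.
move=> t0; rewrite /residue_inv -[mk 0]/(0 : residue) (negbTE t0).
have ht := residue_val_int t.
have [x0 hx] : ssval t != 0 /\ vr v (ssval t) = 0 by apply: mk_neq0; rewrite ?to_residueK.
have ux := hA x0.
have hi : vge v 0 (ssval t)^-1.
  by apply/(vgeE hv); [exact: inv_neq0_div|rewrite vr_inv // hx oppr0].
by rewrite -{2 3}(to_residueK t) -!mkM // mulVr // mulrV.
Qed.

Fact residue_mulV : {in [pred t : residue | t != 0], left_inverse 1 residue_inv *%R}.
Proof. by move=> t /residue_inv_spec[]. Qed.
Fact residue_divr : {in [pred t : residue | t != 0], right_inverse 1 residue_inv *%R}.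
Proof. by move=> t /residue_inv_spec[]. Qed.
Fact residue_unitP (x y : residue) : y * x = 1 /\ x * y = 1 -> x != 0.
Proof. by case=> h _; apply: contra_eq_neq h => ->; rewrite mulr0 eq_sym oner_neq0. Qed.
Fact residue_inv_out : {in [predC [pred t : residue | t != 0]], residue_inv =1 id}.
Proof.
move=> t; rewrite !inE negbK => /eqP ->.
by rewrite /residue_inv -[mk 0]/(0 : residue) eqxx.
Qed.
HB.instance Definition _ := GRing.NzRing_hasMulInverse.Build residue
  residue_mulV residue_divr residue_unitP residue_inv_out.

Lemma residue_unitE (t : residue) : (t \is a GRing.unit) = (t != 0).
Proof. by []. Qed.

Lemma residue_domain : GRing.integral_domain_axiom residue.
Proof.
move=> x y xy0; apply/negPn/negP; rewrite negb_or -!residue_unitE => /andP[ux uy].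
by have := unitrMl x uy; rewrite xy0 ux residue_unitE eqxx.
Qed.

(** The residue ring is a finite division ring, hence a field by Wedderburn's theorem, and its
    multiplicative group is cyclic; [z] lifts a generator and [N] is its order. *)
Theorem residue_generator : exists N z, [/\ (0 < N)%N, z != 0 /\ vr v z = 0,
  vpos v N.+1%:R,
  forall x, x != 0 -> vr v x = 0 -> exists m, vpos v (x - z ^+ m)
  & forall m, vpos v (z ^+ m - 1) <-> (N %| m)%N].
Proof.
have cyc : cyclic [set: {unit residue}]%SET.
  apply: (@div_ring_mul_group_cyclic _ _ residue (fun u => FinRing.uval u)) => //.
    move=> u /setD1P[u1 _]; rewrite residue_unitE subr_eq0.
    by apply: contra u1 => /eqP h; apply/eqP/val_inj.
  apply/centsP => u _ w _; apply: val_inj => /=.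
  exact: (finDomain_mulrC residue_domain).
have /cyclicP[g hg] := cyc.
exists #[g]%g, (ssval (FinRing.uval g)); set z := ssval _.
have hz : vge v 0 z by exact: residue_val_int.
have mkz : mk z = FinRing.uval g by exact: to_residueK.
have mkzX m : mk (z ^+ m) = FinRing.uval (g ^+ m)%g.
  by rewrite mkX // mkz; elim: m => [|m IH]; rewrite ?expr0 // exprS IH expgS.
have z0 : z != 0 /\ vr v z = 0.
  by apply: mk_neq0 => //; rewrite mkz -residue_unitE; exact: (valP g).
have vgez m : vge v 0 (z ^+ m) by rewrite -[0](mulr0 m%:R); exact: (vgeX hv).
split=> //.
- apply/(mk_eq0 (vge_nat hv _)); rewrite mk_nat.
  have -> : #[g]%g.+1 = #|{: residue}|.
    rewrite orderE -hg cardsT /= card_sub.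
    rewrite (eq_card (B := predC1 (0 : residue))); last first.
      by [].
    by rewrite cardC1 prednK //; apply/card_gt0P; exists 0.
  (* Lagrange in the additive group: the cardinal [N.+1] of the residue ring annihilates 1. *)
  pose F : finUnitRingType := residue.
  have := @expg_cardG F [set: F]%G (1%R : F) (finset.in_setT _).
  by rewrite FinRing.zmodXgE cardsT.
- move=> x x0 hx; have hx' : vge v 0 x by apply/(vgeE hv _ x0); rewrite hx.
  have ux : mk x \is a GRing.unit.
    rewrite residue_unitE; apply/eqP => /(mk_eq0 hx')/(vposE hv x0).
    by rewrite hx ltxx.
  have : FinRing.unit residue ux \in [set: {unit residue}]%SET by rewrite inE.
  rewrite hg => /cycleP[m hm]; exists m.
  by apply/(to_residue_eq hx' (vgez m)); rewrite mkzX -hm.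
move=> m; rewrite -(to_residue_eq (vgez m) (vge1 hv)) mkzX mk1 order_dvdn.
by split=> [h|/eqP ->//]; apply/eqP/val_inj.
Qed.

End ResidueRing.

(** * Lifting the residue field by roots of unity *)

Section DivisionStructure.
Variables (R : realType) (k : fieldType) (nu : k -> \bar R).
Hypothesis hk : is_odd_local_field nu.
Variables (A : unitRingType) (emb : {rmorphism k -> A}) (es : seq A) (v : A -> \bar R).
Hypothesis hA : forall x : A, x != 0 -> x \is a GRing.unit.
Hypothesis hes : forall x, in_span (fun c x => emb c * x) es x.
Hypotheses (hv : is_valuation v) (he : forall c, v (emb c) = nu c).

Lemma exists_nat_mul_ge (q B r : R) : 0 < q -> exists n : nat, r <= n%:R * q - B.
Proof.
move=> q0; exists (Num.truncn (`|r + B| / q)).+1.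
have : `|r + B| < (Num.truncn (`|r + B| / q)).+1%:R * q by rewrite -ltr_pdivrMr // truncnS_gt.
have := ler_norm (r + B); lra.
Qed.

Lemma vge_exprB x y n r : vge v 0 x -> vge v 0 y -> vge v r (x - y) ->
  vge v r (x ^+ n - y ^+ n).
Proof.
move=> hx hy hr; elim: n => [|n IH]; first by rewrite !expr0 subrr; exact: (vge0 hv).
have -> : x ^+ n.+1 - y ^+ n.+1 = x * (x ^+ n - y ^+ n) + (x - y) * y ^+ n.
  by rewrite mulrBr mulrBl addrA subrK -!exprS.
apply: (vgeD hv); first by rewrite -[r]add0r; apply: (vgeM hv).
have hyn : vge v 0 (y ^+ n) by rewrite -[0](mulr0 n%:R); exact: (vgeX hv).
by rewrite -[r]addr0; apply: (vgeM hv).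
Qed.

Lemma vr_emb c : vr v (emb c) = vr nu c.
Proof. by rewrite /vr he. Qed.

Lemma emb_neq0 c : c != 0 -> emb c != 0.
Proof. by rewrite fmorph_eq0. Qed.

Lemma emb_2 : emb 2 = 2.
Proof. by rewrite rmorph_nat. Qed.

Lemma two_neq0 : (2 : A) != 0.
Proof. by rewrite -emb_2 emb_neq0 // (lf_2neq0 hk). Qed.

Lemma vr_two : vr v 2 = 0.
Proof. by rewrite -emb_2 vr_emb (lf_vr2 hk). Qed.

Section Teichmuller.
Variable p : A.
Hypothesis hp : is_uniformizer v p.
Local Notation q := (unif_val v p).
Let q0 : 0 < q := unif_val_gt0 hv hp.

(* The limit of the powers [z ^+ (N.+1 ^ n)], where [z] lifts a generator of the
   multiplicative group of the residue field, which has [N.+1] elements. *)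
Theorem teichmuller : exists N z, [/\ (0 < N)%N, z != 0 /\ vr v z = 0,
  vpos v N.+1%:R /\ z ^+ N = 1,
  forall x, x != 0 -> vr v x = 0 -> exists m, vpos v (x - z ^+ m)
  & forall m, vpos v (z ^+ m - 1) <-> (N %| m)%N].
Proof.
have hsc := emb_is_scaling emb.
have hfil := vge_filtration hv.
have hsh := shifts_val_ext hv he.
have [S hS] := fil_reps hk hsc hfil hsh hes 0 q.
have hS' x : vge v 0 x -> exists2 y, y \in S & vpos v (x - y).
  by move=> /hS[y yS hy]; exists y => //; apply/(vpos_unif hv hp).
have [N [z [N0 [z0 hz] hQ hgen hord]]] := residue_generator hv hA hS'.
pose Q := N.+1.
have vz0 : vge v 0 z by apply/(vgeE hv _ z0); rewrite hz.
have vzX m : vge v 0 (z ^+ m) by rewrite -[0](mulr0 m%:R); exact: (vgeX hv).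
(* Raising [w], congruent to 1, to the power [Q] multiplies [w - 1] by a geometric sum congruent to
   [Q], which has positive value: each step gains [q]. *)
have hw n : vge v (n.+1%:R * q) (z ^+ (N * Q ^ n) - 1).
  elim: n => [|n IH].
    by rewrite mul1r muln1; apply/(vpos_unif hv hp)/hord.
  rewrite expnSr mulnA exprM subrX1 -natr1 mulrDl mul1r; apply: (vgeM hv) => //.
  apply/(vpos_unif hv hp).
  set w := z ^+ _; have -> : \sum_(i < Q) w ^+ i = \sum_(i < Q) (w ^+ i - 1) + Q%:R.
    by rewrite sumrB sumr_const card_ord subrK.
  apply: (vposD hv) => //; apply: (vpos_sum hv) => i _.
  apply/(vpos_unif hv hp); rewrite -(expr1n _ i).
  apply: vge_exprB; [exact: vzX|exact: (vge1 hv)|].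
  apply: vge_le IH; rewrite -[leLHS]mul1r ler_pM2r // -[1]/(1%:R) ler_nat //.
have hd n : vge v (n%:R * q) (z ^+ (Q ^ n.+1) - z ^+ (Q ^ n)).
  have -> : z ^+ (Q ^ n.+1) - z ^+ (Q ^ n) = z ^+ (Q ^ n) * (z ^+ (N * Q ^ n) - 1).
    by rewrite mulrBr mulr1 -exprD -mulSn expnS.
  rewrite -[_ * q]add0r; apply: (vgeM hv) => //; apply: vge_le (hw n).
  by rewrite ler_pM2r // ler_nat.
have [B [l hl]] := fil_series hk hsc hfil hsh hes q0 hd.
pose y := l + z.
have hy m : vge v (m%:R * q - B) (y - z ^+ (Q ^ m)).
  have := hl m; rewrite -(big_mkord xpredT (fun n => z ^+ (Q ^ n.+1) - z ^+ (Q ^ n))).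
  by rewrite telescope_sumr // expn0 expr1 opprB addrA.
have yz : vpos v (y - z).
  have [m hm] := exists_nat_mul_ge B q q0.
  have -> : y - z = (y - z ^+ (Q ^ m)) + (z ^+ (Q ^ m) - z) by rewrite addrA subrK.
  apply: (vposD hv); apply/(vpos_unif hv hp); first exact: vge_le (hy m).
  have -> : z ^+ (Q ^ m) - z = z * (z ^+ (Q ^ m).-1 - 1).
    by rewrite mulrBr mulr1 -exprS prednK // expn_gt0.
  rewrite -[q]add0r; apply: (vgeM hv) => //; apply/(vpos_unif hv hp)/hord.
  by rewrite predn_exp dvdn_mulr.
have [y0 vy] : y != 0 /\ vr v y = 0.
  by rewrite -hz; apply: (vr_dom hv z0 (r := q)); [rewrite hz|apply/(vpos_unif hv hp)].
have vy0 : vge v 0 y by apply/(vgeE hv _ y0); rewrite vy.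
have yzX m : vpos v (y ^+ m - z ^+ m).
  by apply/(vpos_unif hv hp)/vge_exprB => //; apply/(vpos_unif hv hp).
exists N, y; split=> //.
- split=> //; apply/eqP; rewrite -subr_eq0; apply/eqP/(vge_eq0 hv) => r.
  have [m hm] := exists_nat_mul_ge (`|B|) r q0.
  have -> : y ^+ N - 1 = (y ^+ N - (z ^+ (Q ^ m)) ^+ N) + (z ^+ (N * Q ^ m) - 1).
    by rewrite -exprM mulnC addrA subrK.
  have hB := ler_norm B; have hB0 := normr_ge0 B.
  apply: (vgeD hv); last by apply: vge_le (hw m); rewrite -natr1 mulrDl; have := q0; lra.
  by apply: vge_exprB => //; apply: vge_le (hy m); lra.
- move=> x x0 hx; have [m hm] := hgen x x0 hx; exists m.
  have -> : x - y ^+ m = (x - z ^+ m) - (y ^+ m - z ^+ m) by rewrite opprB addrA subrK.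
  exact: (vposB hv).
move=> m; rewrite -hord; split=> h.
  have -> : z ^+ m - 1 = (y ^+ m - 1) - (y ^+ m - z ^+ m).
    by rewrite opprB [RHS]addrC addrA subrK.
  exact: (vposB hv).
have -> : y ^+ m - 1 = (y ^+ m - z ^+ m) + (z ^+ m - 1) by rewrite addrA subrK.
exact: (vposD hv).
Qed.

End Teichmuller.
End DivisionStructure.

(** * A uniformizer normalizing the roots of unity *)

Section TameStructure.
Variables (R : realType) (k : fieldType) (nu : k -> \bar R).
Hypothesis hk : is_odd_local_field nu.
Variables (A : unitRingType) (emb : {rmorphism k -> A}) (es : seq A) (v : A -> \bar R).
Hypothesis hA : forall x : A, x != 0 -> x \is a GRing.unit.
Hypothesis hes : forall x, in_span (fun c x => emb c * x) es x.
Hypotheses (hv : is_valuation v) (he : forall c, v (emb c) = nu c).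

(** A tame presentation of the division algebra: the root of unity [z] generates the residue field,
    and conjugation by the uniformizer [j] is the [s]-th power map on it. *)
Record tame_pair (N s : nat) (z j : A) : Prop := {
  tp_N : (0 < N)%N;
  tp_s : (0 < s)%N;
  tp_z0 : z != 0;
  tp_vz : vr v z = 0;
  tp_zN : z ^+ N = 1;
  tp_gen : forall x, x != 0 -> vr v x = 0 -> exists m, vpos v (x - z ^+ m);
  tp_ord : forall m, vpos v (z ^+ m - 1) <-> (N %| m)%N;
  tp_unif : is_uniformizer v j;
  tp_comm : j * z = z ^+ s * j }.

Lemma vge0_vr0 x : x != 0 -> vr v x = 0 -> vge v 0 x.
Proof. by move=> x0 hx; apply/(vgeE hv _ x0); rewrite hx. Qed.

Lemma vge0_exp x m : vge v 0 x -> vge v 0 (x ^+ m).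
Proof. by move=> hx; rewrite -[0](mulr0 m%:R); exact: (vgeX hv). Qed.

(* A uniformizer [p] is made to normalize the powers of [z] by averaging it into
   [\sum_(m < N) z ^- (s * m) * p * z ^+ m]. *)
Lemma exists_tame_pair : exists N s z j, tame_pair N s z j.
Proof.
have [p hp] := exists_uniformizer hk hes hv he.
have [N [z [N0 [z0 vz] [hQ zN] hgen hord]]] := teichmuller hk hA hes hv he hp.
have p0 := unif_neq0 hp; have up := hA p0.
have hq := unif_val_gt0 hv hp; set q := unif_val v p in hq.
pose y := p * z / p.
have hy : y * p = p * z by rewrite /y mulrVK.
have y0 : y != 0 by rewrite /y !(mul_neq0 hv) // inv_neq0_div.
have vy : vr v y = 0.
  by rewrite /y !(vrM hv) ?(mul_neq0 hv) ?inv_neq0_div // vr_inv // vz; lra.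
(* Adding [N] does not change the power of [z] and makes the exponent positive, as [tp_s]
   demands. *)
have [s hs] := hgen y y0 vy; pose a := z ^+ (s + N).
have a0 : a != 0 by exact: (expr_neq0 hv).
have ua := hA a0.
have va : vr v a = 0 by rewrite /a (vrX hv) // vz mulr0.
have hya : vge v q (y - a) by apply/(vpos_unif hv hp); rewrite /a exprD zN mulr1.
have aN : a ^+ N = 1 by rewrite /a -exprM mulnC exprM zN expr1n.
have hyX m : y ^+ m * p = p * z ^+ m.
  elim: m => [|m IH]; first by rewrite !expr0 mul1r mulr1.
  by rewrite exprS -mulrA IH mulrA hy -mulrA -exprS.
pose j := \sum_(m < N) a ^- m * p * z ^+ m.
have jz : j * z = a * j.
  rewrite /j mulr_suml mulr_sumr.
  pose f (m : nat) := a * (a ^- m * p * z ^+ m).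
  have -> : \sum_(m < N) a ^- m * p * z ^+ m * z = \sum_(m < N) f m.+1.
    have haV (m : nat) : a * a ^- m.+1 = a ^- m.
      by rewrite exprSr (invrM (unitrX m ua) ua) mulrA mulrV // mul1r.
    by apply: eq_bigr => m _; rewrite /f !mulrA haV -!mulrA -exprSr.
  have hfN : f N = f 0%N by rewrite /f zN aN !expr0.
  have := erefl (\sum_(m < N.+1) f m).
  rewrite {1}big_ord_recl big_ord_recr /= hfN => h.
  by apply: (addrI (f 0%N)); rewrite [RHS]addrC; exact: h.
(* As [N.+1] has positive value, [N] is congruent to -1 and is a unit. Each summand of [j] being
   congruent to [p] to higher order, [j] has the value of [N * p], that of [p]. *)
have hN1 : (N%:R : A) != 0 /\ vr v N%:R = 0.
  have m10 : (-1 : A) != 0 by rewrite oppr_eq0 oner_neq0.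
  rewrite -(vrN1 hv); apply: (vr_dom hv m10 (r := q)); first by rewrite (vrN1 hv).
  by rewrite opprK natr1; apply/(vpos_unif hv hp).
have [j0 vj] : j != 0 /\ vr v j = q.
  have Np0 : N%:R * p != 0 by apply: (mul_neq0 hv) => //; exact: hN1.1.
  have vNp : vr v (N%:R * p) = q by rewrite (vrM hv) ?hN1.2 ?hN1.1 // add0r.
  rewrite -vNp; apply: (vr_dom hv Np0 (r := q + q)); first by rewrite vNp; lra.
  have -> : j - N%:R * p = \sum_(m < N) (a ^- m * p * z ^+ m - p).
    by rewrite sumrB sumr_const card_ord mulr_natl.
  apply: (vge_sum hv) => m _.
  have uam := unitrX m ua.
  have -> : a ^- m * p * z ^+ m - p = a ^- m * ((y ^+ m - a ^+ m) * p).
    by rewrite mulrBl mulrBr hyX !mulrA mulVr // mul1r.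
  have am0 := expr_neq0 hv m a0.
  rewrite -[q + q]add0r; apply: (vgeM hv).
    apply: vge0_vr0; first exact: inv_neq0_div.
    by rewrite vr_inv // (vrX hv) // va; lra.
  apply: (vgeM hv); last by exact: vge_vr.
  by apply: (vge_exprB hv) => //; apply: vge0_vr0.
exists N, (s + N)%N, z, j; split=> //; first by rewrite addn_gt0 N0 orbT.
split=> //; first by apply/(vposE hv j0); rewrite vj.
move=> x hx; rewrite (val_fin hv j0) vj; exact/(vpos_unif hv hp).
Qed.

Variables (N s : nat) (z j : A).
Hypothesis hT : tame_pair N s z j.
Local Notation q := (unif_val v j).
Let hj := tp_unif hT.
Let q0 : 0 < q := unif_val_gt0 hv hj.
Let j0 := unif_neq0 hj.
Let z0 := tp_z0 hT.

(** Sums of monomials in [j] and [z] are dense: the leading term of any remainder is some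
    [j ^ m * z ^+ l]. Such sums commute with everything that commutes with [z] and [j]. *)
Lemma tame_approx (x y : A) (n : nat) : x * z = z * x -> x * j = j * x ->
  exists2 a, x * a = a * x & vge v (vr v y + n%:R * q) (y - a).
Proof.
move=> xz xj; elim: n => [|n [a ha hya]].
  exists 0; first by rewrite mulr0 mul0r.
  by rewrite mul0r addr0 subr0; exact: (vge_vr hv).
have [hd|d0] := eqVneq (y - a) 0; first by exists a => //; rewrite hd; exact: (vge0 hv).
have [m hm hu] := unif_decomp hv hA hj d0.
have u0 : j ^ (- m) * (y - a) != 0 by rewrite (mul_neq0 hv) // (exprz_neq0 hv).
have [l hl] := tp_gen hT u0 hu.
have jm0 := exprz_neq0 hv hA m j0.
have hjm : j ^ m * j ^ (- m) = 1.
  have uj i : j ^+ i \is a GRing.unit by apply/unitrX/hA.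
  case: (m) => i; first by rewrite -exprnN -[j ^ i]/(j ^+ i) mulrV.
  by rewrite NegzE opprK -exprnN -[j ^ _]/(j ^+ i.+1) mulVr.
exists (a + j ^ m * z ^+ l).
  have xjm : x * j ^ m = j ^ m * x.
    case: (m) => i; first exact: commrX.
    by rewrite NegzE -exprnN; apply/commrV/commrX.
  by rewrite mulrDr mulrDl ha mulrA xjm -!mulrA; congr (_ + _ * _); apply: commrX.
have -> : y - (a + j ^ m * z ^+ l) = j ^ m * (j ^ (- m) * (y - a) - z ^+ l).
  by rewrite mulrBr mulrA hjm mul1r opprD addrA.
have hge : vr v y + n%:R * q <= vr v (y - a) by exact: (vr_ge hv d0 hya).
apply: (vge_le (r := vr v (y - a) + q)); first by rewrite -natr1 mulrDl mul1r addrA lerD2r.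
apply: (vgeM hv); last exact/(vpos_unif hv hj).
by apply/(vgeE hv _ jm0); rewrite (vrXz hv) // hm.
Qed.

Lemma tame_central x : x * z = z * x -> x * j = j * x -> forall y, x * y = y * x.
Proof.
move=> xz xj y; apply/eqP; rewrite -subr_eq0; apply/eqP/(vge_eq0 hv) => r.
have [n hn] := exists_nat_mul_ge (- (vr v x + vr v y)) r q0.
have [a xa ha] := tame_approx y n xz xj.
have -> : x * y - y * x = x * (y - a) - (y - a) * x.
  by rewrite mulrBr mulrBl xa opprB addrA subrK.
apply: (vge_le hn); rewrite opprK.
have hx := vge_vr hv x.
apply: (vgeB hv).
  have -> : n%:R * q + (vr v x + vr v y) = vr v x + (vr v y + n%:R * q) by ring.
  exact: (vgeM hv).
have -> : n%:R * q + (vr v x + vr v y) = (vr v y + n%:R * q) + vr v x by ring.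
exact: (vgeM hv).
Qed.

Lemma tame_comm_pow m : j * z ^+ m = z ^+ (s * m) * j.
Proof.
elim: m => [|m IH]; first by rewrite muln0 !expr0 mulr1 mul1r.
by rewrite exprSr mulrA IH -mulrA (tp_comm hT) mulrA -exprD mulnS addnC.
Qed.

Lemma tame_order m : (N %| m)%N -> z ^+ m = 1.
Proof. by move=> /dvdnP[l ->]; rewrite mulnC exprM (tp_zN hT) expr1n. Qed.

Lemma vge0_z m : vge v 0 (z ^+ m).
Proof. by apply/vge0_exp/vge0_vr0 => //; exact: tp_vz hT. Qed.

Lemma vpos_congM a b c d : vge v 0 a -> vge v 0 d -> vpos v (a - b) -> vpos v (c - d) ->
  vpos v (a * c - b * d).
Proof.
move=> ha hd hab hcd.
have -> : a * c - b * d = a * (c - d) + (a - b) * d by rewrite mulrBr mulrBl addrA subrK.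
by apply: (vposD hv); [exact: (vposMr hv)|exact: (vposMl hv)].
Qed.

Lemma vpos_congC a b : a != 0 -> vr v a = 0 -> b != 0 -> vr v b = 0 ->
  vpos v (a * b - b * a).
Proof.
move=> a0 va b0 vb; have [m hm] := tp_gen hT a0 va; have [n hn] := tp_gen hT b0 vb.
have ga := vge0_vr0 a0 va; have gb := vge0_vr0 b0 vb.
have -> : a * b - b * a = (a * b - z ^+ m * z ^+ n) - (b * a - z ^+ n * z ^+ m).
  by rewrite -!exprD addnC opprB addrA subrK.
by apply: (vposB hv); apply: vpos_congM => //; exact: vge0_z.
Qed.

Lemma vpos_conj a b : a != 0 -> vpos v b -> vpos v (a * b / a).
Proof.
have [->|b0] := eqVneq b 0; first by rewrite mulr0 mul0r.
move=> a0 /(vposE hv b0) hb; have a'0 := inv_neq0_div hA a0.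
apply/(vposE hv); first by rewrite !(mul_neq0 hv).
rewrite !(vrM hv) ?(mul_neq0 hv) // vr_inv //; lra.
Qed.

Section WithInvolution.
Variable rho : A -> A.
Hypotheses (hrho : is_ring_involution rho) (vrho : forall x, vr v (rho x) = vr v x).

Let rho0 : rho 0 = 0.
Proof. by apply: (addIr (rho 0)); rewrite -(inv_add hrho) !add0r. Qed.

Let rho_neq0 x : x != 0 -> rho x != 0.
Proof. by apply: contra => /eqP h; rewrite -(inv_invol hrho x) h rho0. Qed.

Lemma vpos_rho x : vpos v x -> vpos v (rho x).
Proof.
have [->|x0] := eqVneq x 0; first by rewrite rho0.
by move/(vposE hv x0) => h; apply/(vposE hv (rho_neq0 x0)); rewrite vrho.
Qed.

Lemma rho_exp x m : rho (x ^+ m) = rho x ^+ m.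
Proof.
elim: m => [|m IH]; first by rewrite !expr0 (inv_one hrho).
by rewrite exprS (inv_mul hrho) IH exprSr.
Qed.

Lemma rhoB x y : rho (x - y) = rho x - rho y.
Proof.
rewrite (inv_add hrho); congr (_ + _).
by apply: (addIr (rho y)); rewrite -(inv_add hrho) !addNr rho0.
Qed.

Lemma tame_conj_pow x : x != 0 -> vr v x = 0 -> vpos v (j * x / j - x ^+ s).
Proof.
move=> x0 vx; have [m hm] := tp_gen hT x0 vx; have uj := hA j0.
have gx := vge0_vr0 x0 vx.
have -> : j * x / j - x ^+ s = j * (x - z ^+ m) / j - (x ^+ s - (z ^+ m) ^+ s).
  rewrite mulrBr mulrBl tame_comm_pow mulrK // -exprM mulnC.
  by rewrite opprB addrA subrK.
apply: (vposB hv); first exact: vpos_conj.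
by apply/(vpos_unif hv hj)/(vge_exprB hv) => //; [exact: vge0_z|apply/(vpos_unif hv hj)].
Qed.

(* Conjugation by any uniformizer is [x |-> x ^+ s] on the residue field.  The
   anti-automorphism [rho] turns it into the inverse of such a conjugation. *)
Lemma tame_s_square : (N %| s * s - 1)%N.
Proof.
have uj := hA j0; have rj0 := rho_neq0 j0; have rz0 := rho_neq0 z0.
set y := rho z in rz0; have vy : vr v y = 0 by rewrite vrho (tp_vz hT).
have gy := vge0_vr0 rz0 vy.
pose u := j^-1 * rho j.
have u0 : u != 0 by rewrite (mul_neq0 hv) // inv_neq0_div.
have vu : vr v u = 0 by rewrite (vrM hv) ?inv_neq0_div // vr_inv // vrho; lra.
have uu := hA u0.
have hju : rho j = j * u by rewrite /u mulrA mulrV // mul1r.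
clearbody u.
have ys0 := expr_neq0 hv s rz0.
have vys : vr v (y ^+ s) = 0 by rewrite (vrX hv) // vy mulr0.
(* Applying [rho] to [j * z = z ^+ s * j] reverses it: conjugation by [rho j = j * u] sends [y ^+ s]
   to [y]. The unit [u] is invisible modulo the maximal ideal, where conjugation by [j] is the
   [s]-th power, so [y] is congruent to [y ^+ (s * s)]. *)
have rel : y * j * u = j * u * y ^+ s.
  have := congr1 rho (tp_comm hT); rewrite !(inv_mul hrho) rho_exp -/y hju mulrA; exact.
have rel2 : y = j * (u * y ^+ s / u) / j.
  rewrite !mulrA -rel mulrK // mulrK //.
have h1 : vpos v (u * y ^+ s / u - y ^+ s).
  have -> : u * y ^+ s / u - y ^+ s = (u * y ^+ s - y ^+ s * u) / u.
    by rewrite mulrBl mulrK.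
  apply: (vposMl hv); first exact: vpos_congC.
  by apply: vge0_vr0; [exact: inv_neq0_div|rewrite vr_inv // vu oppr0].
have h2 := vpos_conj j0 h1; have h3 := tame_conj_pow ys0 vys.
have h4 : vpos v (y - y ^+ (s * s)).
  rewrite exprM.
  have -> : y - (y ^+ s) ^+ s =
      (j * (u * y ^+ s / u - y ^+ s) / j) + (j * y ^+ s / j - (y ^+ s) ^+ s).
    by rewrite {1}rel2 mulrBr mulrBl addrA subrK.
  exact: (vposD hv).
have ss : (0 < s * s)%N by rewrite muln_gt0 (tp_s hT).
apply/(tp_ord hT).
have h5 : vpos v (rho (y - y ^+ (s * s))) by exact: vpos_rho.
move: h5; rewrite rhoB rho_exp (inv_invol hrho) => h5.
have vz' := tp_vz hT; have z'0 := inv_neq0_div hA z0.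
have -> : z ^+ (s * s - 1) - 1 = z^-1 * - (z - z ^+ (s * s)).
  by rewrite mulrN mulrBr mulVr ?hA // opprB -[in RHS](subnK ss) addn1 exprS mulKr ?hA.
apply: (vposMr hv); last exact: (vposN hv).
by apply: vge0_vr0 => //; rewrite vr_inv // vz' oppr0.
Qed.

End WithInvolution.
End TameStructure.

(** * Division algebras with involution are fields or quaternion algebras *)

Section QuaternionStructure.
Variables (R : realType) (k : fieldType) (nu : k -> \bar R).
Hypothesis hk : is_odd_local_field nu.
Variables (A : unitRingType) (emb : {rmorphism k -> A}) (es : seq A) (v : A -> \bar R).
Hypothesis hA : forall x : A, x != 0 -> x \is a GRing.unit.
Hypothesis hes : forall x, in_span (fun c x => emb c * x) es x.
Hypotheses (hv : is_valuation v) (he : forall c, v (emb c) = nu c).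
Hypothesis hembC : forall c x, emb c * x = x * emb c.
Hypothesis hcent : forall x : A, (forall y, x * y = y * x) -> exists c, x = emb c.
Variable rho : A -> A.
Hypotheses (hrho : is_ring_involution rho) (vrho : forall x, vr v (rho x) = vr v x).

Record quaternion_pair (i j : A) : Prop := {
  qp_i0 : i != 0;
  qp_j0 : j != 0;
  qp_ii : exists c, i * i = emb c;
  qp_jj : exists c, j * j = emb c;
  qp_ij : i * j = - (j * i);
  qp_span : forall x, exists a b c d, x = emb a + emb b * i + (emb c + emb d * i) * j }.

Lemma emb_half_double x : emb 2^-1 * (x + x) = x.
Proof.
have h : emb 2^-1 * 2 = 1 by rewrite -(rmorph_nat emb) -rmorphM mulVf ?(lf_2neq0 hk) // rmorph1.
by rewrite -mulr2n -[x *+ 2]mulr_natl mulrA h mul1r.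
Qed.

(** Conjugation by [g] is an involutive operator, and 2 is invertible, so [x] splits into
    eigenvectors for 1 and -1. The last clause keeps track of what else the two parts commute
    with. *)
Lemma square_split (g x : A) c : g * g = emb c -> c != 0 ->
  exists a b, [/\ x = a + b, g * a = a * g, g * b = - (b * g) &
    forall t, t * x = x * t -> (t * g = g * t \/ t * g = - (g * t)) ->
      t * a = a * t /\ t * b = b * t].
Proof.
move=> gg c0; pose u := emb c^-1 * (g * x * g).
have embK : emb c^-1 * emb c = 1 by rewrite -rmorphM mulVf // rmorph1.
have gu : g * u = x * g by rewrite /u mulrA -hembC -!mulrA [g * (g * _)]mulrA gg mulrA embK mul1r.
have ug : u * g = g * x.
  rewrite /u -!mulrA gg -[x * emb c]hembC [g * (_ * x)]mulrA -[g * emb c]hembC.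
  by rewrite -[emb c * g * x]mulrA mulrA embK mul1r.
have hcomm d t : GRing.comm t (emb d) by rewrite /GRing.comm hembC.
exists (emb 2^-1 * (x + u)), (emb 2^-1 * (x - u)); split.
- by rewrite -mulrDr addrACA subrr addr0 emb_half_double.
- by rewrite mulrA -hembC -!mulrA mulrDr mulrDl gu ug addrC.
- by rewrite mulrA -hembC -!mulrA mulrBr mulrBl gu ug -[RHS]mulrN opprB.
move=> t tx tg.
have tu : GRing.comm t u.
  apply: commrM; first exact: hcomm.
  case: tg => h; first by apply: commrM => //; exact: commrM.
  rewrite /GRing.comm !mulrA h !mulNr -[g * t * x]mulrA tx !mulrA -[g * x * t * g]mulrA h.
  by rewrite mulrN opprK !mulrA.
by split; apply: commrM; rewrite ?hcomm //; [exact: commrD|exact: commrB].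
Qed.

(** By [tame_s_square], [s] acts on the powers of [z] with square 1. If [s] acts trivially, [z] and
    [j] commute, hence are central and the algebra is [k]. Otherwise [i = z - z ^+ s] and [j] form a
    quaternion pair. *)
Theorem tame_structure : exists2 p, is_uniformizer v p &
  ((forall x, exists c, x = emb c) /\ vr v p = 1) \/
  ((exists i j, quaternion_pair i j) /\ vr v p = 1 / 2).
Proof.
have [N [s [z [j hT]]]] := exists_tame_pair hk hA hes hv he.
have hp := tp_unif hT; exists j => //.
have q0 := unif_val_gt0 hv hp; have j0 := unif_neq0 hp; have z0 := tp_z0 hT.
have vz := tp_vz hT.
have hz : forall x, x * z = z * x -> x * j = j * x -> exists c, x = emb c.
  by move=> x xz xj; apply/hcent/(tame_central hA hv hT).
have ss := tame_s_square hA hv hT hrho vrho.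
have s0 := tp_s hT.
have [w [w0 ew0 vw]] := emb_unif hk he.
have q1 : vr v j <= 1.
  by rewrite -vw; apply: (vr_ge hv ew0); apply/(vpos_unif hv hp)/(vposE hv ew0); rewrite vw.
have hint c : emb c != 0 -> exists n : int, vr v (emb c) = n%:~R.
  by rewrite fmorph_eq0 => c0; rewrite (vr_emb he); exact: lf_vr_int hk _ c0.
have [hs|hs] := boolP (N %| s - 1)%N.
  left; have zs : z ^+ s = z.
    by rewrite -(subnK s0) addn1 exprS (tame_order hT hs) mulr1.
  have jz : j * z = z * j by rewrite (tp_comm hT) zs.
  have [cz ez] := hz z erefl (esym jz); have [cj ej] := hz j jz erefl.
  have hall x : exists c, x = emb c by apply: hz; rewrite ?ez ?ej hembC.
  split=> //; apply/eqP; rewrite eq_le q1 /=.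
  have [|n hn] := hint cj; first by rewrite -ej.
  move: q0; rewrite /unif_val {2}ej ej hn ltr0z -[1]/(1%:~R) ler_int; exact.
(* Conjugation by [j] exchanges [z] and [z ^+ s], so their difference anticommutes with [j]; it is a
   unit because [z ^+ (s - 1)] is not congruent to 1. *)
right; have [i idef] : exists i, i = z - z ^+ s by exists (z - z ^+ s).
have ji : j * i = - (i * j).
  rewrite idef mulrBr mulrBl opprB (tp_comm hT) (tame_comm_pow hT).
  congr (_ - _ * _); rewrite -[(s * s)%N](subnK (_ : 0 < s * s)%N) ?muln_gt0 ?s0 //.
  by rewrite addn1 exprS (tame_order hT ss) mulr1.
have ij : i * j = - (j * i) by rewrite ji opprK.
have zi : z * i = i * z.
  by rewrite idef mulrBr mulrBl -exprS -exprSr.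
have gi : vge v 0 i; first rewrite idef.
  by apply: (vgeB hv); [rewrite -[z]expr1|]; exact: (vge0_z hv hT).
have npi : ~ vpos v i.
  move=> hi; move/negP: hs; apply; apply/(tp_ord hT).
  have -> : z ^+ (s - 1) - 1 = z^-1 * - i.
    by rewrite idef opprB mulrBr mulVr ?hA // -[in RHS](subnK s0) addn1 exprS mulKr ?hA.
  apply: (vposMr hv); last exact: (vposN hv).
  by apply: (vge0_vr0 hv); [exact: inv_neq0_div|rewrite vr_inv // vz oppr0].
have i0 : i != 0 by apply/eqP => h; apply: npi; rewrite h; exact: (vpos0 hv).
have vi : vr v i = 0 by exact: (vge0_pos hv).
have [ci eii] : exists c, i * i = emb c.
  apply: hz; first by rewrite -mulrA -zi mulrA -zi mulrA.
  by rewrite -mulrA ij mulrN [i * (j * i)]mulrA ij mulNr opprK mulrA.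
have [cj ejj] : exists c, j * j = emb c.
  apply: hz; last by rewrite mulrA.
  rewrite -mulrA (tp_comm hT) mulrA (tame_comm_pow hT) -mulrA.
  rewrite -[(s * s)%N](subnK (_ : 0 < s * s)%N) ?muln_gt0 ?s0 //.
  by rewrite addn1 exprS (tame_order hT ss) mulr1.
have ci0 : ci != 0 by rewrite -(fmorph_eq0 emb) -eii (mul_neq0 hv).
have cj0 : cj != 0 by rewrite -(fmorph_eq0 emb) -ejj (mul_neq0 hv).
(* The sum of the two conjugates is central, so [z] is an affine function of [i] over [k], and the
   centralizer of [i] and [j] is that of [z] and [j]. *)
have [ct et] : exists c, z + z ^+ s = emb c.
  apply: hz; first by rewrite mulrDr mulrDl -exprS -exprSr.
  rewrite mulrDr mulrDl (tp_comm hT) (tame_comm_pow hT) addrC.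
  congr (_ + _ * _); rewrite -[(s * s)%N](subnK (_ : 0 < s * s)%N) ?muln_gt0 ?s0 //.
  by rewrite addn1 exprS (tame_order hT ss) mulr1.
have zE : z = emb 2^-1 * (emb ct + i).
  by rewrite -et idef addrACA subrr addr0 emb_half_double.
have hij x : x * i = i * x -> x * j = j * x -> exists c, x = emb c.
  move=> xi xj; apply: hz => //; rewrite zE.
  rewrite mulrA -hembC -!mulrA; congr (_ * _).
  by rewrite mulrDr mulrDl xi hembC.
have emb_div (x g : A) c d : g * g = emb c -> c != 0 -> x * g = emb d ->
    x = emb (d / c) * g.
  move=> gg c0 xg; rewrite rmorphM -xg -mulrA [emb c^-1 * g]hembC !mulrA -[x * g * g]mulrA gg.
  by rewrite -mulrA -rmorphM mulfV // rmorph1 mulr1.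
have hi x : x * i = i * x -> exists a b, x = emb a + emb b * i.
  move=> xi; have [a [b [xE ja jb hab]]] := square_split x ejj cj0.
  have [ia ib] := hab i (esym xi) (or_intror ij).
  have [ca aE] := hij a (esym ia) (esym ja).
  have [||cb hcb] := hij (b * i); first by rewrite mulrA ib.
    by rewrite -mulrA ij mulrN !mulrA jb mulNr.
  by exists ca, (cb / ci); rewrite xE aE (emb_div _ _ _ _ eii ci0 hcb).
have span x : exists a b c d, x = emb a + emb b * i + (emb c + emb d * i) * j.
  have [a [b [-> ia ib _]]] := square_split x eii ci0.
  have [ca [cb ->]] := hi a (esym ia).
  have [|cc [cd hb]] := hi (b * j).
    by rewrite -mulrA -[j * i]opprK -ij mulrN !mulrA ib mulNr.
  exists ca, cb, (cc / cj), (cd / cj); congr (_ + _).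
  have bE : b = b * j * (emb cj^-1 * j).
    rewrite -[b * j * _]mulrA [j * (_ * j)]mulrA -hembC -[emb _ * j * j]mulrA ejj.
    by rewrite -rmorphM mulVf // rmorph1 mulr1.
  rewrite bE hb mulrA; congr (_ * _); rewrite mulrDl !rmorphM; congr (_ + _).
  by rewrite -!mulrA; congr (_ * _); rewrite hembC.
split; first by exists i, j; split=> //; [exists ci|exists cj].
have v2 : vr v j + vr v j = vr nu cj.
  by rewrite -(vr_emb he) -ejj (vrM hv).
have [n hn] := lf_vr_int hk cj0.
(* If [j] had value 1, then [u = j / w] would be a unit anticommuting with [i], whereas units
   commute modulo the maximal ideal and 2 is a unit. As twice the value of [j] is an integer, only
   [1 / 2] remains. *)
have qn1 : vr v j != 1.
  apply/eqP => q1'; have ew'0 := inv_neq0_div hA ew0.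
  pose u := (emb w)^-1 * j.
  have u0 : u != 0 by rewrite (mul_neq0 hv).
  have vu : vr v u = 0 by rewrite (vrM hv) // vr_inv // vw q1'; lra.
  have ui : u * i - i * u = (- 2) * (i * u).
    have wi : (emb w)^-1 * i = i * (emb w)^-1.
      by apply/esym/commrV; rewrite /GRing.comm hembC.
    rewrite /u -mulrA ji mulrN !mulrA wi -!mulrA mulNr mulr_natl mulr2n opprD //.
  have := vpos_congC hv hT u0 vu i0 vi; rewrite ui; clearbody u.
  have n20 : (-2 : A) != 0 by rewrite oppr_eq0 (two_neq0 hk).
  have iu0 := mul_neq0 hv i0 u0.
  move/(vposE hv (mul_neq0 hv n20 iu0)); rewrite !(vrM hv) // (vrN hv) (vr_two hk he) vi vu.
  by rewrite !addr0 ltxx.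
rewrite hn in v2.
have n1 : 0 < n by rewrite -(ltr0z R) -v2 addr_gt0.
have n2 : n < 2.
  rewrite -(ltr_int R) -v2.
  have : vr v j < 1 by rewrite lt_neqAle qn1.
  move=> h; rewrite -[2%:~R]/(2 : R); lra.
have n1' : n = 1 by lia.
by rewrite n1' in v2; lra.
Qed.

End QuaternionStructure.

(** * Lattice functions as norms *)

(** Naming the action keeps scalars in [D], so that products of scalars are read there and not in
    the converse ring. *)
Definition ract (D : nzRingType) (V : lmodType D^c) (y : D) (w : V) : V := (y : D^c) *: w.

Import VectorInternalTheory.

Section RightAction.
Variables (D : nzRingType) (V : lmodType D^c).
Implicit Types (y z : D) (w : V).

Lemma ractM y z w : ract (y * z) w = ract z (ract y w).
Proof. by rewrite /ract scalerA. Qed.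

Lemma ract1 w : ract 1 w = w.
Proof. exact: scale1r. Qed.

Lemma ract0 w : ract 0 w = 0.
Proof. exact: scale0r. Qed.

Lemma ractD y w1 w2 : ract y (w1 + w2) = ract y w1 + ract y w2.
Proof. exact: scalerDr. Qed.

Lemma ractDl y z w : ract (y + z) w = ract y w + ract z w.
Proof. exact: scalerDl. Qed.

Lemma ractBl y z w : ract (y - z) w = ract y w - ract z w.
Proof. exact: scalerBl. Qed.

Lemma ractN y w : ract y (- w) = - ract y w.
Proof. exact: scalerN. Qed.

Lemma ractNl y w : ract (- y) w = - ract y w.
Proof. exact: scaleNr. Qed.

Lemma ract_sum y (I : Type) (s : seq I) (P : pred I) (F : I -> V) :
  ract y (\sum_(i <- s | P i) F i) = \sum_(i <- s | P i) ract y (F i).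
Proof. exact: scaler_sumr. Qed.

End RightAction.

Section LatticeFunctions.
Variables (R : realType) (D : unitRingType) (v : D -> \bar R).
Hypotheses (hv : is_valuation v) (hD : forall x : D, x != 0 -> x \is a GRing.unit).
Variable p : D.
Hypothesis hp : is_uniformizer v p.
Local Notation q := (vr v p).
Variable V : vectType D^c.
Implicit Types (L : R -> set V) (w : V).

Let q0 : 0 < q := unif_val_gt0 hv hp.
Let p0 := unif_neq0 hp.

(** The inequality is homogeneity, since it also applies to the inverse of [y]. Finite generation is
    left out: it follows from boundedness of coordinates in [right_norm_latf]. *)
Definition right_norm L : Prop :=
  filtration L /\ forall y : D, y != 0 -> shifts L L (vr v y) (ract y).

Definition crd w (i : 'I_(dim V)) : D := v2r w 0 i.

Definition crd_basis (i : 'I_(dim V)) : V := r2v (delta_mx 0 i).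

Lemma crdD w1 w2 i : crd (w1 + w2) i = crd w1 i + crd w2 i.
Proof. by rewrite /crd linearD mxE. Qed.

Lemma crdB w1 w2 i : crd (w1 - w2) i = crd w1 i - crd w2 i.
Proof. by rewrite /crd linearB !mxE. Qed.

Lemma crdM y w i : crd (ract y w) i = crd w i * y.
Proof. by rewrite /crd /ract linearZ mxE. Qed.

Lemma crd0 i : crd 0 i = 0.
Proof. by rewrite /crd linear0 mxE. Qed.

Lemma crd_sum (I : Type) (s : seq I) (P : pred I) (F : I -> V) i :
  crd (\sum_(j <- s | P j) F j) i = \sum_(j <- s | P j) crd (F j) i.
Proof. by rewrite /crd linear_sum summxE. Qed.

Lemma crd_inj w : (forall i, crd w i = 0) -> w = 0.
Proof.
move=> h; apply: v2r_inj; rewrite linear0; apply/rowP => i; rewrite mxE; exact: h.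
Qed.

Lemma crd_expand w : w = \sum_i ract (crd w i) (crd_basis i).
Proof.
rewrite -{1}(v2rK w) {1}(row_sum_delta (v2r w)) linear_sum; apply: eq_bigr => i _.
by rewrite linearZ.
Qed.

Section OfLatticeFunction.
Variable L : R -> set V.
Hypothesis hL : is_lattice_function v q L.

Lemma latf_0 r : L r 0.
Proof.
have [n [g [-> _]]] := latf_lattice hL r; exists (fun=> 0).
  by move=> i; exact: (vge0 hv).
by rewrite big1 // => i _; rewrite scale0r.
Qed.

Lemma latf_sub r w1 w2 : L r w1 -> L r w2 -> L r (w1 - w2).
Proof.
have [n [g [-> _]]] := latf_lattice hL r => -[c hc ->] [d hd ->].
exists (fun i => c i - d i); first by move=> i; apply: (vgeB hv); [exact: hc|exact: hd].
by rewrite -sumrB; apply: eq_bigr => i _; rewrite -scalerBl.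
Qed.

Lemma latf_int r y w : vge v 0 y -> L r w -> L r (ract y w).
Proof.
move=> hy; have [n [g [-> _]]] := latf_lattice hL r => -[c hc ->].
exists (fun i => c i * y); first by move=> i; apply: (vgeM00 hv) => //; exact: hc.
by rewrite ract_sum; apply: eq_bigr => i _; exact/esym/ractM.
Qed.

Lemma latf_sum r (I : Type) (s : seq I) (P : pred I) (F : I -> V) :
  (forall i, P i -> L r (F i)) -> L r (\sum_(i <- s | P i) F i).
Proof.
move=> h; apply: big_ind => //; first exact: latf_0.
move=> x y hx hy; rewrite -[y]opprK; apply: latf_sub => //.
by rewrite -sub0r; apply: latf_sub => //; exact: latf_0.
Qed.

Lemma latf_p r w : L r w -> L (r + q) (ract p w).
Proof.
move=> hw; rewrite -(latf_period hL); exists 1%N, (fun=> w), (fun=> p); split=> //.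
  by move=> _; exact: unif_gt0 hp.
by rewrite big_ord1.
Qed.

Lemma latf_pV r w : L (r + q) w -> L r (ract p^-1 w).
Proof.
rewrite -(latf_period hL) => -[n [g [c [hg hc ->]]]].
rewrite ract_sum; apply: latf_sum => i _.
have -> : ract p^-1 ((c i : D^c) *: g i) = ract (c i * p^-1) (g i) by rewrite ractM.
apply: latf_int => //; apply: (vge_le (r := q + - q)); first by rewrite subrr.
apply: (vgeM hv); first by apply/(vpos_unif hv hp); exact: hc.
by rewrite -(vr_inv hv hD p0); exact: vge_vr.
Qed.

Lemma latf_pX r w n : L r w -> L (r + n%:R * q) (ract (p ^+ n) w).
Proof.
elim: n => [|n IH] hw; first by rewrite mul0r addr0 expr0 ract1.
by rewrite -natr1 mulrDl mul1r addrA exprSr ractM; apply/latf_p/IH.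
Qed.

Lemma latf_pXV r w n : L r w -> L (r - n%:R * q) (ract (p ^- n) w).
Proof.
elim: n r w => [|n IH] r w hw; first by rewrite mul0r subr0 expr0 invr1 ract1.
have up := hD p0.
rewrite exprS invrM ?unitrX // ractM -natr1 mulrDl mul1r opprD [- _ - q]addrC addrA.
rewrite addrAC.
by apply: latf_pV; rewrite subrK; exact: IH.
Qed.

Lemma latf_pXz r w (n : int) : L r w -> L (r + n%:~R * q) (ract (p ^ n) w).
Proof.
case: n => n hw; first exact: latf_pX.
by rewrite NegzE mulrNz mulNr -exprnN -pmulrn; apply: latf_pXV.
Qed.

Lemma latf_shifts y : y != 0 -> shifts L L (vr v y) (ract y).
Proof.
move=> y0 s w hw; have [n hn hu] := unif_decomp hv hD hp y0.
have pn0 := exprz_neq0 hv hD n p0.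
have -> : y = p ^ n * (p ^ (- n) * y).
  have up i : p ^+ i \is a GRing.unit by apply/unitrX/hD.
  case: (n) => i; first by rewrite -exprnN -[p ^ i]/(p ^+ i) mulVKr.
  by rewrite NegzE opprK -exprnN -[p ^ _]/(p ^+ i.+1) mulKr.
rewrite (vrM hv) // ?(mul_neq0 hv) ?(exprz_neq0 hv) // hu addr0 ractM.
rewrite (vrXz hv hD) //; apply: latf_int; last exact: latf_pXz.
by apply: (vge0_vr0 hv) => //; rewrite (mul_neq0 hv) ?(exprz_neq0 hv).
Qed.

Lemma latf_le r s w : s <= r -> L r w -> L s w.
Proof. by rewrite le_eqVlt => /orP[/eqP -> //|/(latf_decr hL)]; exact. Qed.

Theorem latf_right_norm : right_norm L.
Proof.
split; last exact: latf_shifts.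
have [n [g [L0 hspan]]] := latf_lattice hL 0.
have hg i : L 0 (g i).
  rewrite L0; exists (fun j => if j == i then 1 else 0).
    by move=> j; case: eqP => _; [exact: (vge1 hv)|exact: (vge0 hv)].
  by rewrite (bigD1 i) //= eqxx scale1r big1 ?addr0 // => j /negbTE ->; rewrite scale0r.
split.
- exact: latf_0.
- exact: latf_sub.
- by move=> r s w; exact: latf_le.
- by move=> r w h; rewrite (latf_left hL).
- move=> w; have [c ->] := hspan w; exists (- \sum_i `|vr v (c i)|).
  apply: latf_sum => i _; rewrite -[_ *: _]/(ract (c i) (g i)).
  have [->|c0] := eqVneq (c i) 0; first by rewrite ract0; exact: latf_0.
  have := latf_shifts c0 (hg i); apply: latf_le; rewrite add0r lerNl.
  rewrite (bigD1 i) //=; have := ler_norm (- vr v (c i)); rewrite normrN.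
  have : 0 <= \sum_(j < n | j != i) `|vr v (c j)| by apply: sumr_ge0.
  lra.
(* Coordinates are bounded below on the finitely generated [L 0]; an element of every [L r] remains
   in [L 0] after division by any power of [p], so its coordinates have infinite value. *)
move=> w hw; apply: crd_inj => i.
pose B := \sum_j `|vr v (crd (g j) i)|.
have hB u : L 0 u -> vge v (- B) (crd u i).
  rewrite L0 => -[c hc ->]; rewrite crd_sum; apply: (vge_sum hv) => j _.
  rewrite -[(c j : D^c) *: g j]/(ract (c j) (g j)) crdM -[- B]addr0; apply: (vgeM hv); last exact: hc.
  apply: (vge_le _ (vge_vr hv _)); rewrite /B (bigD1 j) //=.
  have := ler_norm (- vr v (crd (g j) i)); rewrite normrN.
  have : 0 <= \sum_(l < n | l != j) `|vr v (crd (g l) i)| by apply: sumr_ge0.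
  lra.
apply: (vge_eq0 hv) => r.
have [m hm] := exists_nat_mul_ge B r q0.
have up := unitrX m (hD p0).
have : L 0 (ract (p ^- m) w) by rewrite -[0](subrr (m%:R * q)); exact: latf_pXV.
move/hB; rewrite crdM => h; apply: (vge_le hm).
rewrite -(mulrVK up (crd w i)) addrC; apply: (vgeM hv) => //.
by rewrite -(vrX hv) //; exact: vge_vr.
Qed.

End OfLatticeFunction.

Section ToLatticeFunction.

(** Echelon form over the valuation ring, where only the first [m] coordinates may be nonzero. An
    element whose last such coordinate has least value, which exists by discreteness and the bound
    [B], clears that coordinate in all others. *)
Lemma fg_submodule (m : nat) (P : set V) (B : R) :
  P 0 -> (forall w1 w2, P w1 -> P w2 -> P (w1 - w2)) ->
  (forall y w, vge v 0 y -> P w -> P (ract y w)) ->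
  (forall w i, P w -> vge v B (crd w i)) ->
  (forall w i, P w -> (m <= nat_of_ord i)%N -> crd w i = 0) ->
  exists gs : seq V, (forall i : 'I_(size gs), P gs`_i) /\
   forall w, P w -> exists2 c : 'I_(size gs) -> D, (forall i, vge v 0 (c i)) &
     w = \sum_(i < size gs) ract (c i) gs`_i.
Proof.
elim: m P => [|m IH] P P0 PB Pint Pb Pc.
  exists [::]; split=> [[]//|w hw]; exists (fun=> 0); first by move=> i; exact: (vge0 hv).
  by rewrite big_ord0; apply: crd_inj => i; apply: Pc.
have [hall|hne] := pselect (forall w (i : 'I_(dim V)), P w -> nat_of_ord i = m -> crd w i = 0).
  apply: IH => // w i hw; rewrite leq_eqVlt => /orP[/eqP/esym/(hall w i hw)//|]; exact: Pc.
have [w1 [i0 [hw1 hi0 hc1]]] : exists w (i : 'I_(dim V)),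
    [/\ P w, nat_of_ord i = m & crd w i != 0].
  apply: contrapT => h; apply: hne => w i hw hi; apply/eqP/negPn/negP => hc.
  by apply: h; exists w, i.
(* In units of [q] all values of the coordinate are integers at least [z]; [E] records their excess
   over [z], a natural number, so that a least one can be taken. *)
pose z := Num.floor (B / q).
pose E (t : nat) := `[< exists w, [/\ P w, crd w i0 != 0 & vr v (crd w i0) = (t%:~R + z%:~R) * q] >].
have hE w : P w -> crd w i0 != 0 -> exists2 t : nat, vr v (crd w i0) = (t%:~R + z%:~R) * q & E t.
  move=> hw c0; have [n hn _] := unif_decomp hv hD hp c0.
  have hB := vr_ge hv c0 (Pb w i0 hw).
  have zn : z <= n.
    rewrite /z -(ler_int R); apply: (le_trans (Num.Theory.floor_le _)).
    by rewrite ler_pdivrMr // -hn.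
  have nz : n%:~R * q = ((`|n - z|%N : int)%:~R + z%:~R) * q.
    by rewrite gez0_abs ?subr_ge0 // -intrD subrK.
  exists `|n - z|%N; first by rewrite hn nz.
  by apply/asboolP; exists w; rewrite hn nz.
have [t0 _ ht0] := hE w1 hw1 hc1.
have exE : exists t, E t by exists t0.
case: (ex_minnP exE) => t /asboolP[g [Pg cg0 vg]] tmin.
pose P' := [set w | P w /\ crd w i0 = 0].
have [||||w i [Pw cw] im|gs [hgs hspan]] := IH P'.
- by split=> //; exact: crd0.
- by move=> u1 u2 [h1 c1] [h2 c2]; split; [exact: PB|rewrite crdB c1 c2 subrr].
- by move=> y u hy [h1 c1]; split; [exact: Pint|rewrite crdM c1 mul0r].
- by move=> u i [h1 _]; exact: Pb.
- move: im; rewrite leq_eqVlt => /orP[/eqP h|]; last exact: Pc.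
  by rewrite (_ : i = i0) //; apply: val_inj; rewrite /= hi0 -h.
exists (g :: gs); split.
  case=> [[|i] hi]; first by [].
  by have [] := hgs (Ordinal (hi : (i < size gs)%N)).
move=> w Pw; pose y := (crd g i0)^-1 * crd w i0.
have ug := hD cg0.
have hy : vge v 0 y.
  have [h|h] := eqVneq (crd w i0) 0; first by rewrite /y h mulr0; exact: (vge0 hv).
  have [t' ht' /tmin tt'] := hE w Pw h.
  have g'0 := inv_neq0_div hD cg0.
  apply/(vgeE hv); first by rewrite (mul_neq0 hv).
  rewrite /y (vrM hv) // (vr_inv hv hD) // ht' vg -mulNr -mulrDl.
  apply: mulr_ge0; last exact: ltW.
  by rewrite opprD addrACA addNr addr0 addrC subr_ge0 ler_int.
have [|c hc hw] := hspan (w - ract y g).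
  split; first by apply: PB => //; exact: Pint.
  by rewrite crdB crdM /y mulrA mulrV // mul1r subrr.
exists (fun i : 'I_(size gs).+1 => if unlift ord0 i is Some j then c j else y).
  by move=> i; case: unliftP => [j _|_] //; exact: hc.
rewrite big_ord_recl unlift_none /= -(subrK (ract y g) w) hw addrC; congr (_ + _).
by apply: eq_bigr => i _; rewrite liftK.
Qed.

Variable L : R -> set V.
Hypothesis hL : right_norm L.
Hypothesis hbound : forall r, exists B, forall w i, L r w -> vge v B (crd w i).

Lemma right_norm_shift r y w : vge v r y -> forall s, L s w -> L (s + r) (ract y w).
Proof.
move=> hy s hw; have [->|y0] := eqVneq y 0; first by rewrite ract0; exact: fil_0 hL.1 _.
apply: (fil_le hL.1) (hL.2 y y0 s w hw).
by rewrite lerD2l; exact: (vr_ge hv).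
Qed.

Theorem right_norm_latf : is_lattice_function v q L.
Proof.
have [hf hs] := hL; split.
- move=> r; have [B hB] := hbound r.
  have Lint y w : vge v 0 y -> L r w -> L r (ract y w).
    by move=> hy hw; rewrite -[r]addr0; exact: right_norm_shift.
  have hdim w (i : 'I_(dim V)) : L r w -> (dim V <= i)%N -> crd w i = 0.
    by rewrite leqNgt ltn_ord.
  have [gs [hgs hspan]] := @fg_submodule (dim V) (L r) B (fil_0 hf r) (@fil_sub _ _ _ hf r)
    Lint (fun w i => @hB w i) hdim.
  exists (size gs), (fun i => gs`_i); split.
    apply/seteqP; split=> w /=; first exact: hspan.
    case=> c hc ->; apply: (fil_sum hf) => i _; apply: Lint => //; exact: hc.
  move=> w; have [s hw] := fil_exh hf w.
  have [m hm] := exists_nat_mul_ge (- s) r q0.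
  have up := unitrX m (hD p0).
  have : L r (ract (p ^+ m) w).
    apply: (fil_le hf) (right_norm_shift (r := m%:R * q) _ hw); first by lra.
    by rewrite -(vrX hv) //; exact: vge_vr.
  case/hspan => c _ hc; exists (fun i => c i * p ^- m).
  have -> : w = ract (p ^- m) (ract (p ^+ m) w) by rewrite -ractM mulrV // ract1.
  by rewrite hc ract_sum; apply: eq_bigr => i _; rewrite -ractM.
- by move=> r s rs w; apply: (fil_le hf); exact: ltW.
- move=> r; apply/seteqP; split=> w /= h.
    by move=> t tr; apply: (fil_le hf) h; exact: ltW.
  exact: (fil_left hf).
move=> r; apply/seteqP; split=> w /=.
  case=> n [g [c [hg hc ->]]]; apply: (fil_sum hf) => i _.
  by apply: (right_norm_shift _ (hg i)); apply/(vpos_unif hv hp); exact: hc.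
move=> hw; exists 1%N, (fun=> ract p^-1 w), (fun=> p); split.
- move=> _; have := hs _ (inv_neq0_div hD p0) _ _ hw.
  by rewrite (vr_inv hv hD p0) addrK.
- by move=> _; exact: unif_gt0 hp.
by rewrite big_ord1 -[_ *: _]/(ract p (ract p^-1 w)) -ractM mulVr ?ract1 ?hD.
Qed.

End ToLatticeFunction.
End LatticeFunctions.

(** * Hermitian forms *)

Lemma linfunE (D : nzRingType) (V W : vectType D^c) (f : V -> W) :
  (forall w1 w2, f (w1 + w2) = f w1 + f w2) ->
  (forall y w, f (ract y w) = ract y (f w)) -> linfun f =1 f.
Proof.
move=> fD fM; have fl : linear f by move=> a x y; rewrite fD; congr (_ + _); exact: fM.
pose g : {linear V -> W} := HB.pack f (GRing.isLinear.Build _ _ _ _ f fl).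
exact: (lfunE g).
Qed.

Lemma lfun_ract (D : nzRingType) (V W : vectType D^c) (f : 'Hom(V, W)) y w :
  f (ract y w) = ract y (f w).
Proof. exact: linearZ. Qed.

Lemma lfun_add (D : nzRingType) (V W : vectType D^c) (f : 'Hom(V, W)) w1 w2 :
  f (w1 + w2) = f w1 + f w2.
Proof. exact: linearD. Qed.

Lemma lfun_sub (D : nzRingType) (V W : vectType D^c) (f : 'Hom(V, W)) w1 w2 :
  f (w1 - w2) = f w1 - f w2.
Proof. exact: linearB. Qed.

Lemma lfun_sum (D : nzRingType) (V W : vectType D^c) (f : 'Hom(V, W))
    (I : Type) (s : seq I) (P : pred I) (F : I -> V) :
  f (\sum_(i <- s | P i) F i) = \sum_(i <- s | P i) f (F i).
Proof. exact: linear_sum. Qed.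

Section Hermitian.
Variables (D : nzRingType) (V : vectType D^c) (rho : D -> D) (eps : D) (h : V -> V -> D).
Hypothesis hh : is_signed_hermitian rho eps h.
Let hrho := Defs.sh_inv hh.

Lemma inv_at0 : rho 0 = 0.
Proof. by apply: (addIr (rho 0)); rewrite -(inv_add hrho) !add0r. Qed.

Lemma inv_atN x : rho (- x) = - rho x.
Proof. by apply: (addIr (rho x)); rewrite -(inv_add hrho) !addNr inv_at0. Qed.

Lemma eps_sq : eps * eps = 1.
Proof. by case: (sh_sign hh) => ->; rewrite ?mulrNN mulr1. Qed.

Lemma eps_comm x : eps * x = x * eps.
Proof. by case: (sh_sign hh) => ->; rewrite ?mulrN ?mulNr mulr1 mul1r. Qed.

Lemma rho_eps : rho eps = eps.
Proof. by case: (sh_sign hh) => ->; rewrite ?inv_atN (inv_one hrho). Qed.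

Lemma herm_sym x y : h x y = eps * rho (h y x).
Proof.
have := sh_herm hh x y 1 1; rewrite !scale1r (inv_one hrho) !mulr1; exact.
Qed.

Lemma herm_ractr x y d : h x (ract d y) = h x y * d.
Proof.
have := sh_herm hh x y 1 d; rewrite scale1r (inv_one hrho) mulr1 => ->.
by rewrite -herm_sym.
Qed.

Lemma herm_ractl x y d : h (ract d x) y = rho d * h x y.
Proof.
have := sh_herm hh x y d 1; rewrite scale1r mulr1 => ->.
by rewrite eps_comm -mulrA -herm_sym.
Qed.

Lemma herm0r x : h x 0 = 0.
Proof. by rewrite -(ract0 (0 : V)) herm_ractr mulr0. Qed.

Lemma herm0l x : h 0 x = 0.
Proof. by rewrite herm_sym herm0r inv_at0 mulr0. Qed.

Lemma hermNr x y : h x (- y) = - h x y.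
Proof. by apply: (addIr (h x y)); rewrite -(sh_addr hh) !addNr herm0r. Qed.

Lemma hermNl x y : h (- x) y = - h x y.
Proof. by apply: (addIr (h x y)); rewrite -(sh_addl hh) !addNr herm0l. Qed.

Lemma hermBr x y z : h x (y - z) = h x y - h x z.
Proof. by rewrite (sh_addr hh) hermNr. Qed.

Lemma herm_sumr x (I : Type) (s : seq I) (P : pred I) (F : I -> V) :
  h x (\sum_(i <- s | P i) F i) = \sum_(i <- s | P i) h x (F i).
Proof. exact: (big_morph (h x) (sh_addr hh x) (herm0r x)). Qed.

Lemma herm_suml x (I : Type) (s : seq I) (P : pred I) (F : I -> V) :
  h (\sum_(i <- s | P i) F i) x = \sum_(i <- s | P i) h (F i) x.
Proof. exact: (big_morph (h^~ x) (fun a b => sh_addl hh a b x) (herm0l x)). Qed.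

Lemma herm_eq0 x y : h x y = 0 -> h y x = 0.
Proof. by move=> e; rewrite herm_sym e inv_at0 mulr0. Qed.

Lemma herm_nondegr y : (forall x, h x y = 0) -> y = 0.
Proof. by move=> e; apply: (sh_nondeg hh) => w; apply: herm_eq0. Qed.

Definition rank1 (x y : V) : 'End(V) := linfun (fun w => ract (h y w) x).

Lemma rank1E x y w : rank1 x y w = ract (h y w) x.
Proof.
by apply: linfunE => [w1 w2|d w']; rewrite ?(sh_addr hh) ?ractDl // herm_ractr ractM.
Qed.

Lemma adjoint_sym (s : 'End(V) -> 'End(V)) (a : 'End(V)) x y :
  is_adjoint h s -> h (s a x) y = h x (a y).
Proof. by move=> hs; rewrite herm_sym -hs -herm_sym. Qed.

Lemma adjoint_unique (s : 'End(V) -> 'End(V)) (a b : 'End(V)) :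
  is_adjoint h s -> (forall x y, h (a x) y = h x (b y)) -> s a = b.
Proof.
move=> hs hab; apply/lfunP => y; apply/eqP; rewrite -subr_eq0; apply/eqP.
by apply: herm_nondegr => x; rewrite hermBr -hs hab subrr.
Qed.

Lemma adjointK (s : 'End(V) -> 'End(V)) a : is_adjoint h s -> s (s a) = a.
Proof. by move=> hs; apply: adjoint_unique => // x y; rewrite adjoint_sym. Qed.

Lemma adjointD (s : 'End(V) -> 'End(V)) a b : is_adjoint h s -> s (a + b) = s a + s b.
Proof.
by move=> hs; apply: adjoint_unique => // x y; rewrite !add_lfunE (sh_addl hh) (sh_addr hh) !hs.
Qed.

Lemma adjointN (s : 'End(V) -> 'End(V)) a : is_adjoint h s -> s (- a) = - s a.
Proof.
by move=> hs; apply: adjoint_unique => // x y; rewrite !opp_lfunE hermNl hermNr hs.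
Qed.

Lemma adjointM (s : 'End(V) -> 'End(V)) (a b : 'End(V)) :
  is_adjoint h s -> s (a \o b)%VF = (s b \o s a)%VF.
Proof. by move=> hs; apply: adjoint_unique => // x y; rewrite !comp_lfunE !hs. Qed.

Lemma adjoint_rank1 (s : 'End(V) -> 'End(V)) x y : is_adjoint h s ->
  s (rank1 x y) = rank1 (ract eps y) x.
Proof.
move=> hs; apply: adjoint_unique => // u w; rewrite !rank1E herm_ractl herm_ractr.
by rewrite herm_ractr (herm_sym u y) eps_comm -!mulrA [eps * (eps * _)]mulrA eps_sq mul1r.
Qed.

End Hermitian.

(** * Duality and rigidity of norms *)

Section DualLattice.
Variables (R : realType) (D : unitRingType) (v : D -> \bar R).
Hypotheses (hv : is_valuation v) (hD : forall x : D, x != 0 -> x \is a GRing.unit).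
Variable p : D.
Hypothesis hp : is_uniformizer v p.
Local Notation q := (vr v p).
Variables (V : vectType D^c) (rho : D -> D) (eps : D) (h : V -> V -> D).
Hypothesis hh : is_signed_hermitian rho eps h.
Hypothesis vrho : forall x, vr v (rho x) = vr v x.

Let q0 : 0 < q := unif_val_gt0 hv hp.
Let p0 := unif_neq0 hp.
Let hrho := Defs.sh_inv hh.

Lemma inv_at_neq0 x : x != 0 -> rho x != 0.
Proof. by apply: contra => /eqP e; rewrite -(inv_invol hrho x) e (inv_at0 hh). Qed.

Lemma eps_neq0 : eps != 0.
Proof. by case: (sh_sign hh) => ->; rewrite ?oppr_eq0 oner_neq0. Qed.

Lemma vr_eps : vr v eps = 0.
Proof. by case: (sh_sign hh) => ->; rewrite ?(vrN hv) (vr1 hv). Qed.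

Lemma vr_herm_sym x y : vr v (h x y) = vr v (h y x).
Proof.
have [e|e] := eqVneq (h y x) 0; first by rewrite e (herm_eq0 hh e).
by rewrite (herm_sym hh x y) (vrM hv) ?eps_neq0 ?inv_at_neq0 // vr_eps add0r vrho.
Qed.

Lemma vge_herm_sym r x y : vge v r (h x y) -> vge v r (h y x).
Proof.
have [e|e] := eqVneq (h y x) 0; first by rewrite e => _; exact: (vge0 hv).
move=> hr; apply/(vgeE hv _ e); rewrite -vr_herm_sym; apply: (vr_ge hv) => //.
by apply: contraNneq e => /(herm_eq0 hh) ->.
Qed.

Variable L : R -> set V.
Hypothesis hL : right_norm v L.
Local Notation dual := (dual_lattice_function v h L).

(** The definition with strict inequalities amounts to an inequality of norms: if it failed,
    rescaling [y] by a power of [p] would make [h x y] a unit while keeping [y] deep enough for the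
    definition of [dual] to apply. *)
Lemma dual_ge r s x y : dual r x -> L s y -> vge v (r + s) (h x y).
Proof.
move=> hx hy; have [e|e] := eqVneq (h x y) 0; first by rewrite e; exact: (vge0 hv).
have [n hn hu] := unif_decomp hv hD hp e.
apply/(vgeE hv _ e); rewrite leNgt; apply/negP => hlt.
have pn0 := exprz_neq0 hv hD (- n) p0.
have := hx (s - n%:~R * q) _ (ract (p ^ (- n)) y); rewrite (herm_ractr hh) => h1.
have : vpos v (h x y * p ^ (- n)).
  apply: h1; first by move: hlt; rewrite hn; rewrite /unif_val; lra.
  have := hL.2 _ pn0 _ _ hy.
  by rewrite (vrXz hv hD) // mulrNz mulNr.
move/(vposE hv (mul_neq0 hv e pn0)); rewrite (vrM hv) // (vrXz hv hD) // hn /unif_val mulrNz mulNr; lra.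
Qed.

Lemma dual_geP r x : dual r x <-> forall s y, L s y -> vge v (r + s) (h x y).
Proof.
split=> [hx s y|hx s rs y hy]; first exact: dual_ge.
by apply: (vpos_ge _ (hx s y hy)); lra.
Qed.

Hypothesis hself : dual = L.

Lemma self_dual_ge r s x y : L r x -> L s y -> vge v (r + s) (h x y).
Proof. by rewrite -{1}hself; exact: dual_ge. Qed.

Lemma self_dualP r x : L r x <-> forall s y, L s y -> vge v (r + s) (h x y).
Proof. by rewrite -{1}hself; exact: dual_geP. Qed.

(** A converse to [self_dual_ge]: when [t] exceeds the norm of [x] by a margin, [u] comes within
    that margin of equality. *)
Lemma near_norming t x : ~ L t x ->
  exists s u, [/\ - t < s, L s u, h x u != 0 & vr v (h x u) <= 0].
Proof.
rewrite -{1}hself => hx; apply: contrapT => hne; apply: hx => s ts u hu.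
have [->|e] := eqVneq (h x u) 0; first exact: (vpos0 hv).
apply/(vposE hv e); rewrite ltNge; apply/negP => hle.
by apply: hne; exists s, u.
Qed.

Lemma rank1_shifts r s x y : L r x -> L s y -> shifts L L (r + s) (rank1 h x y).
Proof.
move=> hx hy t w hw; rewrite (rank1E hh).
have -> : t + (r + s) = r + (s + t) by ring.
have hyw := self_dual_ge hy hw.
have [->|e] := eqVneq (h y w) 0; first by rewrite ract0; exact: fil_0 hL.1 _.
apply: (fil_le hL.1) (hL.2 _ e _ _ hx).
by rewrite lerD2l; exact: (vr_ge hv).
Qed.

(* If [b] does not shift [L] by [t], there are [w] and [u] for which the rank one operator
   [rank1 _ u \o b \o rank1 w _] can be completed to a nonzero idempotent that the
   filtration of [M] would have to shift by a positive amount. *)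
Theorem rank1_rigidity (M : zmodType) (F : R -> set M) (psi : 'End(V) -> M -> M) :
  filtration F -> (forall (a b : 'End(V)) w, psi (a \o b)%VF w = psi a (psi b w)) ->
  (forall a : 'End(V), (forall w, psi a w = 0) -> a = 0) ->
  (forall t (b : 'End(V)), shifts L L t b -> shifts F F t (psi b)) ->
  forall t (b : 'End(V)), shifts F F t (psi b) -> shifts L L t b.
Proof.
move=> hF psiM psi0 hpsi t b hb s w hw.
apply/self_dualP => s' u hu; apply: (vge_herm_sym).
have [e|e] := eqVneq (h u (b w)) 0; first by rewrite e; exact: (vge0 hv).
apply/(vgeE hv _ e); rewrite leNgt; apply/negP => hlt.
set z := h u (b w) in e hlt *.
have w0 : w != 0.
  by apply: contraNneq e => w0; rewrite /z w0 linear0 (herm0r hh).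
(* The amount by which [b] falls short of the shift [t], as tested on [w] and [u]. *)
pose d := s + t + s' - vr v z.
have d0 : 0 < d by rewrite /d; lra.
pose x := w; have [r hr] := fil_value hL.1 w0.
have [|s2 [y [hs2 hy e2 hle]]] := @near_norming (r + d) w; first by rewrite hr; lra.
have vz := vge_vr hv z.
(* With this scalar, [P] is the projector onto the line of [w] along the orthogonal complement of
   [y]. *)
pose c := (h y w)^-1 * z^-1.
have e2' : h y w != 0 by apply: contraNneq e2 => /(herm_eq0 hh) ->.
have hc0 : c != 0 by rewrite (mul_neq0 hv) // inv_neq0_div.
pose x1 := ract c w.
have hx1 : L (r - vr v z) x1.
  apply: (fil_le hL.1) (hL.2 c hc0 r w ((hr r).2 (lexx r))).
  rewrite /c (vrM hv) ?inv_neq0_div // !(vr_inv hv hD) // (vr_herm_sym y w); lra.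
pose P := (rank1 h x1 u \o (b \o rank1 h w y))%VF.
have PE a : P a = ract ((h y w)^-1 * h y a) w.
  rewrite /P !comp_lfunE !(rank1E hh) lfun_ract (herm_ractr hh) -/z /x1 -!ractM /c.
  by rewrite !mulrA mulrVK ?hD.
have PP a : P (P a) = P a.
  by rewrite [LHS]PE PE (herm_ractr hh) mulKr ?hD.
have hP : shifts F F ((s + s2) + t + (r - vr v z + s')) (psi P).
  move=> a m hm.
  rewrite /P !psiM.
  have h1 := hpsi _ _ (rank1_shifts hw hy) _ _ hm.
  have h2 := hb _ _ h1.
  have h3 := hpsi _ _ (rank1_shifts hx1 hu) _ _ h2.
  by apply: (fil_le hF) h3; lra.
(* The total equals [r + d + s2], and [near_norming] was applied with margin [d] precisely to have
   [s2] exceed [- (r + d)]. *)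
have pos : 0 < (s + s2) + t + (r - vr v z + s') by move: hs2 d0; rewrite /d; lra.
have P0 : P = 0.
  apply: psi0 => m; apply: contrapT => /eqP Pm0.
  have [l hl] := fil_value hF Pm0.
  have := hP l (psi P m) ((hl l).2 (lexx l)).
  have -> : psi P (psi P m) = psi P m.
    by rewrite -psiM; congr psi; apply/lfunP => a; rewrite comp_lfunE PP.
  by move/hl; lra.
have := PE w; rewrite P0 lfunE /= mulVr ?hD // ract1 => /esym/eqP.
by rewrite (negbTE w0).
Qed.

End DualLattice.

(** * Norms determined by centralizers *)

(** [phi] is the coordinate along the first vector of a spanning list of least length; if it were
    ambiguous, that vector could be dropped. *)
Lemma exists_functional (M : zmodType) (E : fieldType) (act : E -> M -> M)
    (es : seq M) (w0 : M) :
  is_prescaling act -> (forall w, act 1 w = w -> in_span act es w) ->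
  act 1 w0 = w0 -> w0 != 0 ->
  exists phi : M -> E, [/\ forall x y, phi (x + y) = phi x + phi y,
    forall y w, phi (act y w) = y * phi w & exists w, phi w != 0].
Proof.
move=> hpre hes hw0 w00.
pose spans n := `[< exists fs : seq M, size fs = n /\
  forall w, act 1 w = w -> in_span act fs w >].
have ex : exists n, spans n by exists (size es); apply/asboolP; exists es.
case: (ex_minnP ex) => n /asboolP[[|e fs] [hn hfs]] nmin.
  by have /eqP := hfs w0 hw0; rewrite (negbTE w00).
have proj w : act 1 (act 1 w) = act 1 w by rewrite -(sc_mul hpre) mulr1.
have /choice[phi hphi] : forall w, exists c, in_span act fs (act 1 w - act c e).
  by move=> w; have [c hc] := hfs _ (proj w); exists c.
have uniq w c d : in_span act fs (w - act c e) -> in_span act fs (w - act d e) -> c = d.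
  move=> hc hd; apply/eqP; rewrite -subr_eq0; apply/negPn/negP => cd.
  have he : in_span act fs (act 1 e).
    rewrite -(mulVf cd) (sc_mul hpre); apply: (in_spanZ hpre).
    have -> : act (c - d) e = (w - act d e) - (w - act c e).
      by rewrite (sc_addl hpre) (sc_oppl hpre) opprB [RHS]addrC addrA subrK.
    by apply: (in_spanD hpre) => //; exact: (in_spanN hpre).
  have hspan : spans (size fs).
    apply/asboolP; exists fs; split=> // w' hw'; have [a ha] := hfs _ hw'.
    rewrite -(subrK (act a e) w'); apply: (in_spanD hpre) => //.
    by rewrite -[a]mulr1 (sc_mul hpre); exact: (in_spanZ hpre).
  by have := nmin _ hspan; rewrite -hn /= ltnn.
exists phi; split.
- move=> x y; apply: (@uniq (act 1 (x + y))); first exact: hphi.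
  rewrite (sc_add hpre) (sc_addl hpre) opprD addrACA.
  by apply: (in_spanD hpre); exact: hphi.
- move=> y w; apply: (@uniq (act 1 (act y w))); first exact: hphi.
  rewrite -(sc_mul hpre) mulrC (sc_mul hpre y 1) (sc_mul hpre) -(sc_oppr hpre) -(sc_add hpre).
  exact/(in_spanZ hpre)/hphi.
exists e; rewrite (_ : phi e = 1) ?oner_neq0 //.
apply: (@uniq (act 1 e)); first exact: hphi.
by rewrite subrr; exact: (in_span0 hpre).
Qed.

(** * Averaging over a quaternion basis and translation of norms *)

Section Translation.
Variables (R : realType) (k : fieldType) (nu : k -> \bar R).
Hypothesis hk : is_odd_local_field nu.
Variables (D : unitRingType) (emb : {rmorphism k -> D}) (v : D -> \bar R).
Hypotheses (hv : is_valuation v) (he : forall c, v (emb c) = nu c).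
Hypothesis hembC : forall c x, emb c * x = x * emb c.
Hypothesis hD : forall x : D, x != 0 -> x \is a GRing.unit.
Variable V : vectType D^c.
Local Notation sc := (fun c (w : V) => ract (emb c) w).

Lemma ract_emb_scaling : is_scaling sc.
Proof.
split; last by move=> x; rewrite rmorph1 ract1.
split=> [c x y|a b x|a b x]; first exact: ractD.
  by rewrite rmorphD ractDl.
by rewrite rmorphM hembC ractM.
Qed.

Lemma right_norm_emb (L : R -> set V) : right_norm v L ->
  forall c, c != 0 -> shifts L L (vr nu c) (sc c).
Proof.
move=> hL c c0; rewrite -(vr_emb he); apply: hL.2; exact: (emb_neq0 emb).
Qed.

(** Linearity over [k] only: before averaging, the operators are not [D]-linear and do not live in
    ['End(V)]. *)
Definition emb_linear (T : V -> V) : Prop :=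
  (forall x y, T (x + y) = T x + T y) /\ (forall c w, T (ract (emb c) w) = ract (emb c) (T w)).

Lemma emb_linearN T w : emb_linear T -> T (- w) = - T w.
Proof.
by case=> hT hc; have := hc (-1) w; rewrite rmorphN1 !ractNl !ract1.
Qed.

Section Averaging.
Variables (g h : D) (c d : k).
Hypotheses (gg : g * g = emb c) (c0 : c != 0) (hg : h * h = emb d) (d0 : d != 0).
Hypothesis anti : h * g = - (g * h).
Let g0 : g != 0.
Proof. by apply: contraNneq c0 => e; rewrite -(fmorph_eq0 emb) -gg e mulr0. Qed.
Let h0 : h != 0.
Proof. by apply: contraNneq d0 => e; rewrite -(fmorph_eq0 emb) -hg e mulr0. Qed.

(** The conjugate of [T] by right multiplication by [g], whose inverse is right multiplication by
    [c^-1 g]. *)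
Definition conj_op (T : V -> V) w := ract (emb c^-1) (ract g (T (ract g w))).
Definition even_part (T : V -> V) w := ract (emb 2^-1) (T w + conj_op T w).
Definition odd_part (T : V -> V) w := ract (emb 2^-1) (T w - conj_op T w).
Definition twisted_part (T : V -> V) w := odd_part T (ract h w).

Lemma ract_embC a x (w : V) : ract (emb a) (ract x w) = ract x (ract (emb a) w).
Proof. by rewrite -!ractM hembC. Qed.

Lemma conj_op_linear T : emb_linear T -> emb_linear (conj_op T).
Proof.
case=> hT hc; split=> [x y|a w]; rewrite /conj_op; first by rewrite ractD hT !ractD.
by rewrite -ract_embC hc -(ract_embC a g) -(ract_embC _ (emb a)).
Qed.

Lemma even_part_linear T : emb_linear T -> emb_linear (even_part T).
Proof.
move=> hT; have [h1 h2] := conj_op_linear hT; case: hT => hT hc.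
split=> [x y|a w]; rewrite /even_part; first by rewrite hT h1 addrACA ractD.
by rewrite hc h2 -ractD ract_embC.
Qed.

Lemma odd_part_linear T : emb_linear T -> emb_linear (odd_part T).
Proof.
move=> hT; have [h1 h2] := conj_op_linear hT; case: hT => hT hc.
split=> [x y|a w]; rewrite /odd_part; first by rewrite hT h1 opprD addrACA ractD.
by rewrite hc h2 -ractN -ractD ract_embC.
Qed.

Lemma twisted_part_linear T : emb_linear T -> emb_linear (twisted_part T).
Proof.
move=> /odd_part_linear[h1 h2]; split=> [x y|a w]; rewrite /twisted_part.
  by rewrite ractD h1.
by rewrite -ract_embC h2.
Qed.

Lemma parts_sum T w : T w = even_part T w + odd_part T w.
Proof.
rewrite /even_part /odd_part -ractD addrACA subrr addr0 -[T w]ract1 -ractDl -ractM.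
have -> : (1 + 1) * emb 2^-1 = 1; last by [].
rewrite -[1 + 1]/(2%:R) -(rmorph_nat emb) -rmorphM mulfV ?rmorph1 //.
exact: (lf_2neq0 hk).
Qed.

Lemma emb_cK (w : V) : ract (emb c^-1) (ract (emb c) w) = w.
Proof. by rewrite -ractM -rmorphM mulfV // rmorph1 ract1. Qed.

Lemma conj_op_g T w : emb_linear T ->
  conj_op T (ract g w) = ract g (T w) /\ ract g (conj_op T w) = T (ract g w).
Proof.
move=> hT; rewrite /conj_op; split.
  by rewrite -(ractM g g w) gg hT.2 -ract_embC emb_cK.
by rewrite -ract_embC -(ractM g g) gg emb_cK.
Qed.

Lemma even_part_comm T w : emb_linear T -> even_part T (ract g w) = ract g (even_part T w).
Proof.
move=> hT; have [h1 h2] := conj_op_g w hT.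
by rewrite /even_part -ract_embC [ract g (_ + _)]ractD h1 h2 addrC.
Qed.

Lemma twisted_part_comm T w : emb_linear T ->
  twisted_part T (ract g w) = ract g (twisted_part T w).
Proof.
move=> hT; rewrite /twisted_part.
have -> : ract h (ract g w) = - ract g (ract h w).
  by rewrite -!ractM -ractNl anti opprK.
rewrite (emb_linearN _ (odd_part_linear hT)) /odd_part -(ract_embC _ g) -ractN opprB.
by have [-> h2] := conj_op_g (ract h w) hT; rewrite [ract g (_ - _)]ractD ractN h2.
Qed.

Lemma parts_comm T x : emb_linear T -> (forall w, T (ract x w) = ract x (T w)) ->
  g * x = - (x * g) -> h * x = x * h ->
  (forall w, even_part T (ract x w) = ract x (even_part T w)) /\
  (forall w, twisted_part T (ract x w) = ract x (twisted_part T w)).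
Proof.
move=> hT hx xg xh.
have hc w : conj_op T (ract x w) = ract x (conj_op T w).
  rewrite /conj_op.
  have -> : ract g (ract x w) = - ract x (ract g w) by rewrite -!ractM -ractNl xg opprK.
  rewrite (emb_linearN _ hT) hx -ract_embC; congr ract.
  by rewrite ractN -!ractM xg ractNl.
split=> w; first by rewrite /even_part hx hc -ractD ract_embC.
rewrite /twisted_part -ractM -xh ractM /odd_part hx hc -ract_embC.
by rewrite [ract x (_ - _)]ractD ractN.
Qed.

Lemma op_shifts_ge (L : R -> set V) (T : V -> V) (a b : D) t : right_norm v L ->
  a != 0 -> b != 0 -> shifts L L t T ->
  shifts L L (vr v a + (t + vr v b)) (fun w => ract b (T (ract a w))).
Proof.
move=> hL a0 b0 hT s w hw; rewrite !addrA.
exact: hL.2 _ b0 _ _ (hT _ _ (hL.2 _ a0 _ _ hw)).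
Qed.

Lemma parts_shifts (L : R -> set V) T t : right_norm v L -> shifts L L t T ->
  shifts L L t (even_part T) /\ shifts L L t (odd_part T).
Proof.
move=> hL hT.
have v2 : vr v (emb 2^-1) = 0.
  by rewrite (vr_emb he) (vrV (lf_val hk)) ?unitfE ?(lf_2neq0 hk) // (lf_vr2 hk) oppr0.
have e20 : emb 2^-1 != 0 by rewrite emb_neq0 // invr_eq0 (lf_2neq0 hk).
have ec0 : emb c^-1 != 0 by rewrite emb_neq0 // invr_eq0.
have vg : vr v g + vr v g = vr nu c by rewrite -(vrM hv) // gg (vr_emb he).
have half s w : L s w -> L s (ract (emb 2^-1) w).
  by move=> hw; have := hL.2 _ e20 _ _ hw; rewrite v2 addr0.
have hconj : shifts L L t (conj_op T).
  move=> s w hw; have h1 := op_shifts_ge hL g0 g0 hT hw.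
  have := hL.2 _ ec0 _ _ h1; rewrite (vr_emb he) (vrV (lf_val hk)) ?unitfE // -vg.
  by rewrite (_ : _ + _ - _ = s + t) //; ring.
split=> s w hw; apply: half.
  by apply: (fil_add hL.1); [exact: hT|exact: hconj].
by apply: (fil_sub hL.1); [exact: hT|exact: hconj].
Qed.

(* [even_part T] commutes with the right multiplication by [g], and so does
   [twisted_part T], because [h] anticommutes with [g]. *)
Lemma averaging_step (L L' : R -> set V) T t : right_norm v L -> right_norm v L' ->
  (forall s, shifts L L s (even_part T) -> shifts L' L' s (even_part T)) ->
  (forall s, shifts L L s (twisted_part T) -> shifts L' L' s (twisted_part T)) ->
  shifts L L t T -> shifts L' L' t T.
Proof.
move=> hL hL' he' ho hT; have [h1 h2] := parts_shifts hL hT.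
have uh := hD h0; have h'0 := inv_neq0_div hD h0.
have h3 : shifts L L (vr v h + t) (twisted_part T).
  by move=> s w hw; rewrite addrA; exact: h2 _ _ (hL.2 _ h0 _ _ hw).
move=> s w hw; rewrite parts_sum; apply: (fil_add hL'.1); first exact: he'.
have := ho _ h3 _ _ (hL'.2 _ h'0 _ _ hw).
rewrite /twisted_part -ractM mulVr // ract1 (vr_inv hv hD) //.
by rewrite (_ : _ + _ = s + t) //; ring.
Qed.

End Averaging.

Hypothesis hstruct : (forall x : D, exists c, x = emb c) \/
  exists i j : D, quaternion_pair emb i j.
Variable E : fieldType.
Variable iota : E -> 'End(V).
Hypothesis iotaD : forall x y, iota (x + y) = iota x + iota y.
Hypothesis iotaM : forall x y, iota (x * y) = (iota x \o iota y)%VF.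
Hypothesis iotak : forall c : k, exists y, forall w, ract (emb c) (iota 1 w) = iota y w.
Variable w_E : E -> R.
Hypothesis w_EV : forall y, y != 0 -> w_E y^-1 = - w_E y.
Variable es : seq V.
Hypothesis hes : forall w, in_span sc es w.

(** The [E]-linear operators of the image of [iota 1], extended by 0. They form a larger class than
    the operators of [centralizer_bounds], which are also [D]-linear. *)
Definition centralizing (T : V -> V) : Prop :=
  [/\ emb_linear T, forall w, iota 1 (T w) = T w & forall y w, T (iota y w) = iota y (T w)].

Definition centralizer_bounds (L L' : R -> set V) : Prop :=
  forall a : 'End(V), (iota 1 \o a)%VF = a ->
  (forall y, (iota y \o a)%VF = (a \o iota y)%VF) ->
  forall t, shifts L L t a -> shifts L' L' t a.

Lemma centralizing_parts g h c d T : g * g = emb c -> c != 0 -> h * h = emb d -> d != 0 ->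
  h * g = - (g * h) -> centralizing T ->
  centralizing (even_part g c T) /\ centralizing (twisted_part g h c T).
Proof.
move=> gg c0 hh d0 anti [hT h1 hE].
have hconj : (forall w, iota 1 (conj_op g c T w) = conj_op g c T w) /\
    forall y w, conj_op g c T (iota y w) = iota y (conj_op g c T w).
  split=> [w|y w]; rewrite /conj_op; first by rewrite !lfun_ract h1.
  by rewrite -[ract g (iota y w)]lfun_ract hE !lfun_ract.
split.
  split; first exact: even_part_linear.
    by move=> w; rewrite /even_part lfun_ract linearD /= h1 hconj.1.
  by move=> y w; rewrite /even_part hE hconj.2 [RHS]lfun_ract lfun_add.
split; first exact: twisted_part_linear.
  by move=> w; rewrite /twisted_part /odd_part lfun_ract linearB /= h1 hconj.1.
by move=> y w; rewrite /twisted_part -lfun_ract /odd_part hE hconj.2 [RHS]lfun_ract lfun_sub.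
Qed.

(** Averaging over [i] leaves operators that commute with [i]; averaging these over [j] keeps that
    property and adds commutation with [j], and the result is [D]-linear. *)
Lemma centralizing_bounds L L' T : right_norm v L -> right_norm v L' ->
  centralizer_bounds L L' -> centralizing T ->
  forall t, shifts L L t T -> shifts L' L' t T.
Proof.
move=> hL hL' hC.
have base S : centralizing S -> (forall y w, S (ract y w) = ract y (S w)) ->
    forall t, shifts L L t S -> shifts L' L' t S.
  move=> [[SD _] S1 SE] SM t hS.
  have SE' := linfunE SD SM.
  have : shifts L' L' t (linfun S).
    apply: hC; first by apply/lfunP => w; rewrite comp_lfunE SE' S1.
      by move=> y; apply/lfunP => w; rewrite !comp_lfunE !SE' SE.
    by move=> s w hw; rewrite SE'; exact: hS.
  by move=> h s w hw; have := h s w hw; rewrite SE'.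
case: hstruct => [hall|[i [j hij]]] hT.
  apply: base => // y w; have [c ->] := hall y; case: hT => -[_ h] _ _; exact: h.
have [ci ii] := qp_ii hij; have [cj jj] := qp_jj hij.
have i0 := qp_i0 hij; have j0 := qp_j0 hij; have ij := qp_ij hij.
have ji : j * i = - (i * j) by rewrite ij opprK.
have ci0 : ci != 0 by rewrite -(fmorph_eq0 emb) -ii (mul_neq0 hv).
have cj0 : cj != 0 by rewrite -(fmorph_eq0 emb) -jj (mul_neq0 hv).
have stepA S : centralizing S -> (forall w, S (ract i w) = ract i (S w)) ->
    forall t, shifts L L t S -> shifts L' L' t S.
  move=> hS Si t; have [S1 _ _] := hS.
  have [c1 c2] := centralizing_parts jj cj0 ii ci0 ij hS.
  have [Pi Qi] : (forall w, even_part j cj S (ract i w) = ract i (even_part j cj S w)) /\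
      (forall w, twisted_part j i cj S (ract i w) = ract i (twisted_part j i cj S w)).
    exact: parts_comm.
  have full U : centralizing U -> (forall w, U (ract i w) = ract i (U w)) ->
      (forall w, U (ract j w) = ract j (U w)) -> forall y w, U (ract y w) = ract y (U w).
    move=> [[UD Uc] _ _] Ui Uj y w; have [a [b [c [d ->]]]] := qp_span hij y.
    by rewrite !(ractDl, mulrDl, ractM) !(UD, Uj, Ui, Uc).
  apply: (averaging_step jj cj0 ii ci0) => // s.
    by apply: base => //; apply: full => // w; apply: even_part_comm.
  by apply: base => //; apply: full => // w; apply: twisted_part_comm.
move=> t; have [T1 _ _] := hT.
have [c1 c2] := centralizing_parts ii ci0 jj cj0 ji hT.
apply: (averaging_step ii ci0 jj cj0) => // s.
  by apply: stepA => // w; apply: even_part_comm.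
by apply: stepA => // w; apply: twisted_part_comm.
Qed.

(** The norm of the rank one operator [T f], that is [w |-> phi(w) f], is the norm of [f] plus the
    dual norm of [phi]. Since [L] and [L'] agree on all of these operators, the norms of [f] differ
    by the difference of the two dual norms, whatever [f] is. *)
Theorem norm_translation (L L' : R -> set V) :
  right_norm v L -> right_norm v L' ->
  (forall y, y != 0 -> shifts L L (w_E y) (iota y)) ->
  (forall y, y != 0 -> shifts L' L' (w_E y) (iota y)) ->
  centralizer_bounds L L' -> centralizer_bounds L' L ->
  exists c, forall r w, iota 1 w = w -> (L' r w <-> L (r + c) w).
Proof.
move=> hL hL' hE hE' hC hC'.
have [hall|] := pselect (forall w, iota 1 w = w -> w = 0).
  move=> *; exists 0 => r w /hall ->.
  by split=> _; [exact: fil_0 hL.1 _|exact: fil_0 hL'.1 _].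
move=> /existsNP[w0 /not_implyP[hw0 /eqP w00]].
have iota11 w : iota 1 (iota 1 w) = iota 1 w by rewrite -comp_lfunE -iotaM mulr1.
have iotaMw y z w : iota (y * z) w = iota y (iota z w) by rewrite iotaM comp_lfunE.
pose act y w := iota y w.
have hpre : is_prescaling act.
  by split=> [y a b|a b w|a b w]; rewrite /act ?linearD ?iotaD ?add_lfunE ?iotaMw.
have hspan w : act 1 w = w -> in_span act es w.
  move=> hw; have hl : forall fs u, in_span sc fs u -> in_span act fs (iota 1 u).
    elim=> [u ->|f fs IH u [c /IH h]] /=; first by rewrite linear0.
    have [y hy] := iotak c; exists y; rewrite /act -hy -lfun_ract -linearB; exact: h.
  by rewrite -hw; exact: hl (hes w).
have [phi [phiD phiM [w1 hw1]]] := exists_functional hpre hspan hw0 w00.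
have phi1 w : phi (iota 1 w) = phi w by rewrite (phiM 1) mul1r.
have phic c : exists y, forall w, phi (ract (emb c) w) = y * phi w /\
    forall u, iota 1 u = u -> ract (emb c) u = iota y u.
  have [y hy] := iotak c; exists y => w; split.
    by rewrite -phi1 lfun_ract hy phiM.
  by move=> u hu; rewrite -{1}hu hy.
pose T f w := iota (phi w) f.
have hT f : iota 1 f = f -> centralizing (T f).
  move=> hf; split.
  - split=> [x y|c w]; rewrite /T; first by rewrite phiD iotaD add_lfunE.
    have [y /(_ w)[-> h]] := phic c; rewrite iotaMw h //.
    by rewrite -iotaMw mul1r.
  - by move=> w; rewrite /T -iotaMw mul1r.
  by move=> y w; rewrite /T (phiM y) iotaMw.
(* [B M tau] says that the dual norm of [phi] is at least [tau]; the supremum [p] of such [tau],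
   obtained in [hsup], is that dual norm. *)
pose B M tau := forall s w, M s w -> phi w != 0 -> s + tau <= w_E (phi w).
have hTB (M : R -> set V) f n t : right_norm v M ->
    (forall y, y != 0 -> shifts M M (w_E y) (iota y)) -> iota 1 f = f ->
    (forall s, M s f <-> s <= n) -> shifts M M t (T f) <-> B M (t - n).
  move=> hM hME hf hn; have key y s : y != 0 -> M s (iota y f) <-> s <= n + w_E y.
    move=> y0; split=> [h|h].
      have y'0 : y^-1 != 0 by rewrite invr_eq0.
      have := hME _ y'0 _ _ h; rewrite -iotaMw mulVf // hf w_EV // => /hn; lra.
    by apply: (fil_le hM.1 h); apply: hME => //; apply/hn.
  split=> [h s w hw p0|h s w hw].
    by have /(key _ _ p0) := h s w hw; lra.
  rewrite /T; have [->|p0] := eqVneq (phi w) 0.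
    have -> : iota 0 f = 0.
      by apply: (addIr (iota 0 f)); rewrite -add_lfunE -iotaD !add0r.
    exact: fil_0 hM.1 _.
  by apply/(key _ _ p0); have := h s w hw p0; lra.
have [n0 hn0] := fil_value hL.1 w00; have [n0' hn0'] := fil_value hL'.1 w00.
have hsup (M : R -> set V) : right_norm v M ->
    (forall y, y != 0 -> shifts M M (w_E y) (iota y)) -> exists p, forall tau, B M tau <-> tau <= p.
  move=> hM hME; have [n hn] := fil_value hM.1 w00.
  have [[TD Tc] _ _] := hT _ hw0.
  have [t ht] := bounded_operator hk ract_emb_scaling ract_emb_scaling hM.1 hM.1
    (right_norm_emb hM) (right_norm_emb hM) hes TD Tc.
  have Bt : B M (t - n) by apply/(hTB _ _ _ _ hM hME hw0 hn).
  have [s1 hs1] := fil_exh hM.1 w1.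
  have hsup : has_sup [set tau | B M tau].
    split; first by exists (t - n).
    by exists (w_E (phi w1) - s1) => tau /(_ _ _ hs1 hw1); lra.
  exists (sup [set tau | B M tau]) => tau; split=> [h|h]; first exact: sup_upper_bound.
  move=> s w hw p0; rewrite leNgt; apply/negP => hlt.
  have d0 : 0 < sup [set tau | B M tau] - (w_E (phi w) - s) by lra.
  have [e hB] := sup_adherent d0 hsup; rewrite subKr.
  have := hB s w hw p0; lra.
have [p hp] := hsup L hL hE; have [p' hp'] := hsup L' hL' hE'.
exists (p' - p) => r f hf.
have [->|f0] := eqVneq f 0.
  by split=> _; [exact: fil_0 hL.1 _|exact: fil_0 hL'.1 _].
have [n hn] := fil_value hL.1 f0; have [n' hn'] := fil_value hL'.1 f0.
have same t : t <= p + n <-> t <= p' + n'.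
  have e1 : t <= p + n <-> shifts L L t (T f).
    by rewrite (hTB _ _ _ _ hL hE hf hn) hp; split; lra.
  have e2 : t <= p' + n' <-> shifts L' L' t (T f).
    by rewrite (hTB _ _ _ _ hL' hE' hf hn') hp'; split; lra.
  rewrite e1 e2; split; apply: centralizing_bounds => //; exact: hT.
have h1 := (same (p + n)).1 (lexx _); have h2 := (same (p' + n')).2 (lexx _).
by rewrite hn hn'; split; lra.
Qed.

End Translation.

Lemma in_span_trans (k : fieldType) (M : zmodType) (sc : k -> M -> M) (es fs : seq M) w :
  is_prescaling sc -> (forall f, f \in fs -> in_span sc es f) -> in_span sc fs w ->
  in_span sc es w.
Proof.
move=> hsc; elim: fs w => [w _ ->|f fs IH w hf /= [c hc]]; first exact: (in_span0 hsc).
rewrite -(subrK (sc c f) w); apply: (in_spanD hsc).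
  by apply: IH => // g gs; apply: hf; rewrite inE gs orbT.
by apply: (in_spanZ hsc); apply: hf; rewrite inE eqxx.
Qed.

Lemma in_span_map (k : fieldType) (M N : zmodType) (scM : k -> M -> M) (scN : k -> N -> N)
    (g : M -> N) (es : seq M) w :
  (forall c x e, g (x - scM c e) = g x - scN c (g e)) -> g 0 = 0 ->
  in_span scM es w -> in_span scN (map g es) (g w).
Proof.
move=> hg g0; elim: es w => [w ->|e es IH w [c /IH h]] //=.
by exists c; rewrite -hg.
Qed.

Lemma homothetyE (D : nzRingType) (V : vectType D^c) (z : D) w :
  (forall x, z * x = x * z) -> homothety V z w = ract z w.
Proof.
move=> hz; apply: linfunE => [x y|y x]; first exact: ractD.
by rewrite -[LHS]/(ract z (ract y x)) -[in RHS]/(ract z x) -!ractM hz.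
Qed.

(** * Right spaces and their endomorphisms as normed spaces over [k] *)

Section SpaceOverLocalField.
Variables (R : realType) (k : fieldType) (nu : k -> \bar R).
Hypothesis hk : is_odd_local_field nu.
Variables (D : unitRingType) (emb : {rmorphism k -> D}) (ds : seq D) (v : D -> \bar R).
Hypothesis hds : forall x, in_span (fun c x => emb c * x) ds x.
Hypotheses (hv : is_valuation v) (he : forall c, v (emb c) = nu c).
Hypothesis hembC : forall c x, emb c * x = x * emb c.
Variable V : vectType D^c.
Local Notation sc := (fun c (w : V) => ract (emb c) w).
Let hsc : is_scaling sc := ract_emb_scaling hembC V.

Lemma space_span : exists es : seq V, forall w, in_span sc es w.
Proof.
pose es := [seq ract d (crd_basis i) | i <- enum 'I_(dim V), d <- ds].
exists es => w; rewrite (crd_expand w); apply: (in_span_sum hsc) => i _.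
apply: (@in_span_trans _ _ _ es [seq ract d (crd_basis i) | d <- ds] _ (sc_pre hsc)).
  move=> _ /mapP[d dd ->]; apply: (in_span_mem hsc).
  by apply/allpairsP; exists (i, d); rewrite mem_enum.
apply: (in_span_map (g := fun d => ract d (crd_basis i)) _ _ (hds (crd w i))).
  by move=> c x e; rewrite ractBl hembC ractM.
exact: ract0.
Qed.

(** The reference norm with which arbitrary norms on [V] are compared. *)
Definition crd_norm (r : R) : set V := [set w | forall i, vge v r (crd w i)].

Lemma crd_norm_right_norm : right_norm v crd_norm.
Proof.
split; last first.
  by move=> y y0 s w hw i; rewrite crdM; apply: (vgeM hv) => //; exact: vge_vr.
split=> /=.
- by move=> r i; rewrite crd0; exact: (vge0 hv).
- by move=> r x y hx hy i; rewrite crdB; apply: (vgeB hv).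
- by move=> r s x sr hx i; exact: vge_le (hx i).
- move=> r x hx i; apply: (fil_left (vge_filtration hv)) => s sr; exact: hx.
- move=> x; exists (- \sum_i `|vr v (crd x i)|) => i.
  apply: (vge_le _ (vge_vr hv _)); rewrite (bigD1 i) //=.
  have := ler_norm (- vr v (crd x i)); rewrite normrN.
  have : 0 <= \sum_(l | l != i) `|vr v (crd x l)| by apply: sumr_ge0.
  lra.
by move=> x hx; apply: crd_inj => i; apply: (vge_eq0 hv) => r; exact: hx.
Qed.

Lemma right_norm_op_bounded (L L' : R -> set V) (T : V -> V) :
  right_norm v L -> right_norm v L' -> emb_linear emb T -> exists t, shifts L L' t T.
Proof.
move=> hL hL' [TD Tc]; have [es hes] := space_span.
exact: (bounded_operator hk hsc hsc hL.1 hL'.1 (right_norm_emb he hL) (right_norm_emb he hL')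
  hes TD Tc).
Qed.

Lemma right_norm_crd_bound (L : R -> set V) : right_norm v L ->
  forall r, exists B, forall w i, L r w -> vge v B (crd w i).
Proof.
move=> hL r; have [t ht] := @right_norm_op_bounded L crd_norm id hL crd_norm_right_norm
  (conj (fun _ _ => erefl) (fun _ _ => erefl)).
by exists (r + t) => w i hw; exact: ht.
Qed.

Lemma lfun_emb_linear (a : 'End(V)) : emb_linear emb a.
Proof. by split=> [x y|c w]; [exact: lfun_add|exact: lfun_ract]. Qed.

Definition end_scale (c : k) (a : 'End(V)) : 'End(V) := (homothety V (emb c) \o a)%VF.

Lemma end_scaleE c a w : end_scale c a w = ract (emb c) (a w).
Proof. by rewrite comp_lfunE homothetyE. Qed.

Lemma end_scaling : is_scaling end_scale.
Proof.
split; last by move=> a; apply/lfunP => w; rewrite end_scaleE rmorph1 ract1.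
split=> [c a b|c d a|c d a]; apply/lfunP => w; rewrite ?add_lfunE !end_scaleE.
- by rewrite add_lfunE ractD.
- by rewrite rmorphD ractDl.
by rewrite rmorphM hembC ractM.
Qed.

Lemma end_filtration (L : R -> set V) : right_norm v L ->
  filtration (fun t => [set a : 'End(V) | shifts L L t a]).
Proof.
move=> hL; have hf := hL.1; split=> /=.
- by move=> r s w _; rewrite lfunE; exact: (fil_0 hf).
- move=> r a b ha hb s w hw; rewrite add_lfunE opp_lfunE; apply: (fil_sub hf); [exact: ha|exact: hb].
- by move=> r s a sr; exact: shifts_le.
- move=> r a ha s w hw; apply: (fil_left hf) => t ts.
  have -> : t = s + (t - s) by rewrite addrC subrK.
  by apply: ha => //; lra.
- by move=> a; exact: (right_norm_op_bounded hL hL (lfun_emb_linear a)).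
move=> a ha; apply/lfunP => w; rewrite lfunE /=; apply: (fil_sep hf) => r.
have [s hs] := fil_exh hf w; rewrite -(subrK s r) addrC; exact: ha hs.
Qed.

Lemma end_scale_shifts (L : R -> set V) : right_norm v L -> forall c, c != 0 ->
  shifts (fun t => [set a : 'End(V) | shifts L L t a])
    (fun t => [set a : 'End(V) | shifts L L t a]) (vr nu c) (end_scale c).
Proof.
move=> hL c c0 s a ha r w hw; rewrite end_scaleE.
have h := hL.2 _ (emb_neq0 emb c0) _ _ (ha _ _ hw).
by rewrite (vr_emb he) -addrA in h.
Qed.

Definition elem_op (i j : 'I_(dim V)) (y : D) : 'End(V) :=
  linfun (fun w => ract (y * crd w i) (crd_basis j)).

Lemma elem_opE i j y w : elem_op i j y w = ract (y * crd w i) (crd_basis j).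
Proof.
apply: linfunE => [w1 w2|z u]; first by rewrite crdD mulrDr ractDl.
by rewrite crdM mulrA ractM.
Qed.

Lemma end_span : exists es : seq 'End(V), forall a, in_span end_scale es a.
Proof.
pose es := [seq elem_op ij.1 ij.2 d | ij <- enum {: 'I_(dim V) * 'I_(dim V)}, d <- ds].
exists es => a.
have -> : a = \sum_i \sum_j elem_op i j (crd (a (crd_basis i)) j).
  apply/lfunP => w; rewrite {1}(crd_expand w) lfun_sum sum_lfunE; apply: eq_bigr => i _.
  rewrite lfun_ract sum_lfunE {1}(crd_expand (a (crd_basis i))) ract_sum.
  by apply: eq_bigr => j _; rewrite elem_opE -ractM.
have hpre := sc_pre end_scaling.
apply: (in_span_sum hpre) => i _; apply: (in_span_sum hpre) => j _.
apply: (@in_span_trans _ _ _ es [seq elem_op i j d | d <- ds] _ hpre).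
  move=> _ /mapP[d dd ->]; apply: (in_span_mem end_scaling).
  by apply/allpairsP; exists ((i, j), d); rewrite mem_enum.
apply: (in_span_map (g := elem_op i j) _ _ (hds _)) => [c x e|].
  apply/lfunP => w; rewrite add_lfunE opp_lfunE end_scaleE !elem_opE mulrBl ractBl.
  by rewrite -mulrA hembC [ract (_ * emb c) _]ractM.
by apply/lfunP => w; rewrite elem_opE mul0r ract0 lfunE.
Qed.

End SpaceOverLocalField.

(** * The components of the centralizer *)

Section HermitianSpace.
Variables (R : realType) (X : hermitian_space R).
Local Notation k := (hs_k X).
Local Notation nu := (@hs_nu R X).
Local Notation D := (hs_D X).
Local Notation v := (@hs_val R X).
Local Notation V := (hs_V X).
Local Notation rho := (@hs_rho R X).
Local Notation emb := (in_alg D : {rmorphism k -> D}).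
Let hk : is_odd_local_field nu := hs_local X.
Let hv : is_valuation v := hs_valP X.
Let he : forall c, v (emb c) = nu c := @hs_val_ext R X.
Let hh := hs_herm X.

Lemma hs_unit (x : D) : x != 0 -> x \is a GRing.unit.
Proof. exact: cd_division (hs_division X) x. Qed.

Lemma falg_span (K : fieldType) (A : falgType K) (x : A) :
  in_span (fun (c : K) (x : A) => (in_alg A : {rmorphism K -> A}) c * x) (vbasis {:A}) x.
Proof.
have -> : (fun (c : K) (x : A) => (in_alg A : {rmorphism K -> A}) c * x) = (fun c x => c *: x).
  by apply/funext => c; apply/funext => y; rewrite /= mulr_algl.
exact: vect_span.
Qed.

Lemma hs_embE c (x : D) : emb c * x = c *: x.
Proof. exact: mulr_algl. Qed.

Lemma hs_embC c (x : D) : emb c * x = x * emb c.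
Proof. by rewrite /= mulr_algl mulr_algr. Qed.

Lemma hs_tau : exists2 tau : k -> k, is_ring_involution tau &
  forall c, rho (emb c) = emb (tau c).
Proof.
have hrho := Defs.sh_inv hh.
have /choice[tau htau] : forall c, exists d, rho (emb c) = emb d.
  move=> c; have [x|d ->] := cd_central (hs_division X) (z := rho (emb c)).
    have := congr1 rho (hs_embC c (rho x)).
    by rewrite !(inv_mul hrho) (inv_invol hrho) => ->.
  by exists d.
have inj : injective emb := fmorph_inj emb.
exists tau => //; split=> [x y||x y|x]; apply: inj.
- by rewrite -htau !rmorphD (inv_add hrho) !htau.
- by rewrite -htau !rmorph1 (inv_one hrho).
- by rewrite -htau !rmorphM (inv_mul hrho) !htau.
by rewrite -!htau (inv_invol hrho).
Qed.

Lemma hs_vrho (x : D) : vr v (rho x) = vr v x.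
Proof.
have [tau htau hc] := hs_tau.
exact: (vr_involution hk (@falg_span _ D) hv he (Defs.sh_inv hh) htau hc).
Qed.

(** Matches the period [1 / d] of lattice functions with the value of a uniformizer: a quaternion
    pair gives dimension at most 4, and dimension 1 is excluded because [i] and [j] do not
    commute. *)
Lemma hs_structure : exists p : D, [/\ is_uniformizer v p,
  vr v p = (hs_index X)%:R^-1 &
  (forall x : D, exists c, x = emb c) \/ exists i j : D, quaternion_pair emb i j].
Proof.
have hcent (x : D) : (forall y, x * y = y * x) -> exists c, x = emb c.
  by move=> hx; have [c ->] := cd_central (hs_division X) hx; exists c.
have [p hp hst] := tame_structure hk hs_unit (@falg_span _ D) hv he hs_embC hcent
  (Defs.sh_inv hh) hs_vrho.
exists p; split=> //; last by case: hst => -[hst _]; [left|right].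
have hdim := hs_indexP X.
have d0 : (0 < hs_index X)%N.
  rewrite lt0n; apply/eqP => e; move: hdim; rewrite e => /eqP.
  rewrite dimv_eq0 => /eqP full0; have := memvf (1 : D).
  by rewrite full0 memv0 oner_eq0.
case: hst => -[hst ->].
  have : (\dim {:D} <= 1)%N.
    apply: leq_trans (_ : \dim <[1 : D]> <= 1)%N; last by rewrite dim_vline; case: (_ != 0).
    by apply/dimvS/subvP => x _; have [c ->] := hst x; rewrite /= memvZ // memv_line.
  rewrite hdim => h1; have -> : hs_index X = 1%N by nia.
  by rewrite invr1.
have [i [j hij]] := hst.
have hle : (\dim {:D} <= 4)%N.
  pose s := [:: 1; i; j; i * j].
  apply: leq_trans (dim_span s).
  apply/dimvS/subvP => x _; have [a [b [c [d ->]]]] := qp_span hij x.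
  have hs y : y \in s -> y \in <<s>>%VS by exact: memv_span.
  rewrite mulrDl !hs_embE -scalerAl.
  have emb1 e : emb e = e *: 1 by [].
  by rewrite !emb1; do !apply: rpredD; apply: memvZ; apply: hs; rewrite !inE eqxx ?orbT.
have hne1 : hs_index X <> 1%N.
  move=> e; have h1 : (<[1 : D]> == {:D})%VS.
    by rewrite eqEdim subvf hdim e dim_vline oner_neq0.
  have scal y : exists c : k, y = emb c.
    by have := memvf y; rewrite -(eqP h1) => /vlineP[c ->]; exists c.
  have [c ec] := scal i.
  have := qp_ij hij; rewrite {1}ec hs_embC -ec => /eqP; rewrite -addr_eq0 -mulr2n.
  have ji0 : j * i != 0 by rewrite (mul_neq0 hv) ?(qp_i0 hij) ?(qp_j0 hij).
  by rewrite -mulr_natl; apply/negP; rewrite (mul_neq0 hv) // (two_neq0 hk emb).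
move: hle; rewrite hdim => h4; have -> : hs_index X = 2%N by nia.
by rewrite mul1r.
Qed.

Lemma hs_latf_right_norm (L : R -> set V) :
  is_lattice_function v (hs_index X)%:R^-1 L -> right_norm v L.
Proof.
have [p [hp <- _]] := hs_structure.
exact: (latf_right_norm hv hs_unit hp).
Qed.

Lemma hs_right_norm_latf (L : R -> set V) : right_norm v L ->
  is_lattice_function v (hs_index X)%:R^-1 L.
Proof.
have [p [hp <- _]] := hs_structure => hL.
exact: (right_norm_latf hv hs_unit hp hL
  (right_norm_crd_bound hk (@falg_span _ D) hv he hs_embC hL)).
Qed.

End HermitianSpace.

Section Component.
Variables (R : realType) (X : hermitian_space R) (beta : 'End(hs_V X)).
Variables (Y : centralizer_datum beta) (i : cz_I Y).
Local Notation k := (hs_k X).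
Local Notation nu := (@hs_nu R X).
Local Notation D := (hs_D X).
Local Notation v := (@hs_val R X).
Local Notation V := (hs_V X).
Local Notation sigma := (@hs_sigma R X).
Local Notation h := (@hs_h R X).
Local Notation emb := (in_alg D : {rmorphism k -> D}).
Local Notation E := (cz_E i).
Local Notation iota := (@cz_iota R X beta Y i).
Local Notation D' := (cz_D i).
Local Notation v' := (@cz_val R X beta Y i).
Local Notation V' := (cz_V i).
Local Notation psi := (@cz_psi R X beta Y i).
Local Notation emb' := (in_alg D' \o in_alg E : {rmorphism k -> D'}).
Let hk : is_odd_local_field nu := hs_local X.
Let hv' : is_valuation v' := @cz_valP R X beta Y i.

Lemma cz_unit (x : D') : x != 0 -> x \is a GRing.unit.
Proof. exact: cd_division (cz_division i) x. Qed.

Lemma cz_emb_val c : v' (emb' c) = nu c.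
Proof. exact: cz_val_ext. Qed.

Lemma cz_EC (y : E) (x : D') : y%:A * x = x * y%:A.
Proof. by rewrite mulr_algl mulr_algr. Qed.

Lemma cz_embC c (x : D') : emb' c * x = x * emb' c.
Proof. exact: cz_EC. Qed.

Lemma cz_span : exists ds : seq D', forall x, in_span (fun c x => emb' c * x) ds x.
Proof.
have hsc := emb_is_scaling emb'; have hpre := sc_pre hsc.
pose ds := [seq (e : E)%:A * d | e <- vbasis {:E}, d <- vbasis {:D'}] : seq D'.
exists ds => x; rewrite (coord_vbasis (memvf x)); apply: (in_span_sum hpre) => l _.
set d := _`_l; set y := coord _ _ _.
have dd : d \in (vbasis {:D'} : seq _) by rewrite mem_nth // size_tuple.
rewrite (coord_vbasis (memvf y)) scaler_suml; apply: (in_span_sum hpre) => m _.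
have -> : (coord (vbasis {:E}) m y *: (vbasis {:E})`_m) *: d =
    emb' (coord (vbasis {:E}) m y) * (((vbasis {:E})`_m)%:A * d).
  by rewrite /= !mulr_algl scalerA mulr_algl.
apply: (in_spanZ hpre); apply: (in_span_mem hsc); apply/allpairsP.
by exists ((vbasis {:E})`_m, d); rewrite mem_nth ?size_tuple.
Qed.

Lemma cz_homothetyE (y : E) w : homothety V' (y%:A : D') w = ract (y%:A : D') w.
Proof. by apply: homothetyE => x; exact: cz_EC. Qed.

Lemma cz_psi0 : psi 0 = 0.
Proof. by apply: (addIr (psi 0)); rewrite -cz_psiD !add0r. Qed.

Lemma cz_psiN a : psi (- a) = - psi a.
Proof. by apply: (addIr (psi a)); rewrite -cz_psiD !addNr cz_psi0. Qed.

Lemma cz_iota0 : iota 0 = 0.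
Proof. by apply: (addIr (iota 0)); rewrite -cz_iotaD !add0r. Qed.

Lemma cz_homothety1 : homothety V' ((1 : E)%:A : D') = \1%VF.
Proof. by apply/lfunP => w; rewrite cz_homothetyE lfunE /= scale1r ract1. Qed.

Lemma cz_psi1 : psi \1%VF = iota 1.
Proof. by rewrite -cz_psiE cz_homothety1. Qed.

Lemma cz_pr_psi a : (iota 1 \o psi a)%VF = psi a.
Proof. by rewrite -cz_psi1 -cz_psiM comp_lfun1l. Qed.

Lemma cz_psi_pr a : (psi a \o iota 1)%VF = psi a.
Proof. by rewrite -cz_psi1 -cz_psiM comp_lfun1r. Qed.

Lemma cz_psi_eq0 a : (forall w, psi a w = 0) -> a = 0.
Proof.
move=> ha; apply: (@cz_psi_inj R X beta Y i); rewrite cz_psi0.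
by apply/lfunP => w; rewrite ha lfunE.
Qed.

Lemma cz_iotaMw y z w : iota (y * z) w = iota y (iota z w).
Proof. by rewrite cz_iotaM comp_lfunE. Qed.

Lemma cz_iota11 w : iota 1 (iota 1 w) = iota 1 w.
Proof. by rewrite -cz_iotaMw mulr1. Qed.

Lemma cz_iotak c w : iota (c%:A) w = ract (emb c) (iota 1 w).
Proof. exact: cz_iotaZ. Qed.

Lemma cz_psi_scale c a w : psi (end_scale emb' c a) w = ract (emb c) (psi a w).
Proof.
rewrite /end_scale cz_psiM comp_lfunE (cz_psiE (c%:A : E)) cz_iotak.
by rewrite -comp_lfunE cz_pr_psi.
Qed.

Lemma cz_latf_right_norm (L : R -> set V') :
  is_lattice_function v' (fine (v' (cz_pi i))) L -> right_norm v' L.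
Proof. exact: (latf_right_norm hv' cz_unit (cz_piP i)). Qed.

Lemma cz_homothety_shifts (L : R -> set V') (y : E) : right_norm v' L -> y != 0 ->
  shifts L L (vr v' (y%:A : D')) (homothety V' (y%:A : D')).
Proof.
move=> hL y0 s w hw; rewrite cz_homothetyE; apply: hL.2 => //.
by rewrite scaler_eq0 negb_or y0 oner_neq0.
Qed.

Lemma cz_E_inv (y : E) : y != 0 -> vr v' (y^-1%:A : D') = - vr v' (y%:A : D').
Proof.
move=> y0; have ya : (y%:A : D') != 0 by rewrite scaler_eq0 negb_or y0 oner_neq0.
have y'a : (y^-1%:A : D') != 0 by rewrite scaler_eq0 negb_or invr_eq0 y0 oner_neq0.
have : vr v' ((y%:A : D') * y^-1%:A) = 0.
  by rewrite mulr_algl scalerA mulfV // scale1r (vr1 hv').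
rewrite (vrM hv') //; lra.
Qed.

(* The lattice function of [V'] bounds its image under [psi] with respect to any
   norm on [V]: this is what makes the infimum defining a CLF norm finite. *)
Lemma cz_psi_bounded (L' : R -> set V') (L : R -> set V) : right_norm v' L' ->
  right_norm v L -> exists B, forall t (b : 'End(V')), shifts L' L' t b -> shifts L L (t - B) (psi b).
Proof.
move=> hL' hL; have [ds hds] := cz_span.
have [es hes] := end_span hds cz_embC V'.
have hg c (a : 'End(V')) : psi (end_scale emb' c a) = end_scale emb c (psi a).
  by apply/lfunP => w; rewrite cz_psi_scale (end_scaleE (@hs_embC _ X)).
have [t ht] := bounded_operator hk (g := psi) (end_scaling cz_embC V')
  (end_scaling (@hs_embC _ X) V)
  (end_filtration hk hds cz_emb_val cz_embC hL')
  (end_filtration hk (@falg_span _ D) (@hs_val_ext R X) (@hs_embC _ X) hL)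
  (end_scale_shifts cz_emb_val cz_embC hL')
  (end_scale_shifts (@hs_val_ext R X) (@hs_embC _ X) hL) hes
  (@cz_psiD R X beta Y i) hg.
by exists (- t) => s b hb; rewrite opprK; exact: ht.
Qed.

End Component.

Section SelfDualComponent.
Variables (R : realType) (X : hermitian_space R) (beta : 'End(hs_V X)).
Variables (Y : centralizer_datum beta) (i : cz_I Y).
Hypothesis hi : i \in cz_I0 Y.
Local Notation k := (hs_k X).
Local Notation nu := (@hs_nu R X).
Local Notation D := (hs_D X).
Local Notation v := (@hs_val R X).
Local Notation V := (hs_V X).
Local Notation sigma := (@hs_sigma R X).
Local Notation h := (@hs_h R X).
Local Notation emb := (in_alg D : {rmorphism k -> D}).
Local Notation E := (cz_E i).
Local Notation iota := (@cz_iota R X beta Y i).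
Local Notation D' := (cz_D i).
Local Notation v' := (@cz_val R X beta Y i).
Local Notation V' := (cz_V i).
Local Notation psi := (@cz_psi R X beta Y i).
Local Notation h' := (@cz_h R X beta Y i).
Local Notation rho' := (@cz_rho R X beta Y i).
Local Notation sigma' := (@cz_sigma R X beta Y i).
Local Notation emb' := (in_alg D' \o in_alg E : {rmorphism k -> D'}).
Let hk : is_odd_local_field nu := hs_local X.
Let hv' : is_valuation v' := @cz_valP R X beta Y i.
Let hh := hs_herm X.
Let hadj : is_adjoint h sigma := @hs_adjoint R X.
Let hh' := @cz_herm R X beta Y i hi.
Let hadj' : is_adjoint h' sigma' := @cz_adjoint R X beta Y i hi.

Lemma cz_sigma_pr : sigma (iota 1) = iota 1.
Proof.
have := hi; rewrite /cz_I0 inE => /eqP e.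
by rewrite cz_sIP e.
Qed.

Lemma cz_V_neq0 : exists w : V', w != 0.
Proof.
apply: contrapT => hne; have h0 (w : V') : w = 0.
  by apply/eqP/negPn/negP => w0; apply: hne; exists w.
have e0 : \1%VF = 0 :> 'End(V') by apply/lfunP => w; rewrite [LHS]h0 [RHS]h0.
have := cz_psi1 i; rewrite e0 cz_psi0 -(cz_iota0 i) => /(@cz_iota_inj R X beta Y i)/eqP.
by rewrite eq_sym oner_eq0.
Qed.

Lemma cz_sigma_scalar (tau : k -> k) : (forall c, @hs_rho R X (emb c) = emb (tau c)) ->
  forall c, sigma (iota c%:A) = iota (tau c)%:A.
Proof.
move=> htau c; apply: (adjoint_unique hh) => // x y.
rewrite !cz_iotak (herm_ractl hh) (herm_ractr hh) htau hs_embC.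
by rewrite hadj cz_sigma_pr.
Qed.

(** Both involutions on [k] can be read off from the action of [sigma] on scalar operators. Through
    [vr_involution] this makes [rho'] preserve the valuation of [D']. *)
Lemma cz_rho_emb (tau : k -> k) : (forall c, @hs_rho R X (emb c) = emb (tau c)) ->
  forall c, rho' (emb' c) = emb' (tau c).
Proof.
move=> htau c; have [w w0] := cz_V_neq0.
have e1 : sigma' (homothety V' (emb' c)) = homothety V' (emb' (tau c)).
  apply: (@cz_psi_inj R X beta Y i); rewrite cz_sigmaP // (cz_psiE (c%:A : E)).
  by rewrite (cz_psiE ((tau c)%:A : E)); exact: cz_sigma_scalar.
have [u hu] : exists u, h' w u != 0.
  apply: contrapT => hne; move/eqP: w0; apply; apply: (sh_nondeg hh') => u.
  by apply/eqP/negPn/negP => e; apply: hne; exists u.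
have := hadj' (homothety V' (emb' c)) w u.
rewrite e1 !cz_homothetyE (herm_ractl hh') (herm_ractr hh') -cz_embC => e.
by apply: (mulIr (cz_unit hu)).
Qed.

Lemma cz_vrho x : vr v' (rho' x) = vr v' x.
Proof.
have [tau htau hc] := hs_tau X; have [ds hds] := cz_span i.
exact: (vr_involution hk hds hv' (@cz_emb_val _ _ _ _ i) (Defs.sh_inv hh') htau (cz_rho_emb hc)).
Qed.

Section Point.
Variable x : R -> set V'.
Hypothesis hx : is_lattice_function v' (fine (v' (cz_pi i))) x.
Hypothesis hdual : dual_lattice_function v' h' x = x.
Let hxn : right_norm v' x := cz_latf_right_norm hx.

(** Compatibility in one direction already gives equality of the induced filtrations: this yields
    the second inclusion in the CLF condition. *)
Lemma cz_rigidity (F : R -> set V) : filtration F ->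
  (forall t (b : 'End(V')), shifts x x t b -> shifts F F t (psi b)) ->
  forall t (b : 'End(V')), shifts F F t (psi b) -> shifts x x t b.
Proof.
move=> hF.
apply: (rank1_rigidity hv' (@cz_unit _ _ _ _ i) (cz_piP i) hh' cz_vrho hxn hdual hF).
  by move=> a b w; rewrite cz_psiM comp_lfunE.
exact: cz_psi_eq0.
Qed.

Lemma cz_sigma_shifts t (b : 'End(V')) : shifts x x t b -> shifts x x t (sigma' b).
Proof.
move=> hb s u hu.
have sd := self_dualP hv' (@cz_unit _ _ _ _ i) (cz_piP i) hh' hxn hdual.
apply/sd => s' y hy; rewrite (adjoint_sym hh' _ _ _ hadj').
have -> : s + t + s' = s + (s' + t) by ring.
by apply: (sd s u).1 => //; exact: hb.
Qed.

Lemma cz_psi_scalar_shifts (F : R -> set V) (y : E) :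
  (forall t (b : 'End(V')), shifts x x t b -> shifts F F t (psi b)) -> y != 0 ->
  shifts F F (vr v' (y%:A : D')) (iota y).
Proof.
by move=> hF y0; rewrite -cz_psiE; apply: hF; exact: cz_homothety_shifts.
Qed.

(** By rigidity both norms induce the filtration [x] on the whole centralizer, so they give the same
    bounds and [norm_translation] applies. *)
Theorem cz_translation (L L' : R -> set V) : right_norm v L -> right_norm v L' ->
  (forall t (b : 'End(V')), shifts x x t b -> shifts L L t (psi b)) ->
  (forall t (b : 'End(V')), shifts x x t b -> shifts L' L' t (psi b)) ->
  exists c, forall r w, iota 1 w = w -> (L' r w <-> L (r + c) w).
Proof.
move=> hL hL' h1 h2.
have [p [_ _ hst]] := hs_structure X.
have [es hes] := space_span (@falg_span _ D) (@hs_embC _ X) V.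
have bounds (L1 L2 : R -> set V) : right_norm v L1 ->
    (forall t (b : 'End(V')), shifts x x t b -> shifts L1 L1 t (psi b)) ->
    (forall t (b : 'End(V')), shifts x x t b -> shifts L2 L2 t (psi b)) ->
    centralizer_bounds iota L1 L2.
  move=> hL1 e1 e2 a a1 aE t ha; have [_ hpsi] := @cz_psi_image R X beta Y i a.
  have [b hb] := hpsi (conj a1 aE).
  by rewrite -hb; apply: e2; apply: (cz_rigidity hL1.1 e1); rewrite hb.
have hik c : exists y : E, forall w, ract (emb c) (iota 1 w) = iota y w.
  by exists c%:A => w; rewrite cz_iotak.
have he c : v (emb c) = nu c by exact: hs_val_ext.
have tr := norm_translation hk (hs_valP X) he (@hs_embC _ X) (@hs_unit _ X) hst
  (@cz_iotaD R X beta Y i) (@cz_iotaM R X beta Y i) hik (@cz_E_inv _ _ _ _ i) hes hL hL'.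
apply: tr.
- by move=> y; exact: cz_psi_scalar_shifts.
- by move=> y; exact: cz_psi_scalar_shifts.
- exact: bounds.
exact: bounds.
Qed.

End Point.
End SelfDualComponent.

(** * Existence *)

Section DualNorm.
Variables (R : realType) (X : hermitian_space R).
Local Notation nu := (@hs_nu R X).
Local Notation D := (hs_D X).
Local Notation v := (@hs_val R X).
Local Notation V := (hs_V X).
Local Notation h := (@hs_h R X).
Let hk : is_odd_local_field nu := hs_local X.
Let hv : is_valuation v := hs_valP X.
Let hh := hs_herm X.
Local Notation dual := (dual_lattice_function v h).

Lemma hs_dual_geP (L : R -> set V) r x : right_norm v L ->
  dual L r x <-> forall s y, L s y -> vge v (r + s) (h x y).
Proof.
move=> hL; have [p [hp _ _]] := hs_structure X.
exact: (dual_geP hv (@hs_unit _ X) hp hh hL).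
Qed.

Lemma hs_dual_right_norm (L : R -> set V) : right_norm v L -> right_norm v (dual L).
Proof.
move=> hL; split; last first.
  move=> y y0 s w /(hs_dual_geP _ _ hL) hw; apply/(hs_dual_geP _ _ hL) => s' u hu.
  rewrite (herm_ractl hh) -addrA [vr v y + s']addrC addrA addrC; apply: (vgeM hv); last exact: hw.
  by rewrite -hs_vrho; exact: vge_vr.
split.
- by move=> r s _ u _; rewrite (herm0l hh); exact: (vpos0 hv).
- move=> r x y hx hy s rs u hu; rewrite (sh_addl hh) (hermNl hh).
  by apply: (vposB hv); [exact: hx hu|exact: hy hu].
- by move=> r s x sr hx s' hs' u hu; apply: (hx s') => //; lra.
- move=> r x hx s rs u hu; apply: (hx ((r - s) / 2)) hu; lra.
(* Comparison with the coordinate norm bounds [h x] on the balls of [L], so [x] lies in some ball of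
   the dual. *)
- move=> x; have [t ht] := @right_norm_op_bounded _ _ _ hk _ _ _ v (@falg_span _ D)
    (@hs_val_ext R X) (@hs_embC _ X) V L _ id hL (crd_norm_right_norm hv V)
    (conj (fun _ _ => erefl) (fun _ _ => erefl)).
  exists (t - \sum_j `|vr v (h x (crd_basis j))|) => s hs u hu.
  rewrite (crd_expand u) (herm_sumr hh); apply: (vpos_sum hv) => j _.
  rewrite (herm_ractr hh); have hc := ht _ _ hu j.
  apply: (vpos_ge _ (vgeM hv (vge_vr hv _) hc)).
  move: hs; rewrite (bigD1 j) //=; have := ler_norm (- vr v (h x (crd_basis j))); rewrite normrN.
  have : 0 <= \sum_(l | l != j) `|vr v (h x (crd_basis l))| by apply: sumr_ge0.
  lra.
move=> x hx; apply: (sh_nondeg hh) => w; apply: (vge_eq0 hv) => r.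
have [s hs] := fil_exh hL.1 w; rewrite -(subrK s r).
by have /(hs_dual_geP _ _ hL) := hx (r - s); apply.
Qed.

End DualNorm.

Section Existence.
Variables (R : realType) (X : hermitian_space R) (beta : 'End(hs_V X)).
Variables (Y : centralizer_datum beta).
Hypothesis hall : forall i, i \in cz_I0 Y.
Local Notation nu := (@hs_nu R X).
Local Notation D := (hs_D X).
Local Notation v := (@hs_val R X).
Local Notation V := (hs_V X).
Local Notation sigma := (@hs_sigma R X).
Local Notation h := (@hs_h R X).
Local Notation psi := (@cz_psi R X beta Y _).
Local Notation pr i := (@cz_iota R X beta Y i 1).
Local Notation dual := (dual_lattice_function v h).
Let hv : is_valuation v := hs_valP X.
Let hh := hs_herm X.
Let hadj : is_adjoint h sigma := @hs_adjoint R X.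

Lemma pr_id i w : pr i (pr i w) = pr i w.
Proof. exact: cz_iota11. Qed.

Lemma pr_ortho i j w : i != j -> pr i (pr j w) = 0.
Proof. by move=> ij; rewrite -comp_lfunE cz_ortho // lfunE. Qed.

Lemma pr_sum w : w = \sum_i pr i w.
Proof. by rewrite -sum_lfunE cz_sum1 lfunE. Qed.

Lemma pr_psi i (b : 'End(cz_V i)) w : pr i (psi b w) = psi b w.
Proof. by rewrite -comp_lfunE cz_pr_psi. Qed.

Lemma psi_pr i (b : 'End(cz_V i)) w : psi b (pr i w) = psi b w.
Proof. by rewrite -comp_lfunE cz_psi_pr. Qed.

Lemma pr_psi_ortho i j (b : 'End(cz_V j)) w : i != j -> pr i (psi b w) = 0.
Proof. by move=> ij; rewrite -pr_psi pr_ortho. Qed.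

Lemma herm_pr i x y : h (pr i x) y = h x (pr i y).
Proof. by rewrite hadj cz_sigma_pr. Qed.

Lemma herm_pr_sum x y : h x y = \sum_i h (pr i x) (pr i y).
Proof.
rewrite {1}(pr_sum y) (herm_sumr hh); apply: eq_bigr => i _.
by rewrite herm_pr pr_id.
Qed.

Variable x : forall i : cz_I Y, R -> set (cz_V i).
Arguments x : clear implicits.
Hypothesis hx : forall i,
  is_lattice_function (@cz_val R X beta Y i) (fine (cz_val (cz_pi i))) (x i).
Hypothesis hdual : forall i,
  dual_lattice_function (@cz_val R X beta Y i) (@cz_h R X beta Y i) (x i) = x i.

Definition clf_compatible (L : R -> set V) : Prop :=
  forall i t (b : 'End(cz_V i)), shifts (x i) (x i) t b -> shifts L L t (psi b).

Lemma clf_compatible_pr L r w i : clf_compatible L -> L r w -> L r (pr i w).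
Proof.
move=> hL hw; rewrite -cz_psi1 -[r]addr0; apply: hL hw => s u hu.
by rewrite lfunE addr0.
Qed.

(* The largest norm below a given one for which all [psi b] are bounded as prescribed. *)
Lemma exists_clf_compatible : exists2 L, right_norm v L & clf_compatible L.
Proof.
have h0 := crd_norm_right_norm hv V; have f0 := h0.1.
have /choice[B hB] : forall i, exists B, forall t (b : 'End(cz_V i)),
    shifts (x i) (x i) t b -> shifts (@crd_norm R D v V) (@crd_norm R D v V) (t - B) (psi b).
  by move=> i; apply: cz_psi_bounded => //; exact: cz_latf_right_norm.
pose L r : set V := [set w | forall i t (b : 'End(cz_V i)),
  shifts (x i) (x i) t b -> crd_norm v (r + t) (psi b w)].
have idshift i : shifts (x i) (x i) 0 \1%VF by move=> s u hu; rewrite lfunE addr0.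
exists L; last first.
  move=> i t b hb s w hw j t' b' hb'.
  have [ij|ij] := eqVneq j i; last first.
    by rewrite -psi_pr pr_psi_ortho // linear0; exact: fil_0 f0 _.
  subst j.
  rewrite -comp_lfunE -cz_psiM -addrA; apply: hw.
  by move=> l u hu; rewrite comp_lfunE addrA; apply/hb'/hb.
split; last first.
  move=> y y0 s w hw i t b hb; rewrite lfun_ract addrAC; apply: h0.2 => //; exact: hw.
split.
- by move=> r i t b _; rewrite linear0; exact: fil_0 f0 _.
- move=> r w1 w2 h1 h2 i t b hb; rewrite lfun_sub.
  by apply: (fil_sub f0); [exact: h1|exact: h2].
- move=> r s w sr hw i t b hb; apply: (fil_le f0) (hw i t b hb); lra.
- move=> r w hw i t b hb; apply: (fil_left f0) => s st.
  rewrite -(subrK t s); apply: hw hb; lra.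
- move=> w; have [s hs] := fil_exh f0 w; exists (s - \sum_i `|B i|) => i t b hb.
  apply: (fil_le f0) (hB i t b hb s w hs).
  rewrite (bigD1 i) //=; have := ler_norm (B i).
  have : 0 <= \sum_(l | l != i) `|B l| by apply: sumr_ge0.
  lra.
move=> w hw; apply: (fil_sep f0) => r; rewrite (pr_sum w); apply: (fil_sum f0) => i _.
by rewrite -cz_psi1 -[r]addr0; exact: hw.
Qed.

(** Adjunction moves [psi b] to the other argument as [psi (cz_sigma b)], and [x i], being
    self-dual, bounds [cz_sigma b] as it bounds [b]. *)
Lemma clf_compatible_dual L : right_norm v L -> clf_compatible L -> clf_compatible (dual L).
Proof.
move=> hL hc i t b hb s w /(hs_dual_geP _ _ hL) hw; apply/(hs_dual_geP _ _ hL) => s' u hu.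
rewrite hadj -cz_sigmaP // -addrA [t + s']addrC; apply: hw.
apply: (hc) hu; exact: (cz_sigma_shifts (hall i) (hx i) (hdual i) hb).
Qed.

(* On each summand the dual of a compatible norm is a translate of it; half of the
   translation makes it self-dual. *)
Theorem exists_self_dual_clf : exists L, [/\ right_norm v L, clf_compatible L & dual L = L].
Proof.
have [L hL hc] := exists_clf_compatible; have hf := hL.1.
have hL2 := hs_dual_right_norm hL; have hc2 := clf_compatible_dual hL hc.
have /choice[c hcc] : forall i, exists c, forall r w, pr i w = w -> (dual L r w <-> L (r + c) w).
  by move=> i; apply: (cz_translation (hall i) (hx i) (hdual i) hL hL2); [exact: hc|exact: hc2].
pose M r : set V := [set w | forall i, L (r + c i / 2) (pr i w)].
have hM : right_norm v M.
  split; last first.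
    by move=> y y0 s w hw i; rewrite lfun_ract addrAC; apply: hL.2 => //; exact: hw.
  split.
  - by move=> r i; rewrite linear0; exact: fil_0 hf _.
  - by move=> r w1 w2 h1 h2 i; rewrite lfun_sub; apply: (fil_sub hf); [exact: h1|exact: h2].
  - move=> r s w sr hw i; apply: (fil_le hf) (hw i); lra.
  - move=> r w hw i; apply: (fil_left hf) => s st.
    rewrite -(subrK (c i / 2) s); apply: hw; lra.
  - move=> w; have [s hs] := fil_exh hf w; exists (s - \sum_i `|c i / 2|) => i.
    apply: (fil_le hf) (clf_compatible_pr i hc hs).
    rewrite (bigD1 i) //=; have := ler_norm (c i / 2).
    have : 0 <= \sum_(l | l != i) `|c l / 2| by apply: sumr_ge0.
    lra.
  move=> w hw; rewrite (pr_sum w); apply: big1 => i _; apply: (fil_sep hf) => r.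
  by rewrite -(subrK (c i / 2) r); exact: hw.
have dualE r i w : dual L (r - c i / 2) (pr i w) <-> L (r + c i / 2) (pr i w).
  rewrite (hcc i _ _ (pr_id i w)); have -> : r - c i / 2 + c i = r + c i / 2 by lra.
  by [].
exists M; split=> //.
- move=> i t b hb s w hw j; have [ij|ij] := eqVneq j i; last first.
    by rewrite pr_psi_ortho //; exact: fil_0 hf _.
  rewrite ij pr_psi -psi_pr addrAC; apply: hc hb _ _ _; exact: hw.
apply/funext => r; apply/seteqP; split=> w hw.
  move=> i; apply/dualE => s hs u hu; rewrite herm_pr; apply: (hw (s - c i / 2)); first by lra.
  move=> j; have [->|ij] := eqVneq j i; last by rewrite pr_ortho //; exact: fil_0 hf _.
  by rewrite pr_id subrK; exact: clf_compatible_pr.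
move=> s hs u hu; rewrite herm_pr_sum; apply: (vpos_sum hv) => i _.
have /dualE := hw i; apply; last exact: hu.
lra.
Qed.

End Existence.

(** * Uniqueness *)

Section HyperbolicDichotomy.
Variables (R : realType) (X : hermitian_space R).
Local Notation k := (hs_k X).
Local Notation nu := (@hs_nu R X).
Local Notation D := (hs_D X).
Local Notation v := (@hs_val R X).
Local Notation V := (hs_V X).
Local Notation rho := (@hs_rho R X).
Local Notation eps := (hs_eps X).
Local Notation h := (@hs_h R X).
Local Notation sigma := (@hs_sigma R X).
Local Notation emb := (in_alg D : {rmorphism k -> D}).
Let hk : is_odd_local_field nu := hs_local X.
Let hv : is_valuation v := hs_valP X.
Let hh := hs_herm X.
Let hadj : is_adjoint h sigma := @hs_adjoint R X.

Lemma hs_self_dual_ge (L : R -> set V) r s x y : right_norm v L ->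
  dual_lattice_function v h L = L -> L r x -> L s y -> vge v (r + s) (h x y).
Proof.
move=> hL hself; have [p [hp _ _]] := hs_structure X.
exact: (self_dual_ge hv (@hs_unit _ X) hp hh hL hself).
Qed.

Lemma hs_rank1_shifts (L : R -> set V) r s x y : right_norm v L ->
  dual_lattice_function v h L = L -> L r x -> L s y -> shifts L L (r + s) (rank1 h x y).
Proof.
move=> hL hself; have [p [hp _ _]] := hs_structure X.
exact: (rank1_shifts hv (@hs_unit _ X) hp hh hL hself).
Qed.

Lemma hs_vr_herm_sym x y : vr v (h x y) = vr v (h y x).
Proof. exact: (vr_herm_sym hv hh (@hs_vrho _ X)). Qed.

Lemma right_norm_unscale (L : R -> set V) r d u : right_norm v L -> d != 0 ->
  L r (ract d u) -> L (r - vr v d) u.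
Proof.
move=> hL d0 hr; have ud := hs_unit d0.
have := hL.2 _ (inv_neq0_div (@hs_unit _ X) d0) _ _ hr.
by rewrite -ractM mulrV // ract1 (vr_inv hv (@hs_unit _ X)).
Qed.

Definition skew_rank2 (x y : V) : 'End(V) := rank1 h x y - rank1 h (ract eps y) x.

Lemma skew_rank2_skew x y : sigma (skew_rank2 x y) = - skew_rank2 x y.
Proof.
have e : rank1 h (ract eps y) x = sigma (rank1 h x y).
  by rewrite (adjoint_rank1 hh x y hadj).
rewrite /skew_rank2 e (adjointD hh _ _ hadj) (adjointN hh _ hadj) (adjointK hh _ hadj).
by rewrite opprB addrC.
Qed.

Lemma skew_rank2E x y w :
  skew_rank2 x y w = ract (h y w) x - ract (eps * h x w) y.
Proof. by rewrite add_lfunE opp_lfunE !(rank1E hh) ractM. Qed.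

Lemma skew_rank2_shifts (L : R -> set V) r s x y : right_norm v L ->
  dual_lattice_function v h L = L -> L r x -> L s y -> shifts L L (r + s) (skew_rank2 x y).
Proof.
move=> hL hself hx hy t w hw; rewrite add_lfunE opp_lfunE.
apply: (fil_sub hL.1); first exact: hs_rank1_shifts hw.
rewrite [r + s]addrC.
apply: (hs_rank1_shifts hL hself _ hx) hw.
have := hL.2 _ (eps_neq0 hh) _ _ hy.
by rewrite (vr_eps hv hh) addr0.
Qed.

Variable pr : 'End(V).
Hypothesis pr_pr : forall w, pr (pr w) = pr w.
Hypothesis pr_herm : forall x y, h (pr x) y = h x (pr y).

Definition skew_agree (L L' : R -> set V) : Prop :=
  forall a : 'End(V), sigma a = - a -> (pr \o a)%VF = a -> (a \o pr)%VF = a ->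
  forall t, shifts L L t a -> shifts L' L' t a.

(** The exceptional case: the skew operators of such a plane are the diagonal ones with entries [l]
    and [- l], so all norms split by [g1] and [g2] bound them alike, and moving the norms of [g1]
    and [g2] in opposite directions preserves self-duality. *)
Definition hyperbolic : Prop :=
  [/\ forall x : D, exists c, x = emb c, forall x, rho x = x, eps = 1 &
  exists g1 g2, [/\ pr g1 = g1, pr g2 = g2, h g1 g1 = 0, h g2 g2 = 0 &
    h g1 g2 = 1 /\ forall w, pr w = ract (h g2 w) g1 + ract (h g1 w) g2]].

Lemma skew_rank2_pr x y : pr x = x -> pr y = y ->
  (pr \o skew_rank2 x y)%VF = skew_rank2 x y /\ (skew_rank2 x y \o pr)%VF = skew_rank2 x y.
Proof.
move=> px py; split; apply/lfunP => w; rewrite comp_lfunE !skew_rank2E.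
  by rewrite lfun_sub !lfun_ract px py.
by rewrite -!pr_herm px py.
Qed.

(** The Gram determinant of [e] and [f] is [a * b - 1], and [1 - a * b] is a square [r ^+ 2] by
    [lf_sqrt], so the plane is split. Taking [r] congruent to 1 keeps [1 + r] invertible. *)
Lemma hyperbolic_of_disc (e f : V) (a b : k) :
  (forall x : D, exists c, x = emb c) -> (forall x, rho x = x) -> eps = 1 ->
  pr e = e -> pr f = f -> h e e = emb a -> h f f = emb b -> h e f = 1 ->
  vpos nu (a * b) ->
  (forall u, pr u = u -> h u e = 0 -> h u f = 0 -> u = 0) -> hyperbolic.
Proof.
move=> hD hr e1 pe pf ee ff ef hab horth; split=> //.
have hsym x y : h x y = h y x by rewrite (herm_sym hh) e1 hr mul1r.
have hab' : vpos nu (- (a * b)) by exact: (vposN (lf_val hk)).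
have [r rr hr1] := lf_sqrt hk hab'.
have r1 : 1 + r != 0.
  apply/eqP => e0; apply: (lf_not_vpos2 hk).
  have -> : (2 : k) = (1 + r) - (r - 1) by ring.
  by rewrite e0 sub0r; apply: (vposN (lf_val hk)).
have r0 : r != 0.
  apply/eqP => e0; apply: (lf_not_vpos1 hk); move: hr1; rewrite e0 sub0r.
  by move/(vposN (lf_val hk)); rewrite opprK.
have n2 := lf_2neq0 hk.
have abE : a * b = (1 - r) * (1 + r) by rewrite -[a * b]opprK -[- (a * b)](addKr 1) -rr; ring.
(* [t] and [t'] are roots of [a t^2 + 2 t + b] and [b t'^2 + 2 t' + a], written with denominator
   [1 + r] because [a] or [b] may vanish; [m] is the value of the form on the two isotropic vectors
   [g1] and [g]. *)
pose t := - b / (1 + r); pose t' := - a / (1 + r); pose m := 2 * r ^+ 2 / (1 + r).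
have m0 : m != 0 by rewrite !mulf_neq0 ?invr_eq0 ?expf_neq0.
pose g1 := ract (emb t) e + f; pose g := e + ract (emb t') f.
pose g2 := ract (emb m^-1) g.
have fe : h f e = 1 by rewrite hsym.
have H x1 x2 y1 y2 : h (ract (emb x1) e + ract (emb x2) f) (ract (emb y1) e + ract (emb y2) f) =
    emb (x1 * y1 * a + (x1 * y2 + x2 * y1) + x2 * y2 * b).
  rewrite !(sh_addl hh) !(sh_addr hh) !(herm_ractl hh) !(herm_ractr hh) !hr ee ff ef fe.
  rewrite !mul1r -!rmorphM -!rmorphD; congr (emb _); ring.
have g1E : g1 = ract (emb t) e + ract (emb 1) f by rewrite rmorph1 ract1.
have gE : g = ract (emb 1) e + ract (emb t') f by rewrite rmorph1 ract1.
have g11 : h g1 g1 = 0.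
  rewrite g1E H; apply/eqP; rewrite fmorph_eq0; apply/eqP.
  have -> : t * t * a + (t * 1 + 1 * t) + 1 * 1 * b =
      b / (1 + r) ^+ 2 * (a * b - 2 * (1 + r) + (1 + r) ^+ 2) by rewrite /t; field.
  by rewrite abE (_ : _ - _ + _ = 0) ?mulr0 //; ring.
have gg : h g g = 0.
  rewrite gE H; apply/eqP; rewrite fmorph_eq0; apply/eqP.
  have -> : 1 * 1 * a + (1 * t' + t' * 1) + t' * t' * b =
      a / (1 + r) ^+ 2 * (a * b - 2 * (1 + r) + (1 + r) ^+ 2) by rewrite /t'; field.
  by rewrite abE (_ : _ - _ + _ = 0) ?mulr0 //; ring.
have g1g : h g1 g = emb m.
  rewrite g1E gE H; congr (emb _).
  have -> : t * 1 * a + (t * t' + 1 * 1) + 1 * t' * b =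
     1 - 2 * (a * b) / (1 + r) + (a * b) / (1 + r) ^+ 2 by rewrite /t /t'; field.
  by rewrite abE /m; field.
have embm : emb m^-1 * emb m = 1 by rewrite -rmorphM mulVf // rmorph1.
have g22 : h g2 g2 = 0 by rewrite (herm_ractl hh) (herm_ractr hh) gg mul0r mulr0.
have g12 : h g1 g2 = 1 by rewrite (herm_ractr hh) g1g -hs_embC embm.
have pg1 : pr g1 = g1 by rewrite lfun_add lfun_ract pe pf.
have pg2 : pr g2 = g2 by rewrite lfun_ract lfun_add lfun_ract pe pf.
have g2E : g2 = ract (emb m^-1) g by [].
clearbody g2 g1 g.
exists g1, g2; split=> //; split=> // w.
have g21 : h g2 g1 = 1 by rewrite hsym.
apply/eqP; rewrite -subr_eq0; apply/eqP; set u := _ - _.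
have pu : pr u = u by rewrite lfun_sub lfun_add !lfun_ract pr_pr pg1 pg2.
have u1 : h g1 u = 0.
  rewrite (hermBr hh) (sh_addr hh) !(herm_ractr hh) g11 g12 mul0r mul1r add0r.
  by rewrite -pr_herm pg1 subrr.
have u2 : h g2 u = 0.
  rewrite (hermBr hh) (sh_addr hh) !(herm_ractr hh) g22 g21 mul0r mul1r addr0.
  by rewrite -pr_herm pg2 subrr.
have u2' : h g u = 0.
  have : emb m * h g2 u = 0 by rewrite u2 mulr0.
  rewrite g2E (herm_ractl hh) hr mulrA -rmorphM mulfV // rmorph1 mul1r; exact.
have [xe hxe] := hD (h e u); have [xf hxf] := hD (h f u).
have q1 : t * xe + xf = 0.
  apply/eqP; rewrite -(fmorph_eq0 emb) rmorphD rmorphM -hxe -hxf.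
  by move: u1; rewrite g1E (sh_addl hh) !(herm_ractl hh) !hr rmorph1 mul1r => ->.
have q2 : xe + t' * xf = 0.
  apply/eqP; rewrite -(fmorph_eq0 emb) rmorphD rmorphM -hxe -hxf.
  by move: u2'; rewrite gE (sh_addl hh) !(herm_ractl hh) !hr rmorph1 mul1r => ->.
have xe0 : xe = 0.
  have : (1 - t * t') * xe = 0.
    have -> : (1 - t * t') * xe = (xe + t' * xf) - t' * (t * xe + xf) by ring.
    by rewrite q1 q2 mulr0 subrr.
  have -> : 1 - t * t' = 2 * r / (1 + r).
    have -> : 1 - t * t' = 1 - (a * b) / (1 + r) ^+ 2 by rewrite /t /t'; field.
    by rewrite abE; field.
  by move/eqP; rewrite !mulf_eq0 invr_eq0 (negbTE n2) (negbTE r0) (negbTE r1) /= => /eqP.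
have xf0 : xf = 0 by move: q1; rewrite xe0 mulr0 add0r.
by apply: horth => //; rewrite hsym ?hxe ?hxf ?xe0 ?xf0 rmorph0.
Qed.

End HyperbolicDichotomy.

Section SkewAgreement.
Variables (R : realType) (X : hermitian_space R).
Local Notation k := (hs_k X).
Local Notation nu := (@hs_nu R X).
Local Notation D := (hs_D X).
Local Notation v := (@hs_val R X).
Local Notation V := (hs_V X).
Local Notation rho := (@hs_rho R X).
Local Notation eps := (hs_eps X).
Local Notation h := (@hs_h R X).
Local Notation sigma := (@hs_sigma R X).
Local Notation emb := (in_alg D : {rmorphism k -> D}).
Let hk : is_odd_local_field nu := hs_local X.
Let hv : is_valuation v := hs_valP X.
Let he c : v (emb c) = nu c := @hs_val_ext R X c.
Let hh := hs_herm X.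
Let hrho := Defs.sh_inv hh.
Let hadj : is_adjoint h sigma := @hs_adjoint R X.
Variable pr : 'End(V).
Hypothesis pr_pr : forall w, pr (pr w) = pr w.
Hypothesis pr_herm : forall x y, h (pr x) y = h x (pr y).

(** Each [m - eps * rho m] satisfies the hypothesis on [l], hence vanishes. At 1 this gives
    [eps = 1], then [rho] is the identity, and an algebra whose identity map reverses products is
    commutative. *)
Lemma scalar_involution : (forall l, eps * rho l = - l -> l = 0) ->
  [/\ forall x : D, exists c, x = emb c, forall x, rho x = x & eps = 1].
Proof.
move=> hl.
have fixed m : eps * rho m = m.
  apply/esym/eqP; rewrite -subr_eq0; apply/eqP/hl.
  rewrite (inv_add hrho) (inv_atN hh) (inv_mul hrho) (inv_invol hrho) (rho_eps hh).
  by rewrite mulrDr mulrN -(eps_comm hh m) mulrA (eps_sq hh) mul1r opprB.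
have e1 : eps = 1 by have := fixed 1; rewrite (inv_one hrho) mulr1.
have r1 x : rho x = x by have := fixed x; rewrite e1 mul1r.
split=> // x; have [y|c ->] := cd_central (hs_division X) (z := x); last by exists c.
by rewrite -{1}[x * y]r1 (inv_mul hrho) !r1.
Qed.

(* For [u] orthogonal to [e] or [f], the skew operators [e h(u, .) - eps u h(e, .)] and
   [f h(u, .) - eps u h(f, .)] bound [N u - N' u] from both sides, so no [u] is orthogonal
   to both; and [e l h(e, .)] is skew if [eps * rho l = - l], which forces [l = 0]. *)
Lemma extremal_pair_hyperbolic (L L' : R -> set V) (N N' : V -> R) (c : R) (e : V) :
  right_norm v L -> right_norm v L' ->
  dual_lattice_function v h L = L -> dual_lattice_function v h L' = L' ->
  (forall r w, L r w -> L r (pr w)) -> (forall r w, L' r w -> L' r (pr w)) ->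
  skew_agree pr L L' -> skew_agree pr L' L ->
  (forall w, w != 0 -> forall s, L s w <-> s <= N w) ->
  (forall w, w != 0 -> forall s, L' s w <-> s <= N' w) ->
  0 < c -> pr e = e -> e != 0 -> c - c / 8 < N e - N' e ->
  (forall w, w != 0 -> pr w = w -> N' w - N w <= c) -> hyperbolic pr.
Proof.
move=> hL hL' hd hd' st st' ag ag' hN hN' c0 pe e0 hc hmax.
have [p [hp _ _]] := hs_structure X.
(* A common margin for the two approximate choices: [e] is within [d] of the extremal value, and its
   partner [u] within [d] of attaining duality for [L']. The estimates below leave room because
   [2 * d < c]. *)
pose d := c / 8; have d0 : 0 < d by rewrite /d; lra.
have hc' : c - d < N e - N' e by [].
have [|s [u [hs hu eu hle]]] := near_norming hv hd' (t := N' e + d) (x := e).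
  by rewrite (hN' _ e0); lra.
pose f := pr u; have pf : pr f = f by rewrite /f pr_pr.
have ef : h e f = h e u by rewrite /f -pr_herm pe.
have ef0 : h e f != 0 by rewrite ef.
have f0 : f != 0 by apply: contraNneq ef0 => ->; rewrite (herm0r hh).
have fe0 : h f e != 0 by apply: contraNneq ef0 => /(herm_eq0 hh) ->.
have hf' : s <= N' f by apply/(hN' _ f0); exact: st'.
have LNe : L (N e) e by apply/(hN _ e0).
have LNf : L (N f) f by apply/(hN _ f0).
have LNe' : L' (N' e) e by apply/(hN' _ e0).
have LNf' : L' (N' f) f by apply/(hN' _ f0).
set z := vr v (h e f).
have z1 : z < N' e + N' f + d by rewrite /z ef; lra.
have z2 : N e + N f <= z by apply: (vr_ge hv ef0); exact: (hs_self_dual_ge hL hd LNe LNf).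
have zs : vr v (h f e) = z by rewrite hs_vr_herm_sym.
have epsu : eps * h e f != 0 by rewrite (mul_neq0 hv) // (eps_neq0 hh).
have vepsu : vr v (eps * h e f) = z by rewrite (vrM hv) ?(eps_neq0 hh) // (vr_eps hv hh) add0r.
have epsu' : eps * h f e != 0 by rewrite (mul_neq0 hv) // (eps_neq0 hh).
have vepsu' : vr v (eps * h f e) = z by rewrite (vrM hv) ?(eps_neq0 hh) // (vr_eps hv hh) add0r.
have claim1 w : pr w = w -> w != 0 -> h w f = 0 -> c - 2 * d < N' w - N w.
  move=> pw w0 wf; have [a1 a2] := skew_rank2_pr pr_herm pe pw.
  have := ag _ (skew_rank2_skew e w) a1 a2 _
    (skew_rank2_shifts hL hd LNe ((hN _ w0 _).2 (lexx _))) _ _ LNf'.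
  rewrite skew_rank2E wf ract0 sub0r => /(fil_opp hL'.1); rewrite opprK.
  move/(right_norm_unscale hL' epsu)/(hN' _ w0); rewrite vepsu; rewrite /d in hc' z1 *; lra.
have claim2 w : pr w = w -> w != 0 -> h w e = 0 -> c - 2 * d < N w - N' w.
  move=> pw w0 we; have [a1 a2] := skew_rank2_pr pr_herm pf pw.
  have := ag' _ (skew_rank2_skew f w) a1 a2 _
    (skew_rank2_shifts hL' hd' LNf' ((hN' _ w0 _).2 (lexx _))) _ _ LNe.
  rewrite skew_rank2E we ract0 sub0r => /(fil_opp hL.1); rewrite opprK.
  move/(right_norm_unscale hL epsu')/(hN _ w0); rewrite vepsu'; rewrite /d in hc' z1 *; lra.
have horth w : pr w = w -> h w e = 0 -> h w f = 0 -> w = 0.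
  move=> pw we wf; apply/eqP/negPn/negP => w0.
  by have := claim1 w pw w0 wf; have := claim2 w pw w0 we; rewrite /d; lra.
have hl l : eps * rho l = - l -> l = 0.
  move=> hl; apply/eqP/negPn/negP => l0.
  (* Applied to [f], this skew operator would give [N e - N' e < d / 2]. *)
  pose a := rank1 h (ract l e) e.
  have sa : sigma a = - a.
    rewrite (adjoint_rank1 hh _ _ hadj); apply/lfunP => w.
    rewrite opp_lfunE !(rank1E hh) (herm_ractl hh) -!ractM -ractNl; congr ract.
    by rewrite mulrA hl mulNr.
  have La : L (N e + vr v l) (ract l e) by exact: hL.2.
  have a1 : (pr \o a)%VF = a.
    by apply/lfunP => w; rewrite comp_lfunE !(rank1E hh) !lfun_ract pe.
  have a2 : (a \o pr)%VF = a.
    by apply/lfunP => w; rewrite comp_lfunE !(rank1E hh) -pr_herm pe.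
  have := ag _ sa a1 a2 _ (hs_rank1_shifts hL hd La LNe) _ _ LNf'.
  rewrite (rank1E hh) -ractM.
  have lf0 : l * h e f != 0 by rewrite (mul_neq0 hv).
  move/(right_norm_unscale hL' lf0)/(hN' _ e0); rewrite (vrM hv) // -/z /d in z1 hc' *; lra.
have [hD hr e1] := scalar_involution hl.
have u1 := hs_unit ef0; pose f1 := ract (h e f)^-1 f.
have ef1 : h e f1 = 1 by rewrite (herm_ractr hh) mulrV.
have ef'0 := inv_neq0_div (@hs_unit _ X) ef0.
have Lf1 : L' (N' f - z) f1.
  by have := hL'.2 _ ef'0 _ _ LNf'; rewrite (vr_inv hv (@hs_unit _ X)).
have pf1 : pr f1 = f1 by rewrite lfun_ract pf.
have [a ha] := hD (h e e); have [b hb] := hD (h f1 f1).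
have va : vge nu (N e + N e) a.
  by rewrite /vge -he -ha; exact: (hs_self_dual_ge hL hd LNe LNe).
have vb : vge nu ((N' f - z) + (N' f - z)) b.
  by rewrite /vge -he -hb; exact: (hs_self_dual_ge hL' hd' Lf1 Lf1).
(* The bound for [a] comes from [L] and that for [b] from [L']; together [a * b] has value above
   [2 * c - 4 * d], which is positive. *)
apply: (@hyperbolic_of_disc _ _ pr pr_pr pr_herm e f1 a b) => //.
  apply: (vpos_ge _ (vgeM (lf_val hk) va vb)); rewrite /d in z1 hc' *; lra.
move=> w pw we wf; apply: horth => //.
by move: wf; rewrite (herm_ractr hh) => wf; rewrite -(mulrVK u1 (h w f)) wf mul0r.
Qed.

(** If the norms differ, their distance has a finite positive supremum, and a vector where it is
    nearly reached feeds [extremal_pair_hyperbolic]; the sign of the difference decides which norm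
    plays the role of [L]. *)
Theorem skew_agree_dichotomy (L L' : R -> set V) :
  right_norm v L -> right_norm v L' ->
  dual_lattice_function v h L = L -> dual_lattice_function v h L' = L' ->
  (forall r w, L r w -> L r (pr w)) -> (forall r w, L' r w -> L' r (pr w)) ->
  skew_agree pr L L' -> skew_agree pr L' L ->
  (forall r w, pr w = w -> (L' r w <-> L r w)) \/ hyperbolic pr.
Proof.
move=> hL hL' hd hd' st st' ag ag'.
have hval (M : R -> set V) : right_norm v M ->
    exists N : V -> R, forall w, w != 0 -> forall s, M s w <-> s <= N w.
  move=> hM; have /choice[N hN] : forall w, exists n, w != 0 -> forall s, M s w <-> s <= n.
    move=> w; have [->|w0] := eqVneq w 0; first by exists 0.
    by have [n hn] := fil_value hM.1 w0; exists n.
  by exists N.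
have [N hN] := hval L hL; have [N' hN'] := hval L' hL'.
have [heq|] := pselect (forall w, pr w = w -> w != 0 -> N w = N' w).
  left=> r w pw; have [->|w0] := eqVneq w 0.
    by split=> _; [exact: fil_0 hL.1 _|exact: fil_0 hL'.1 _].
  by rewrite (hN' _ w0) (hN _ w0) heq.
move=> /existsNP[w1 /not_implyP[pw1 /not_implyP[w10 hne]]]; right.
have cmp (M1 M2 : R -> set V) (N1 N2 : V -> R) : right_norm v M1 -> right_norm v M2 ->
    (forall w, w != 0 -> forall s, M1 s w <-> s <= N1 w) ->
    (forall w, w != 0 -> forall s, M2 s w <-> s <= N2 w) ->
    exists t, forall w, w != 0 -> N1 w - N2 w <= t.
  move=> h1 h2 n1 n2.
  have [t ht] := @right_norm_op_bounded _ _ _ hk _ _ _ v (@falg_span _ D)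
    he (@hs_embC _ X) V M1 M2 id h1 h2 (conj (fun _ _ => erefl) (fun _ _ => erefl)).
  exists (- t) => w w0; have /(n2 _ w0) := ht _ _ ((n1 _ w0 _).2 (lexx _)); lra.
have [t1 ht1] := cmp L L' N N' hL hL' hN hN'; have [t2 ht2] := cmp L' L N' N hL' hL hN' hN.
pose S := [set c | exists w, [/\ pr w = w, w != 0 & c = `|N w - N' w|]].
have hS : has_sup S.
  split; first by exists `|N w1 - N' w1|, w1.
  exists (`|t1| + `|t2|) => c [w [_ w0 ->]].
  have := ht1 w w0; have := ht2 w w0; have := ler_norm t1; have := ler_norm t2.
  have := normr_ge0 t1; have := normr_ge0 t2.
  by case: (ler0P (N w - N' w)); lra.
have c0 : 0 < sup S.
  apply: lt_le_trans (_ : `|N w1 - N' w1| <= _); last by apply: sup_upper_bound => //; exists w1.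
  by rewrite normr_gt0 subr_eq0; apply/eqP.
have d0 : 0 < sup S / 8 by lra.
have [_ [e [pe e0 ->]] hlt] := sup_adherent d0 hS.
have hmax w : w != 0 -> pr w = w -> `|N w - N' w| <= sup S.
  by move=> w0 pw; apply: sup_upper_bound => //; exists w.
have [h1|h1] := leP 0 (N e - N' e).
  apply: (extremal_pair_hyperbolic hL hL' hd hd' st st' ag ag' hN hN' c0 pe e0).
    by rewrite -(ger0_norm h1).
  by move=> w w0 pw; have := hmax w w0 pw; have := ler_norm (N' w - N w); rewrite distrC; lra.
apply: (extremal_pair_hyperbolic hL' hL hd' hd st' st ag' ag hN' hN c0 pe e0).
  by rewrite -[N' e - N e]opprB -(ltr0_norm h1).
by move=> w w0 pw; have := hmax w w0 pw; have := ler_norm (N w - N' w); lra.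
Qed.

End SkewAgreement.

(** * Components with and without skew scalars *)

Section Uniqueness.
Variables (R : realType) (X : hermitian_space R) (beta : 'End(hs_V X)).
Variables (Y : centralizer_datum beta).
Hypothesis hall : forall i, i \in cz_I0 Y.
Local Notation k := (hs_k X).
Local Notation nu := (@hs_nu R X).
Local Notation D := (hs_D X).
Local Notation v := (@hs_val R X).
Local Notation V := (hs_V X).
Local Notation sigma := (@hs_sigma R X).
Local Notation h := (@hs_h R X).
Local Notation iota := (@cz_iota R X beta Y _).
Local Notation psi := (@cz_psi R X beta Y _).
Local Notation pr i := (@cz_iota R X beta Y i 1).
Local Notation dual := (dual_lattice_function v h).
Local Notation emb := (in_alg D : {rmorphism k -> D}).
Let hk : is_odd_local_field nu := hs_local X.
Let he c : v (emb c) = nu c := @hs_val_ext R X c.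
Let hh := hs_herm X.
Let hadj : is_adjoint h sigma := @hs_adjoint R X.

Definition has_skew_scalar (i : cz_I Y) : Prop :=
  exists2 e : cz_E i, e != 0 & sigma (iota e) = - iota e.

Section WithoutSkewScalar.
Variable i : cz_I Y.
Hypothesis hbad : ~ has_skew_scalar i.

(** On [V_i], [beta] acts as an element of [E_i], which is skew because [beta] is; without nonzero
    skew scalars that element is 0. *)
Lemma bad_beta w : beta (pr i w) = 0.
Proof.
have hb : beta = beta :> 'End(V) by [].
have [hfor _] := @cz_adjoin R X beta Y beta.
have [|b bE] := hfor.
  by exists 'X => u; rewrite size_polyX big_ord_recl big_ord1 !coefX /= !scale0r !scale1r add0r.
have bw u : beta u = \sum_j iota (b j) u.
  by have := congr1 (fun f : 'End(V) => f u) bE; rewrite /= sum_lfunE.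
have bi u : beta (pr i u) = iota (b i) u.
  rewrite bw (bigD1 i) //= big1 ?addr0; last first.
    move=> j ji; have -> : b j = b j * 1 by rewrite mulr1.
    by rewrite cz_iotaMw pr_ortho // linear0.
  by rewrite -cz_iotaMw mulr1.
have bi2 u : pr i (beta u) = iota (b i) u.
  rewrite bw lfun_sum (bigD1 i) //= big1 ?addr0; last first.
    move=> j ji; have -> : b j = 1 * b j by rewrite mul1r.
    by rewrite cz_iotaMw pr_ortho // eq_sym.
  by rewrite -cz_iotaMw mul1r.
rewrite bi; have [->|b0] := eqVneq (b i) 0; first by rewrite cz_iota0 lfunE.
case: hbad; exists (b i) => //; apply: (adjoint_unique hh hadj) => x y.
have hbeta : sigma beta = - beta := cz_beta Y.
by rewrite -bi hadj hbeta opp_lfunE (hermNr hh) opp_lfunE (hermNr hh) (herm_pr hall) bi2.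
Qed.

Lemma bad_adjoin (P : {poly k}) w :
  \sum_(l < size P) ((P`_l)%:A : D^c) *: iter l beta (pr i w) = ract (emb P`_0) (pr i w).
Proof.
have hit l : iter l.+1 beta (pr i w) = 0.
  by elim: l => [|l IH]; [exact: bad_beta|rewrite iterS IH linear0].
have [s0|s0] := posnP (size P).
  rewrite s0 big_ord0 nth_default ?s0 // rmorph0.
  exact/esym/ract0.
rewrite (bigD1 (Ordinal s0)) //= big1 ?addr0 // => -[[|l] hl] // _.
by rewrite -[iter _ _ _]/(iter l.+1 beta (pr i w)) hit scaler0.
Qed.

(** Every element of [E_i] is a polynomial in [beta], and where [beta] vanishes a polynomial acts by
    its constant term. *)
Lemma bad_scalar (y : cz_E i) : exists c, y = c%:A.
Proof.
have [_ hback] := @cz_adjoin R X beta Y (iota y).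
have [|P hP] := hback.
  exists (@dfwith _ (fun j => cz_E j : Type) (fun j => 0) i y).
  rewrite (bigD1 i) //= dfwith_in big1 ?addr0 // => j ji.
  by rewrite dfwith_out ?cz_iota0 // eq_sym.
exists P`_0; apply: (@cz_iota_inj R X beta Y i); apply/lfunP => w.
by rewrite cz_iotak -bad_adjoin -hP -cz_iotaMw mulr1.
Qed.

End WithoutSkewScalar.

(** The idempotent [1_i] is a polynomial in [beta]; its constant term would have to be 1 on [V_i]
    and 0 on [V_j]. *)
Lemma bad_unique i j : ~ has_skew_scalar i -> ~ has_skew_scalar j -> i = j.
Proof.
move=> hi hj; apply/eqP/negPn/negP => ij.
have [_ hback] := @cz_adjoin R X beta Y (pr i).
have [|P hP] := hback.
  exists (@dfwith _ (fun j => cz_E j : Type) (fun j => 0) i 1).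
  rewrite (bigD1 i) //= dfwith_in big1 ?addr0 // => l li.
  by rewrite dfwith_out ?cz_iota0 // eq_sym.
have e1 : (1 : cz_E i) = (P`_0)%:A.
  apply: (@cz_iota_inj R X beta Y i); apply/lfunP => w.
  by rewrite cz_iotak -(bad_adjoin hi) -hP pr_id.
have e2 : (P`_0)%:A = 0 :> cz_E j.
  apply: (@cz_iota_inj R X beta Y j); apply/lfunP => w.
  by rewrite cz_iotak -(bad_adjoin hj) -hP pr_ortho // cz_iota0 lfunE.
move/eqP: e2; rewrite scaler_eq0 oner_eq0 orbF => /eqP P0.
by move/eqP: e1; rewrite P0 scale0r oner_eq0.
Qed.

Variable x : forall i : cz_I Y, R -> set (cz_V i).
Arguments x : clear implicits.
Hypothesis hx : forall i,
  is_lattice_function (@cz_val R X beta Y i) (fine (cz_val (cz_pi i))) (x i).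
Hypothesis hdual : forall i,
  dual_lattice_function (@cz_val R X beta Y i) (@cz_h R X beta Y i) (x i) = x i.

Definition skew_compatible (L : R -> set V) : Prop :=
  forall i t (b : 'End(cz_V i)), cz_sigma b = - b ->
    (shifts (x i) (x i) t b <-> shifts L L t (psi b)).

Lemma shifts_half (M : zmodType) (K : R -> set M) (L : R -> set V) t (a : M -> V) :
  right_norm v L -> shifts K L t (fun w => a w + a w) -> shifts K L t a.
Proof.
move=> hL ha s w hw; have := ha s w hw.
have n20 := lf_2neq0 hk.
have e20 : emb 2^-1 != 0 by rewrite (emb_neq0 emb) // invr_eq0.
move/(hL.2 _ e20); rewrite (vr_emb he) (vrV (lf_val hk)) ?unitfE // (lf_vr2 hk) oppr0 addr0.
have e1 : 2^-1 + 2^-1 = 1 :> k by field.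
by rewrite ractD -ractDl -rmorphD e1 rmorph1 ract1.
Qed.

(* [b] is the sum of a skew operator and of a symmetric one, and the latter is the product
   of a skew operator with the inverse of a skew scalar. *)
Lemma skew_scalar_compatible i (L : R -> set V) : right_norm v L -> skew_compatible L ->
  has_skew_scalar i ->
  forall t (b : 'End(cz_V i)), shifts (x i) (x i) t b -> shifts L L t (psi b).
Proof.
move=> hL hc [e e0 he'] t b hb; have hi := hall i.
have hxi := cz_latf_right_norm (hx i).
have adj' : is_adjoint (@cz_h R X beta Y i) (@cz_sigma R X beta Y i) := cz_adjoint hi.
have hh' := cz_herm hi.
pose m (y : cz_E i) := homothety (cz_V i) (y%:A : cz_D i).
have mM y z : (m y \o m z)%VF = m (y * z).
  by apply/(@cz_psi_inj R X beta Y i); rewrite cz_psiM !cz_psiE cz_iotaM.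
have m1 : m 1 = \1%VF by exact: cz_homothety1.
have mC y (a : 'End(cz_V i)) : (m y \o a)%VF = (a \o m y)%VF.
  by apply/lfunP => w; rewrite !comp_lfunE !cz_homothetyE lfun_ract.
have sm : cz_sigma (m e) = - m e.
  apply/(@cz_psi_inj R X beta Y i); rewrite cz_sigmaP // cz_psiN cz_psiE; exact: he'.
have smV : cz_sigma (m e^-1) = - m e^-1.
  have s1 : cz_sigma \1%VF = \1%VF :> 'End(cz_V i).
    by apply: (adjoint_unique hh' adj') => u w; rewrite !lfunE.
  pose n := cz_sigma (m e^-1).
  have e2 : (n \o m e)%VF = - \1%VF.
    have := adjointM hh' (m e) (m e^-1) adj'.
    by rewrite mM mulfV // m1 s1 sm comp_lfunNr => ->; rewrite opprK.
  rewrite -/n -[n]comp_lfun1r -m1 -(mulfV e0) -mM comp_lfunA e2 comp_lfunNl comp_lfun1l.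
  by [].
have hsb := cz_sigma_shifts hi (hx i) (hdual i) hb.
have hskew : shifts L L t (psi (b - cz_sigma b)).
  apply/hc; first by rewrite (adjointD hh' _ _ adj') (adjointN hh' _ adj') (adjointK hh' _ adj') opprB addrC.
  move=> s u hu; rewrite add_lfunE opp_lfunE.
  by apply: (fil_sub hxi.1); [exact: hb|exact: hsb].
have hsym : shifts L L t (psi (b + cz_sigma b)).
  pose c := b + cz_sigma b.
  have hcsh : shifts (x i) (x i) t c.
    by move=> s u hu; rewrite add_lfunE; apply: (fil_add hxi.1); [exact: hb|exact: hsb].
  have sc : cz_sigma c = c by rewrite /c (adjointD hh' _ _ adj') (adjointK hh' _ adj') addrC.
  have -> : psi c = (psi (c \o m e)%VF \o psi (m (e^-1)%R))%VF.
    by rewrite -cz_psiM -comp_lfunA mM mulfV // m1 comp_lfun1r.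
  have h1 : shifts L L (t + vr (@cz_val R X beta Y i) (e%:A : cz_D i)) (psi (c \o m e)%VF).
    apply/hc.
      rewrite (adjointM hh' _ _ adj') sc sm comp_lfunNl; congr (- _); exact: mC.
    move=> s u hu; rewrite comp_lfunE [t + _]addrC addrA.
    exact: hcsh (cz_homothety_shifts hxi e0 hu).
  have h2 : shifts L L (- vr (@cz_val R X beta Y i) (e%:A : cz_D i)) (psi (m e^-1)).
    apply/hc => //; rewrite -cz_E_inv //; apply: cz_homothety_shifts => //.
    by rewrite invr_eq0.
  move=> s u hu; rewrite comp_lfunE; have := h1 _ _ (h2 _ _ hu).
  by rewrite (_ : _ + _ = s + t) //; ring.
apply: shifts_half => // s u hu.
have -> : psi b u + psi b u = psi (b - cz_sigma b) u + psi (b + cz_sigma b) u.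
  by rewrite !cz_psiD cz_psiN !add_lfunE opp_lfunE addrACA addNr addr0.
by apply: (fil_add hL.1); [exact: hskew|exact: hsym].
Qed.

(** Projectors are symmetric, so skew compatibility does not control them directly. Skew scalars
    handle all components but one, and the remaining projector is 1 minus the others. *)
Lemma skew_compatible_pr (L : R -> set V) i r w : right_norm v L -> skew_compatible L ->
  L r w -> L r (pr i w).
Proof.
move=> hL hc hw.
have good j : has_skew_scalar j -> L r (pr j w).
  move=> hj; rewrite -cz_psi1 -[r]addr0; apply: (skew_scalar_compatible hL hc hj) hw => s u hu.
  by rewrite lfunE addr0.
have [hi|hi] := pselect (has_skew_scalar i); first exact: good.
have -> : pr i w = w - \sum_(j | j != i) pr j w.
  by rewrite {2}(pr_sum Y w) (bigD1 i) //= addrK.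
apply: (fil_sub hL.1) => //; apply: (fil_sum hL.1) => j ji; apply: good.
by apply: contrapT => hj; move/eqP: ji; apply; exact: bad_unique hj hi.
Qed.

Lemma self_dual_prP (L : R -> set V) i r w : right_norm v L -> skew_compatible L ->
  dual L = L -> pr i w = w ->
  (L r w <-> forall s y, pr i y = y -> L s y -> vge v (r + s) (h w y)).
Proof.
move=> hL hc hd pw; rewrite -{1}hd (hs_dual_geP _ _ hL); split=> [h1 s y _|h1 s y hy]; first exact: h1.
by rewrite -pw (herm_pr hall); apply: h1; [exact: pr_id|exact: skew_compatible_pr].
Qed.

(** Duality reverses translations: if [L'] is [L] translated by [c] and both are self-dual, then the
    translates by [c] and by [- c] coincide, whence [c = 0]. *)
Lemma good_component_unique (L L' : R -> set V) i : right_norm v L -> right_norm v L' ->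
  dual L = L -> dual L' = L' -> skew_compatible L -> skew_compatible L' ->
  has_skew_scalar i -> forall r w, pr i w = w -> (L' r w <-> L r w).
Proof.
move=> hL hL' hd hd' hc hc' hi r w pw.
have [c hcc] := cz_translation (hall i) (hx i) (hdual i) hL hL'
  (skew_scalar_compatible hL hc hi) (skew_scalar_compatible hL' hc' hi).
have [->|w0] := eqVneq w 0.
  by split=> _; [exact: fil_0 hL.1 _|exact: fil_0 hL'.1 _].
have sym s : L (s + c) w <-> L (s - c) w.
  rewrite -(hcc s w pw) (self_dual_prP _ hL' hc' hd' pw) (self_dual_prP _ hL hc hd pw).
  split=> h1 t y py hy.
    have -> : s - c + t = s + (t - c) by ring.
    by apply: h1 => //; apply/(hcc _ y py); rewrite subrK.
  have -> : s + t = s - c + (t + c) by ring.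
  by apply: h1 => //; apply/(hcc _ y py).
have [n hn] := fil_value hL.1 w0.
have c0 : c = 0.
  have h1 := sym (n - c); have h2 := sym (n + c); rewrite !hn in h1 h2.
  have e1 : n - c + c <= n by lra.
  have e2 : n + c - c <= n by lra.
  have := h1.1 e1; have := h2.2 e2; lra.
by rewrite hcc // c0 addr0.
Qed.

Theorem clf_unique (L L' : R -> set V) : right_norm v L -> right_norm v L' ->
  dual L = L -> dual L' = L' -> skew_compatible L -> skew_compatible L' ->
  (forall i, ~ has_skew_scalar i -> ~ hyperbolic (pr i)) -> L' = L.
Proof.
move=> hL hL' hd hd' hc hc' hyp.
have comp i r w : pr i w = w -> (L' r w <-> L r w).
  have [hi|hi] := pselect (has_skew_scalar i); first exact: good_component_unique.
  (* Here [E_i = k], so the centralizer contains every operator supported on [V_i], and all skew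
     ones are tested. *)
  have agree (L1 L2 : R -> set V) : skew_compatible L1 -> skew_compatible L2 ->
      skew_agree (pr i) L1 L2.
    move=> c1 c2 a sa pa ap t ha; have [_ hpsi] := @cz_psi_image R X beta Y i a.
    have [|b hb] := hpsi.
      split=> // y; have [c ->] := bad_scalar hi y; apply/lfunP => u.
      rewrite !comp_lfunE !cz_iotak lfun_ract.
      by rewrite -[pr i (a u)]comp_lfunE pa -[a (pr i u)]comp_lfunE ap.
    have sb : cz_sigma b = - b.
      by apply: (@cz_psi_inj R X beta Y i); rewrite cz_sigmaP // cz_psiN hb.
    by rewrite -hb; apply/(c2 i t b sb)/(c1 i t b sb); rewrite hb.
  have [|/(hyp i hi)//] := @skew_agree_dichotomy _ X (pr i) (@pr_id _ _ _ _ i) (herm_pr hall i)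
    L L' hL hL' hd hd' (fun s u => skew_compatible_pr i hL hc)
    (fun s u => skew_compatible_pr i hL' hc') (agree L L' hc hc') (agree L' L hc' hc).
  exact.
apply/funext => r; apply/seteqP; split=> w hw; rewrite (pr_sum Y w).
  by apply: (fil_sum hL.1) => i _; apply/(comp i r _ (pr_id i w)); exact: skew_compatible_pr.
by apply: (fil_sum hL'.1) => i _; apply/(comp i r _ (pr_id i w)); exact: skew_compatible_pr.
Qed.

End Uniqueness.

(** * The group O_2^is *)

Lemma poly_map_id (F K : fieldType) (f : {rmorphism F -> K}) (n : nat) (x : 'rV[K]_n) :
  poly_map f (fun j : 'I_n => mpoly.mpolyX F (mpoly.mnm1 j)) x = x.
Proof. by apply/rowP => j; rewrite mxE mpoly.mmapX mpoly.mmap1U. Qed.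

(** With matrix coordinates from a hyperbolic basis the unitary group is literally [O2is], so the
    identity polynomials give the isomorphism. *)
Lemma isomorphic_over_id (F K : fieldType) (f : {rmorphism F -> K}) n
    (P1 P2 : set 'rV[K]_n) (m1 m2 : 'rV[K]_n -> 'rV[K]_n -> 'rV[K]_n) :
  P1 = P2 -> (forall x y, m1 x y = m2 x y) ->
  isomorphic_over f (AffineGroup P1 m1) (AffineGroup P2 m2).
Proof.
move=> P12 m12; pose P j := mpoly.mpolyX F (mpoly.mnm1 (j : 'I_n)).
have hP x : poly_map f P x = x by exact: poly_map_id.
by exists P, P; split=> /=; rewrite ?P12 => *; rewrite ?hP.
Qed.

Section MatrixCoordinates.
Variables (F K : fieldType) (f : {rmorphism F -> K}) (A : zmodType).
Variables (mul : A -> A -> A) (one : A) (s : A -> A).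
Variables (mat : A -> 'M[F]_(1 + 1)) (bo : 'M[F]_(1 + 1) -> A).
Hypothesis matK : cancel mat bo.
Hypothesis boK : cancel bo mat.
Hypothesis mat_mul : forall a b, mat (mul a b) = mat a *m mat b.
Hypothesis mat_one : mat one = 1%:M.
Hypothesis mat_s : forall a, mat (s a) = \matrix_(p, q) mat a (rev_ord q) (rev_ord p).
Hypothesis two : (2 : K) != 0.

Let co a := mxvec (mat a).
Let oc x := bo (vec_mx x).
(** Reflection in the antidiagonal, the adjoint for the hyperbolic Gram matrix. *)
Let flip (M : 'M[K]_(1 + 1)) : 'M[K]_(1 + 1) := \matrix_(p, q) M (rev_ord q) (rev_ord p).

Lemma co_ext_basis i : mat (ext_basis oc i) = vec_mx (delta_mx 0 i).
Proof. by rewrite /ext_basis /oc boK. Qed.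

Lemma matrix_ext_mul x y : ext_mul f mul co oc x y = mxvec (vec_mx x *m vec_mx y).
Proof.
rewrite /ext_mul [in RHS](row_sum_delta x) [in RHS](row_sum_delta y).
rewrite [vec_mx (\sum_(j < _) x 0 j *: _)]linear_sum [vec_mx (\sum_(j < _) y 0 j *: _)]linear_sum /=.
rewrite mulmx_suml linear_sum; apply: eq_bigr => i _ /=.
rewrite mulmx_sumr linear_sum; apply: eq_bigr => j _ /=.
rewrite [vec_mx (x 0 i *: _)]linearZ [vec_mx (y 0 j *: _)]linearZ /=.
rewrite -scalemxAl -scalemxAr scalerA [RHS]linearZ /=; congr (_ *: _).
by rewrite /co mat_mul !co_ext_basis map_mxvec map_mxM !map_vec_mx !map_delta_mx.
Qed.

Lemma matrix_ext_inv x : ext_inv f s co oc x = mxvec (flip (vec_mx x)).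
Proof.
pose G y := mxvec (flip (vec_mx y)).
have GD y z : G (y + z) = G y + G z.
  rewrite /G -[RHS]linearD; congr (mxvec _).
  by apply/matrixP => p q; rewrite !mxE.
have GZ c y : G (c *: y) = c *: G y.
  rewrite /G -[RHS]linearZ; congr (mxvec _).
  by apply/matrixP => p q; rewrite !mxE.
have G0 : G 0 = 0 by have := GZ 0 0; rewrite !scale0r.
rewrite -[RHS]/(G x) [in RHS](row_sum_delta x) (big_morph G GD G0); apply: eq_bigr => i _.
rewrite GZ; congr (_ *: _); rewrite /co mat_s co_ext_basis map_mxvec; congr (mxvec _).
by apply/matrixP => p q; rewrite !mxE rmorph_nat.
Qed.

Lemma sum_ord2 (M : nmodType) (G : 'I_(1 + 1) -> M) :
  \sum_r G r = G (lshift 1 (0 : 'I_1)) + G (rshift 1 (0 : 'I_1)).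
Proof. by rewrite big_split_ord !big_ord1. Qed.

Lemma rev_ord2l : rev_ord (lshift 1 (0 : 'I_1)) = rshift 1 (0 : 'I_1).
Proof. exact: val_inj. Qed.

Lemma rev_ord2r : rev_ord (rshift 1 (0 : 'I_1)) = lshift 1 (0 : 'I_1).
Proof. exact: val_inj. Qed.

Lemma matrix2_eq (M N : 'M[K]_(1 + 1)) :
  M (lshift 1 0) (lshift 1 0) = N (lshift 1 0) (lshift 1 0) ->
  M (lshift 1 0) (rshift 1 0) = N (lshift 1 0) (rshift 1 0) ->
  M (rshift 1 0) (lshift 1 0) = N (rshift 1 0) (lshift 1 0) ->
  M (rshift 1 0) (rshift 1 0) = N (rshift 1 0) (rshift 1 0) -> M = N.
Proof.
move=> h1 h2 h3 h4; apply/matrixP => p q.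
by case: (split_ordP p) => i ->; case: (split_ordP q) => j ->; rewrite !ord1.
Qed.

(** For a matrix with rows [(a, b)] and [(c, d)] the equations are [a d + b c = 1] and
    [2 b d = 2 a c = 0]; since 2 is invertible, the matrix is diagonal or antidiagonal with inverse
    entries. *)
Lemma matrix_unitary_O2is :
  isomorphic_over f (unitary_group f mul one s co oc) (O2is K).
Proof.
apply: isomorphic_over_id; last exact: matrix_ext_mul.
apply/seteqP; split=> x /=.
  rewrite matrix_ext_mul matrix_ext_inv mxvecK /co mat_one map_mxvec map_mx1.
  move/(can_inj mxvecK); have xM : x = mxvec (vec_mx x) by rewrite vec_mxK.
  move: (vec_mx x) xM => M xM hM.
  have e p q := congr1 (fun N : 'M[K]_(1 + 1) => N p q) hM.
  have := e (lshift 1 0) (lshift 1 0); have := e (lshift 1 0) (rshift 1 0).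
  have := e (rshift 1 0) (lshift 1 0); have := e (rshift 1 0) (rshift 1 0).
  rewrite !mxE !sum_ord2 !mxE !rev_ord2l !rev_ord2r.
  set a := M (lshift 1 0) (lshift 1 0); set b := M (lshift 1 0) (rshift 1 0).
  set c := M (rshift 1 0) (lshift 1 0); set d := M (rshift 1 0) (rshift 1 0).
  rewrite !eqxx /= => e11 e10 e01 e00.
  have bd : b * d = 0.
    apply: (mulfI two); rewrite mulr0 -[RHS]e01; ring.
  have ac : a * c = 0.
    apply: (mulfI two); rewrite mulr0 -[RHS]e10; ring.
  move/eqP: bd; rewrite mulf_eq0 => /orP[/eqP b0|/eqP d0].
    have da : d * a = 1 by rewrite -[RHS]e00 b0 mul0r addr0.
    have a0 : a != 0 by apply: contra_eq_neq da => ->; rewrite mulr0 eq_sym oner_neq0.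
    have c0 : c = 0 by move/eqP: ac; rewrite mulf_eq0 (negbTE a0) => /eqP.
    exists a => //; left; rewrite xM; congr (mxvec _); apply: matrix2_eq;
      rewrite ?block_mxEul ?block_mxEur ?block_mxEdl ?block_mxEdr !mxE // eqxx mulr1n //.
    by apply: (mulIf a0); rewrite -/d da mulVf.
  have bc : b * c = 1 by rewrite -[RHS]e00 d0 mul0r add0r.
  have b0 : b != 0 by apply: contra_eq_neq bc => ->; rewrite mul0r eq_sym oner_neq0.
  have c0 : c != 0 by apply: contra_eq_neq bc => ->; rewrite mulr0 eq_sym oner_neq0.
  have a0 : a = 0 by move/eqP: ac; rewrite mulf_eq0 (negbTE c0) orbF => /eqP.
  exists b => //; right; rewrite xM; congr (mxvec _); apply: matrix2_eq;
    rewrite ?block_mxEul ?block_mxEur ?block_mxEdl ?block_mxEdr !mxE // eqxx mulr1n //.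
  by apply: (mulfI b0); rewrite -/c bc mulfV.
case=> l l0 hx; rewrite matrix_ext_mul matrix_ext_inv mxvecK /co mat_one map_mxvec map_mx1.
congr (mxvec _).
by case: hx => ->; rewrite mxvecK; apply: matrix2_eq;
  rewrite !mxE !sum_ord2 [flip _ _ _]mxE [flip _ _ (rshift _ _)]mxE ?rev_ord2l ?rev_ord2r
    ?block_mxEul ?block_mxEur ?block_mxEdl ?block_mxEdr ?mxE ?eqxx
    ?mulr1n ?mul0r ?mulr0 ?addr0 ?add0r ?mulVf ?mulfV.
Qed.

End MatrixCoordinates.

Section HyperbolicComponent.
Variables (R : realType) (X : hermitian_space R) (beta : 'End(hs_V X)).
Variables (Y : centralizer_datum beta).
Hypothesis hall : forall i, i \in cz_I0 Y.
Variable i : cz_I Y.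
Local Notation k := (hs_k X).
Local Notation D := (hs_D X).
Local Notation V := (hs_V X).
Local Notation sigma := (@hs_sigma R X).
Local Notation h := (@hs_h R X).
Local Notation rho := (@hs_rho R X).
Local Notation emb := (in_alg D : {rmorphism k -> D}).
Local Notation E := (cz_E i).
Local Notation E0 := (cz_E0 i).
Local Notation incl := (@cz_incl R X beta Y i).
Local Notation iota := (@cz_iota R X beta Y i).
Local Notation psi := (@cz_psi R X beta Y i).
Local Notation pr := (iota 1).
Let hh := hs_herm X.
Let hadj : is_adjoint h sigma := @hs_adjoint R X.
Hypothesis hbad : ~ has_skew_scalar i.
Hypothesis hD : forall x : D, exists c, x = emb c.
Hypothesis hrho : forall x, rho x = x.
Hypothesis heps : hs_eps X = 1.

(** As [rho] is trivial, [sigma] fixes the scalars of [k], which therefore lie in [(E_i)_0]; [delta]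
    carries values of [h] into the field over which the matrices are formed. *)
Lemma hyperbolic_incl : exists delta : D -> E0, forall x c, x = emb c -> incl (delta x) = c%:A.
Proof.
have hsig c : sigma (iota c%:A) = iota c%:A.
  by have := cz_sigma_scalar (hall i) (tau := id) (fun c => hrho (emb c)) c.
have /choice[delta hdelta] : forall x, exists y, forall c, x = emb c -> incl y = c%:A.
  move=> x; have [c ->] := hD x; have [y hy] := (@cz_inclP R X beta Y i (hall i) c%:A).2 (hsig c).
  by exists y => d /(fmorph_inj emb) <-.
by exists delta.
Qed.

Lemma herm_sym_id x y : h x y = h y x.
Proof. by rewrite (herm_sym hh) heps hrho mul1r. Qed.

Variables g1 g2 : V.
Hypotheses (pg1 : pr g1 = g1) (pg2 : pr g2 = g2).
Hypotheses (g11 : h g1 g1 = 0) (g22 : h g2 g2 = 0) (g12 : h g1 g2 = 1).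
Hypothesis hpr : forall w, pr w = ract (h g2 w) g1 + ract (h g1 w) g2.

Let o0 : 'I_(1 + 1) := lshift 1 (0 : 'I_1).
Let o1 : 'I_(1 + 1) := rshift 1 (0 : 'I_1).
(** The hyperbolic basis, with [gd] its dual basis: the same vectors in reverse order, so that
    taking adjoints becomes reflection in the antidiagonal. *)
Let gg (p : 'I_(1 + 1)) : V := if p == o0 then g1 else g2.
Let gd (p : 'I_(1 + 1)) : V := if p == o0 then g2 else g1.

Let ord2_case (P : 'I_(1 + 1) -> Prop) : P o0 -> P o1 -> forall p, P p.
Proof. by move=> h0 h1 p; case: (split_ordP p) => j ->; rewrite ord1. Qed.

Let gdE p : gd p = gg (rev_ord p).
Proof. by elim/ord2_case: p; rewrite /gd /gg ?rev_ord2l ?rev_ord2r. Qed.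

Let ggE p : gg p = gd (rev_ord p).
Proof. by rewrite gdE rev_ordK. Qed.

Let pr_gg p : pr (gg p) = gg p.
Proof. by rewrite /gg; case: ifP. Qed.

Let dual_gg p q : h (gd p) (gg q) = (p == q)%:R.
Proof.
have g21 : h g2 g1 = 1 by rewrite herm_sym_id.
by elim/ord2_case: p; elim/ord2_case: q; rewrite /gd /gg /= ?eqxx.
Qed.

Let pr_expand w : pr w = \sum_p ract (h (gd p) w) (gg p).
Proof. by rewrite sum_ord2 hpr. Qed.

(** All of [D], [k], [E_i] and [(E_i)_0] are identified here, and [End(V'_i)] becomes, through
    [psi], the ring of 2 by 2 matrices in the hyperbolic basis. *)
Theorem hyperbolic_O2is_basis : H_is_O2is i.
Proof.
have [delta hdelta] := hyperbolic_incl.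
have inclI : injective incl := fmorph_inj incl.
have deltaD x y : delta (x + y) = delta x + delta y.
  have [a ea] := hD x; have [b eb] := hD y; apply: inclI.
  by rewrite rmorphD (hdelta _ _ ea) (hdelta _ _ eb) -scalerDl; apply: hdelta;
    rewrite ea eb rmorphD.
have deltaM x y : delta (x * y) = delta x * delta y.
  have [a ea] := hD x; have [b eb] := hD y; apply: inclI.
  rewrite rmorphM (hdelta _ _ ea) (hdelta _ _ eb) mulr_algl scalerA; apply: hdelta.
  by rewrite ea eb rmorphM.
have delta_nat n : delta n%:R = n%:R.
  by apply: inclI; rewrite rmorph_nat (hdelta _ n%:R) ?rmorph_nat // scaler_nat.
have delta0 : delta 0 = 0 := delta_nat 0%N.
have delta_sum (F : 'I_(1 + 1) -> D) : delta (\sum_p F p) = \sum_p delta (F p).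
  exact: (big_morph delta deltaD delta0).
have /choice[eta heta] : forall y : E0, exists x : D, delta x = y.
  move=> y; have [c hc] := bad_scalar hall hbad (incl y); exists (emb c); apply: inclI.
  by rewrite hc; apply: hdelta.
have deltaI : injective delta.
  move=> x y; have [a ea] := hD x; have [b eb] := hD y => /(congr1 incl).
  by rewrite (hdelta _ _ ea) (hdelta _ _ eb) => /(fmorph_inj (in_alg E)) ab; rewrite ea eb ab.
have etaK x : eta (delta x) = x by apply: deltaI; rewrite heta.
pose mat (a : 'End(cz_V i)) : 'M[E0]_(1 + 1) := \matrix_(p, q) delta (h (gd p) (psi a (gg q))).
pose Aop (M : 'M[E0]_(1 + 1)) : 'End(V) :=
  \sum_p \sum_q rank1 h (ract (eta (M p q)) (gg p)) (gd q).
have AopE M w : Aop M w = \sum_p \sum_q ract (h (gd q) w) (ract (eta (M p q)) (gg p)).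
  rewrite sum_lfunE; apply: eq_bigr => p _; rewrite sum_lfunE; apply: eq_bigr => q _.
  exact: (rank1E hh).
have pr_gd q w : h (gd q) (pr w) = h (gd q) w.
  by rewrite -(herm_pr hall) gdE pr_gg.
have /choice[bo hbo] : forall M, exists b : 'End(cz_V i), psi b = Aop M.
  move=> M; have [_ hpsi] := @cz_psi_image R X beta Y i (Aop M); apply: hpsi; split.
    apply/lfunP => w; rewrite comp_lfunE AopE lfun_sum; apply: eq_bigr => p _.
    by rewrite lfun_sum; apply: eq_bigr => q _; rewrite !lfun_ract pr_gg.
  move=> y; have [c ->] := bad_scalar hall hbad y; apply/lfunP => w.
  rewrite !comp_lfunE !cz_iotak lfun_ract; congr (ract _ _).
  rewrite !AopE lfun_sum; apply: eq_bigr => p _; rewrite lfun_sum; apply: eq_bigr => q _.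
  by rewrite !lfun_ract pr_gg pr_gd.
have psi_gg a q : psi a (gg q) = \sum_p ract (h (gd p) (psi a (gg q))) (gg p).
  by rewrite -pr_expand pr_psi.
have matK : cancel mat bo.
  move=> a; apply: (@cz_psi_inj R X beta Y i); apply/lfunP => w.
  rewrite hbo AopE -[RHS]psi_pr pr_expand lfun_sum exchange_big; apply: eq_bigr => q _.
  rewrite lfun_ract psi_gg ract_sum; apply: eq_bigr => p _.
  by rewrite mxE etaK.
have boK : cancel bo mat.
  move=> M; apply/matrixP => p q; rewrite mxE hbo AopE (herm_sumr hh).
  rewrite (bigD1 p) //= [X in _ + X]big1 ?addr0; last first.
    move=> p' pp'; rewrite (herm_sumr hh) big1 // => q' _.
    by rewrite !(herm_ractr hh) dual_gg eq_sym (negbTE pp') !mul0r.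
  rewrite (herm_sumr hh) (bigD1 q) //= [X in _ + X]big1 ?addr0; last first.
    by move=> q' qq'; rewrite !(herm_ractr hh) !dual_gg (negbTE qq') mulr0.
  by rewrite !(herm_ractr hh) !dual_gg !eqxx mul1r mulr1 heta.
have mat_mul a b : mat (a \o b)%VF = mat a *m mat b.
  apply/matrixP => p q; rewrite !mxE cz_psiM comp_lfunE (psi_gg b) lfun_sum (herm_sumr hh).
  by rewrite delta_sum; apply: eq_bigr => r _; rewrite !mxE lfun_ract (herm_ractr hh) deltaM.
have mat_one : mat \1%VF = 1%:M.
  by apply/matrixP => p q; rewrite !mxE cz_psi1 pr_gg dual_gg delta_nat.
have mat_s a : mat (cz_sigma a) = \matrix_(p, q) mat a (rev_ord q) (rev_ord p).
  apply/matrixP => p q; rewrite !mxE cz_sigmaP // -hadj herm_sym_id.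
  by rewrite [gg q]ggE [gd p]gdE.
have two : (2 : cz_Ebar i) != 0.
  rewrite -(rmorph_nat (cz_tau i)) fmorph_eq0 -(fmorph_eq0 incl) rmorph_nat.
  by rewrite -(rmorph_nat (in_alg E)) fmorph_eq0 (lf_2neq0 (hs_local X)).
exists ((1 + 1) * (1 + 1))%N, (fun a => mxvec (mat a)), (fun x => bo (vec_mx x)); split; last first.
  exact: matrix_unitary_O2is.
split.
- move=> a b; rewrite -[RHS]linearD; congr (mxvec _); apply/matrixP => p q.
  by rewrite !mxE cz_psiD add_lfunE (sh_addr hh) deltaD.
- move=> c a; rewrite -[RHS]linearZ; congr (mxvec _); apply/matrixP => p q.
  rewrite !mxE cz_psiM cz_psiE comp_lfunE; have [d hd] := bad_scalar hall hbad (incl c).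
  rewrite hd cz_iotak pr_psi (herm_ractr hh) deltaM mulrC; congr (_ * _).
  by apply: inclI; rewrite hd; apply: hdelta.
- by move=> a; rewrite mxvecK matK.
by move=> x; rewrite boK vec_mxK.
Qed.

End HyperbolicComponent.

Lemma hyperbolic_O2is (R : realType) (X : hermitian_space R) (beta : 'End(hs_V X))
    (Y : centralizer_datum beta) (i : cz_I Y) : (forall i, i \in cz_I0 Y) ->
  ~ has_skew_scalar i -> hyperbolic (@cz_iota R X beta Y i 1) -> H_is_O2is i.
Proof.
move=> hall hbad [hD hr he [g1 [g2 [pg1 pg2 g11 g22 [g12 hpr]]]]].
exact: (hyperbolic_O2is_basis hall hbad hD hr he pg1 pg2 g11 g22 g12 hpr).
Qed.

(** * CLF-maps *)

Section Buildings.
Variables (R : realType) (X : hermitian_space R) (beta : 'End(hs_V X)).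
Variables (Y : centralizer_datum beta).
Hypothesis hall : forall i, i \in cz_I0 Y.
Local Notation sigma := (@hs_sigma R X).
Local Notation h := (@hs_h R X).
Local Notation psi := (@cz_psi R X beta Y _).
Local Notation pr i := (@cz_iota R X beta Y i 1).
Let hh := hs_herm X.
Let hadj : is_adjoint h sigma := @hs_adjoint R X.

Let factor_mem i : i \in cz_I0 Y :|: cz_Ip Y.
Proof. by rewrite inE hall. Qed.

Let factor i : factorH Y := exist _ i (factor_mem i).

Lemma lieH_embedE (b : forall j : factorH Y, 'End(cz_V (val j))) :
  lieH_embed b = \sum_j psi (b j).
Proof. by apply: eq_bigr => j _; rewrite hall. Qed.

Lemma pr_lieH_embed (b : forall j : factorH Y, 'End(cz_V (val j))) j w :
  pr (val j) (lieH_embed b w) = psi (b j) w.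
Proof.
rewrite lieH_embedE sum_lfunE lfun_sum (bigD1 j) //= big1 ?addr0 ?pr_psi // => j' jj'.
by rewrite pr_psi_ortho // eq_sym (inj_eq val_inj).
Qed.

Lemma lieH_embed_skew (b : forall j : factorH Y, 'End(cz_V (val j))) :
  lieH_mem b -> sigma (lieH_embed b) = - lieH_embed b.
Proof.
move=> hb; apply: (adjoint_unique hh) => // u w.
rewrite lieH_embedE opp_lfunE !sum_lfunE (herm_suml hh) (hermNr hh) (herm_sumr hh) -sumrN.
apply: eq_bigr => j _; rewrite hadj -cz_sigmaP // hb // cz_psiN opp_lfunE.
by rewrite (hermNr hh).
Qed.

Let point (x : buildingH Y) (i : cz_I Y) : R -> set (cz_V i) := sval x (factor i).
Arguments point : clear implicits.

Let pointE x (j : factorH Y) : point x (val j) = sval x j.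
Proof. by case: j => i ij; rewrite /point /factor (bool_irrelevance (factor_mem i) ij). Qed.

Let point_latf (x : buildingH Y) i :
  is_lattice_function (@cz_val R X beta Y i) (fine (cz_val (cz_pi i))) (point x i).
Proof. exact: (svalP x (factor i)).1. Qed.

Let point_dual (x : buildingH Y) i :
  dual_lattice_function (@cz_val R X beta Y i) (@cz_h R X beta Y i) (point x i) = point x i.
Proof. exact: ((svalP x (factor i)).2 (hall i)). Qed.

Let buildingG_norm (L : buildingG X) : right_norm (@hs_val R X) (sval L).
Proof. exact: hs_latf_right_norm (svalP L).1. Qed.

(** A compatible self-dual norm is chosen at each point. Compatibility is one inclusion of
    filtrations; rigidity, applied to each component of an operator, is the other. *)
Lemma exists_CLF : exists f : buildingH Y -> buildingG X, is_CLF f.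
Proof.
have /choice[f hf] : forall x, exists L : buildingG X, clf_compatible (point x) (sval L).
  move=> x; have [L [hL hc hd]] := exists_self_dual_clf hall (point_latf x) (point_dual x).
  by exists (exist _ L (conj (hs_right_norm_latf hL) hd)).
exists f => x t; apply/seteqP; split=> [a [b [hb hs ->]]|a [[b hb ->] [hs _]]].
  split; first by exists b.
  split; last exact: lieH_embed_skew.
  move=> s w hw; rewrite lieH_embedE sum_lfunE.
  apply: (fil_sum (buildingG_norm (f x)).1) => j _.
  apply: (hf x (val j)) hw; move: (hs j).
  by rewrite pointE.
exists b; split=> // j.
suff : shifts (point x (val j)) (point x (val j)) t (b j) by rewrite pointE.
apply: (cz_rigidity (hall (val j)) (point_latf x _) (point_dual x _) (buildingG_norm (f x)).1).
  by move=> t' b' hb'; exact: hf.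
by move=> s w hw; rewrite -pr_lieH_embed; apply: (clf_compatible_pr _ (hf x)); exact: hs.
Qed.

(** The CLF condition is tested on the Lie algebra elements with a single nonzero component. *)
Lemma CLF_skew_compatible (f : buildingH Y -> buildingG X) x : is_CLF f ->
  skew_compatible (point x) (sval (f x)).
Proof.
move=> hf i t b hb.
pose B := @dfwith _ (fun j : factorH Y => 'End(cz_V (val j))) (fun j => 0) (factor i) b.
have Bi : B (factor i) = b by exact: dfwith_in.
have Bo j : j != factor i -> B j = 0 by move=> ji; apply: dfwith_out; rewrite eq_sym.
have hB : lieH_mem B.
  move=> j _; have [->|ji] := eqVneq j (factor i); first by rewrite Bi.
  rewrite Bo // oppr0; apply: (@cz_psi_inj R X beta Y (val j)).
  rewrite cz_sigmaP // cz_psi0; apply: (adjoint_unique hh) => // u w.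
  by rewrite !lfunE /= (herm0l hh) (herm0r hh).
have eB : lieH_embed B = psi b.
  rewrite lieH_embedE (bigD1 (factor i)) //= big1 ?addr0 ?Bi // => j ji.
  by rewrite Bo // cz_psi0.
have sb : sigma (psi b) = - psi b by rewrite -eB lieH_embed_skew.
split=> [hs|hs].
  have : lieH_filtration x t (psi b).
    exists B; split=> // j; have [->|ji] := eqVneq j (factor i); first by rewrite Bi.
    rewrite Bo // => s w _; rewrite lfunE.
    have := fil_0 (cz_latf_right_norm (point_latf x (val j))).1 (s + t).
    by rewrite pointE.
  by rewrite hf => -[_ []].
have : lieH_filtration x t (psi b) by rewrite hf; split=> //; exists B.
case=> b' [_ hb' e].
have <- : b' (factor i) = b; last by move=> s w; exact: (hb' (factor i) s w).
apply: (@cz_psi_inj R X beta Y i); apply/lfunP => w.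
by have := pr_lieH_embed b' (factor i) w; rewrite -e pr_psi.
Qed.

Lemma CLF_unique (f f' : buildingH Y -> buildingG X) :
  (forall i : cz_I Y, ~ has_skew_scalar i -> ~ hyperbolic (pr i)) ->
  is_CLF f -> is_CLF f' -> f = f'.
Proof.
move=> hyp hf hf'; apply/funext => x.
suff : sval (f x) = sval (f' x).
  by case: (f x) (f' x) => L hL [L' hL'] /= e; move: hL hL'; rewrite e => hL hL'; congr exist.
apply: (clf_unique hall (point_latf x) (point_dual x)) => //.
- exact: (svalP (f' x)).2.
- exact: (svalP (f x)).2.
- exact: CLF_skew_compatible.
- exact: CLF_skew_compatible.
Qed.

End Buildings.

Theorem theorem9p2 (R : realType) (X : hermitian_space R)
    (beta : 'End(hs_V X)%type) (Y : centralizer_datum beta)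
    (hplus : cz_Ip Y = finset.set0)
    (hO2 : forall i : cz_I Y, i \in cz_I0 Y -> ~ H_is_O2is i) :
  exists! f : buildingH Y -> buildingG X, is_CLF f.
Proof.
have hall i : i \in cz_I0 Y.
  have := cz_Ip_cover Y; rewrite hplus imset0 finset.setU0 => e.
  by rewrite -[cz_I0 Y]finset.setCK -e finset.setC0 inE.
have [f hf] := exists_CLF hall; exists f; split=> // f' hf'.
apply: (CLF_unique hall) => // i hbad hyp.
exact: (hO2 i (hall i) (hyperbolic_O2is hall hbad hyp)).
Qed.
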